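(* Suppose that $X$ is a (finite-dimensional) ANR. Then $X$ satisfies the piecewise disjoint arc-disk property* (P-DADP* ) if and only if $X$ satisfies the strong fuzzy ribbons property (FRP* ).
   Context: All spaces are finite-dimensional. ANRs are locally contractible, locally compact, separable metric spaces. $I=[0,1]$; $D^2$ is the disk; maps are continuous; 1-complexes are finite. A map $f':Z\to X$ ($Z$ compact) is an $\epsilon$-approximation of $f:Z\to X$ if $\rho(f(z),f'(z))<\epsilon$ for all $z$, $\rho$ being the metric of $X$. An $\epsilon$-homotopy is a homotopy $H:Z\times[0,1]\to X$ with $\mathrm{diam}\,H(\{z\}\times[0,1])<\epsilon$ for all $z$. For a cell complex $T$ of $D^2$ (a finite cell decomposition of $D^2$ into closed cells), $T^{(1)}$ is its 1-skeleton and $T^{(2)}$ its collection of 2-cells. P-DADP*: for every $f:D^2\to X$, every $\alpha:L\to X$ with $L$ a 1-complex, and every $\epsilon>0$, there are a cell complex $T$ of $D^2$ and $\epsilon$-approximations $f':D^2\to X$ of $f$ and $\alpha':L\to X-f'(T^{(1)})$ of $\alpha$ such that for each $\sigma\in T^{(2)}$ there is an $\epsilon$-homotopy $H_\sigma:L\times[0,1]\to X-f'(T^{(1)})$ from $\alpha'$ to a map $\alpha'':L\to X-f'(\sigma)$ ($\alpha''$ may depend on $\sigma$). A topographical map pair is an ordered pair of maps $(f,\tau)$ with $f:Z\to X$ and $\tau:Z\to I$. It is in the category $\mathcal{K}$ if $Z=K\times I$ for some 1-complex $K$ and $K\times\{e\}\subset\tau^{-1}(e)$ for $e=0,1$. A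 pair $(f,\tau)\in\mathcal{K}$ is in $\mathcal{K}_c$ if $f:K\times I\to X$ is a constant homotopy ($f(x,t)=f(x,0)$ for all $x,t$) and $\tau(x,t)=t$. For $(f_i,\tau_i)\in\mathcal{K}$ with domain $K_i\times I$ ($i=1,2$), $(f_1,\tau_1)$ is fractured over $(f_2,\tau_2)$ if there are disjoint balls (closed 2-cells) $B_1,\dots,B_m$ in $K_1\times I$ such that (1) $f_1^{-1}(\mathrm{im}(f_2))\subset\bigcup_{j=1}^m\mathrm{int}(B_j)$; and (2) $\tau_2(f_2^{-1}(f_1(B_j)))\neq I$ for each $j$. FRP*: for any topographical map pairs $(f_1,\tau_1)\in\mathcal{K}$ and $(f_2,\tau_2)\in\mathcal{K}_c$ and any $\epsilon>0$, there are topographical map pairs $(f'_i,\tau'_i)\in\mathcal{K}$, $i=1,2$, such that $f'_i$ is an $\epsilon$-approximation of $f_i$, $\tau'_2$ is the natural projection $\tau'_2(x,t)=t$, and $(f'_1,\tau'_1)$ is fractured over $(f'_2,\tau'_2)$. *)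

(* Defs.v *)
From HB Require Import structures.
From mathcomp Require Import all_boot all_order all_algebra.
From mathcomp Require Import all_classical all_reals all_analysis.
Set Implicit Arguments.
Unset Strict Implicit.
Unset Printing Implicit Defensive.
Import Order.TTheory GRing.Theory Num.Theory.
Import numFieldNormedType.Exports.
Local Open Scope classical_set_scope.
Local Open Scope card_scope.
Local Open Scope ring_scope.

(* A map from a compact space Z to Y is represented by a total function on an
   ambient space of Z which is continuous on the set Z; its values outside Z are
   never used. *)
Definition map_on (S Y : topologicalType) (Z : set S) (W : set Y) (f : S -> Y) :=
  {within Z, continuous f} /\ f @` Z `<=` W.

Definition II (R : realType) : set R := [set` `[0, 1]].
Arguments II : clear implicits.

Definition disk (R : realType) k : set 'rV[R]_k :=
  [set x | \sum_i x ord0 i ^+ 2 <= 1].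
Definition open_disk (R : realType) k : set 'rV[R]_k :=
  [set x | \sum_i x ord0 i ^+ 2 < 1].
Definition sphere (R : realType) k : set 'rV[R]_k :=
  [set x | \sum_i x ord0 i ^+ 2 = 1].
Arguments disk : clear implicits.
Arguments open_disk : clear implicits.
Arguments sphere : clear implicits.

(* h parametrizes a closed k-cell. The disk being compact, such an h is an
   embedding as soon as S is Hausdorff, which is the case of all the spaces S
   this is used for. *)
Definition cell_param (R : realType) (S : topologicalType) k
    (h : 'rV[R]_k -> S) :=
  {within disk R k, continuous h} /\
  (forall x y, disk R k x -> disk R k y -> h x = h y -> x = y).

Section cells.
Context {R : realType} {S : Type} {k : nat}.
Implicit Type h : 'rV[R]_k -> S.
Definition cell_carrier h : set S := h @` disk R k.
Definition cell_int h : set S := h @` open_disk R k.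
Definition cell_bd h : set S := h @` sphere R k.
End cells.

(* Finite cell decompositions of the disk D^2 into closed cells: D^2 is the
   disjoint union of the interiors of the cells, and the boundary of each cell
   is a union of cells of lower dimension. *)
Record cell_complex (R : realType) := CellComplex {
  cell : finType;
  cdim : cell -> nat;
  cparam : forall c, 'rV[R]_(cdim c) -> 'rV[R]_2;
  cdim_le2 : forall c, (cdim c <= 2)%N;
  cparamP : forall c, cell_param (@cparam c);
  cell_cover : disk R 2 = \bigcup_(c in [set: cell]) cell_int (@cparam c);
  cell_triv : trivIset [set: cell] (fun c => cell_int (@cparam c));
  cell_bdP : forall c, exists2 D : set cell,
    (forall d, D d -> (cdim d < cdim c)%N) &
    cell_bd (@cparam c) = \bigcup_(d in D) cell_carrier (@cparam d) }.
Arguments cparam {R} T c : rename.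

Definition skeleton1 (R : realType) (T : cell_complex R) : set 'rV[R]_2 :=
  \bigcup_(c in [set c : cell T | (cdim c <= 1)%N]) cell_carrier (cparam T c).

(* A finite (simplicial) 1-complex with vertices 0, ..., n-1 and an edge between
   i and j whenever adj i j; adj need not be symmetric. Its polyhedron is the
   standard geometric realization in R^n, vertex i being the i-th basis
   vector. *)
Record complex1 := Complex1 { vert : nat; adj : rel 'I_vert }.

Definition polyhedron (R : realType) (K : complex1) : set 'rV[R]_(vert K) :=
  [set x | exists i j (t : R), [/\ i = j \/ adj i j, 0 <= t <= 1 &
    x = (1 - t) *: delta_mx ord0 i + t *: delta_mx ord0 j]].
Arguments polyhedron : clear implicits.

Definition cyl (R : realType) (K : complex1) : set ('rV[R]_(vert K) * R) :=
  polyhedron R K `*` II R.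
Arguments cyl : clear implicits.

Section anr.
Context {R : realType} (X : metricType R).

Definition separable_space := exists2 D : set X, countable D & dense D.

Definition locally_contractible := forall (x : X) (U : set X), nbhs x U ->
  exists V : set X, [/\ nbhs x V, V `<=` U &
    exists (H : X * R -> X) (c : X), map_on (V `*` II R) U H /\
      forall y, V y -> H (y, 0) = y /\ H (y, 1) = c].

Definition ANR :=
  [/\ locally_contractible, locally_compact [set: X] & separable_space].

Definition open_cover (C : set (set X)) :=
  (forall U, C U -> open U) /\ \bigcup_(U in C) U = [set: X].

(* Lebesgue covering dimension at most n. *)
Definition covering_dim_le (n : nat) :=
  forall C : set (set X), finite_set C -> open_cover C ->
  exists D : set (set X), [/\ open_cover D,
    (forall V, D V -> exists2 U, C U & V `<=` U) &
    (forall x, [set V | D V /\ V x] #<= `I_n.+1)].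

Definition finite_dimensional := exists n, covering_dim_le n.
End anr.

Section approx.
Context {R : realType} {X : metricType R}.

Definition eps_approximation (S : Type) (Z : set S) (e : R) (f f' : S -> X) :=
  forall z, Z z -> mdist (f z) (f' z) < e.

Definition diam (A : set X) : \bar R :=
  ereal_sup [set (mdist p.1 p.2)%:E | p in A `*` A].

Definition eps_homotopy (S : topologicalType) (Z : set S) (W : set X) (e : R)
    (H : S * R -> X) (a b : S -> X) :=
  [/\ map_on (Z `*` II R) W H,
      forall z, Z z -> H (z, 0) = a z /\ H (z, 1) = b z &
      forall z, Z z -> (diam (H @` ([set z] `*` II R)) < e%:E)%E].
End approx.

Definition P_DADP_star (R : realType) (X : metricType R) :=
  forall (f : 'rV[R]_2 -> X) (L : complex1) (alpha : 'rV[R]_(vert L) -> X)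
    (e : R),
  map_on (disk R 2) [set: X] f -> map_on (polyhedron R L) [set: X] alpha ->
  0 < e ->
  exists (T : cell_complex R) (f' : 'rV[R]_2 -> X)
    (alpha' : 'rV[R]_(vert L) -> X),
  [/\ map_on (disk R 2) [set: X] f' /\ eps_approximation (disk R 2) e f f',
      map_on (polyhedron R L) (~` (f' @` skeleton1 T)) alpha' /\
        eps_approximation (polyhedron R L) e alpha alpha' &
      forall s : cell T, cdim s = 2%N ->
        exists (H : 'rV[R]_(vert L) * R -> X) (alpha'' : 'rV[R]_(vert L) -> X),
          map_on (polyhedron R L) (~` (f' @` cell_carrier (cparam T s))) alpha''
          /\ eps_homotopy (polyhedron R L) (~` (f' @` skeleton1 T)) e H
               alpha' alpha''].

Section topographical.
Context {R : realType} {X : metricType R}.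

Definition topographical_pair (S : topologicalType) (Z : set S)
    (f : S -> X) (tau : S -> R) :=
  map_on Z [set: X] f /\ map_on Z (II R) tau.

(* The categories K and K_c, for pairs with domain K x I. *)
Definition in_catK (K : complex1) (f : 'rV[R]_(vert K) * R -> X)
    (tau : 'rV[R]_(vert K) * R -> R) :=
  topographical_pair (cyl R K) f tau /\
  forall x, polyhedron R K x -> tau (x, 0) = 0 /\ tau (x, 1) = 1.

Definition in_catKc (K : complex1) (f : 'rV[R]_(vert K) * R -> X)
    (tau : 'rV[R]_(vert K) * R -> R) :=
  in_catK f tau /\
  forall x t, polyhedron R K x -> II R t -> f (x, t) = f (x, 0) /\ tau (x, t) = t.

(* The interior of a ball B_j is its interior as a 2-cell. *)
Definition fractured_over (K1 K2 : complex1)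
    (f1 : 'rV[R]_(vert K1) * R -> X) (tau1 : 'rV[R]_(vert K1) * R -> R)
    (f2 : 'rV[R]_(vert K2) * R -> X) (tau2 : 'rV[R]_(vert K2) * R -> R) :=
  exists (m : nat) (B : 'I_m -> 'rV[R]_2 -> 'rV[R]_(vert K1) * R),
  [/\ forall j, cell_param (B j) /\ cell_carrier (B j) `<=` cyl R K1,
      trivIset [set: 'I_m] (fun j => cell_carrier (B j)),
      cyl R K1 `&` f1 @^-1` (f2 @` cyl R K2) `<=`
        \bigcup_(j in [set: 'I_m]) cell_int (B j) &
      forall j, tau2 @` (cyl R K2 `&` f2 @^-1` (f1 @` cell_carrier (B j)))
        <> II R].
End topographical.

Definition FRP_star (R : realType) (X : metricType R) :=
  forall (K1 K2 : complex1)
    (f1 : 'rV[R]_(vert K1) * R -> X) (tau1 : 'rV[R]_(vert K1) * R -> R)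
    (f2 : 'rV[R]_(vert K2) * R -> X) (tau2 : 'rV[R]_(vert K2) * R -> R)
    (e : R),
  in_catK f1 tau1 -> in_catKc f2 tau2 -> 0 < e ->
  exists (f1' : 'rV[R]_(vert K1) * R -> X) (tau1' : 'rV[R]_(vert K1) * R -> R)
    (f2' : 'rV[R]_(vert K2) * R -> X) (tau2' : 'rV[R]_(vert K2) * R -> R),
  [/\ in_catK f1' tau1' /\ in_catK f2' tau2',
      eps_approximation (cyl R K1) e f1 f1' /\ eps_approximation (cyl R K2) e f2 f2',
      forall x t, polyhedron R K2 x -> II R t -> tau2' (x, t) = t &
      fractured_over f1' tau1' f2' tau2'].

(* Main.v *)
(** P-DADP* => FRP*. Move [f_1] off [alpha = f_2 (_, 0)] over the vertices of
    [K_1], and interpolate near them by local contractibility: this leaves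
    finitely many squares whose vertical sides miss [alpha]. Those in a given path
    component of [X] are laid out as parallel strips of a single disk, to which
    P-DADP* applies. The balls are the 2-cells of [T], slightly shrunk, and [f_2']
    runs back and forth through the homotopies [H_sigma] one after the other, so
    that it avoids each 2-cell at some time.

    FRP* => P-DADP*. Make [f] miss [alpha] along the lines of a coarse square grid,
    and apply FRP* to [f], seen as a map of the cylinder over an arc, and to the
    constant homotopy of [alpha]; this gives [g], [F] and balls [B_j] outside of
    which [g] misses [F], while [g] still misses [F] along the coarse lines. On each
    coarse square replace [g] by the following composite: blow the coarse square up
    to the whole square, push each ball off a small neighbourhood of its centre to
    its boundary, retract the whole square onto the coarse square, and apply [g].
    The new map meets [F] only near the (scaled down) centres of the balls. A fine
    grid which separates these centres has a 1-skeleton which misses [F], and each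
    of its 2-cells meets [F] only in the image of one ball [B_j]; running [F] up to
    a time at which it misses that ball gives the homotopy for this cell. That the
    interiors of the balls are open is invariance of domain in the plane, which is
    derived from winding numbers. *)
Require Import Defs.
From mathcomp Require Import all_boot all_order all_algebra.
From mathcomp Require Import all_classical all_reals all_analysis.
From mathcomp Require Import ring lra.
Set Implicit Arguments.
Unset Strict Implicit.
Unset Printing Implicit Defensive.
Import Order.TTheory GRing.Theory Num.Theory.
Import numFieldNormedType.Exports.
Local Open Scope classical_set_scope.
Local Open Scope ring_scope.

(** * Continuity *)

(** Neither property prescribes the approximations on a subset, and collars take the place of
    homotopy extension: a square is squeezed towards its middle, and short homotopies given by local
    contractibility fill the margins. This creates no intersection only where a definite distance to
    the other map is available, which is why walls and grid lines are first made to miss [alpha];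
    both properties allow this, see [arcs_disjoint]. The squares that join strips inside one disk
    exist only within a path component. In the converse, the balls may be large and interleaved, and
    a missed time is known for one ball at a time only, so a small cell whose image met those of two
    balls could not be handled; hence the concentration of the intersections near the centres.
    Pushing a ball to its boundary is a large move in the blown-up square, and it is the retraction
    to the coarse square that makes it small. A point which this retraction moves lands on a coarse
    line, where nothing meets. Copies in adjacent coarse squares agree since the pushing fixes the
    boundary of the unit square. *)

Section continuity.
Context {S T U : topologicalType}.

Lemma within_comp (A : set S) (B : set T) (f : S -> T) (g : T -> U) :
  {within A, continuous f} -> {within B, continuous g} -> f @` A `<=` B ->
  {within A, continuous (g \o f)}.
Proof.
move=> /subspace_continuousP cf /subspace_continuousP cg fAB.
apply/subspace_continuousP => x Ax; apply: cvg_comp (cg _ (fAB _ (ex_intro2 _ _ x Ax erefl))).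
move=> W /= BW; have := cf _ Ax _ BW; rewrite /fmap/= /within/= !nbhs_simpl/=.
apply: filterS => y + Ay => /(_ Ay); apply.
by apply: fAB; exists y.
Qed.

Lemma within_compT (A : set S) (f : S -> T) (g : T -> U) :
  {within A, continuous f} -> continuous g -> {within A, continuous (g \o f)}.
Proof. by move=> cf cg; apply: (within_comp cf (continuous_subspaceT cg) (@subsetT _ _)). Qed.

Lemma within_eq (A : set S) (f g : S -> T) :
  (forall x, A x -> f x = g x) -> {within A, continuous f} -> {within A, continuous g}.
Proof. by move=> fg; apply: subspace_eq_continuous => x /set_mem /fg. Qed.

Lemma within_setT (f : S -> T) : {within setT, continuous f} -> continuous f.
Proof. by rewrite continuous_subspace_setT. Qed.

Lemma within_pair (A : set S) (f : S -> T) (g : S -> U) :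
  {within A, continuous f} -> {within A, continuous g} ->
  {within A, continuous (fun x => (f x, g x))}.
Proof. by move=> cf cg x; apply: cvg_pair; [exact: cf|exact: cg]. Qed.

Lemma within_bigcup (I : finType) (A : I -> set S) (f : S -> T) :
  (forall i, closed (A i)) -> (forall i, {within A i, continuous f}) ->
  {within \bigcup_(i in [set: I]) A i, continuous f}.
Proof.
move=> cA cf.
suff H (s : seq I) : closed (\bigcup_(i in [set` s]) A i) /\
    {within \bigcup_(i in [set` s]) A i, continuous f}.
  have [_] := H (enum I); congr ({within _, continuous f}).
  by apply: eq_bigcupl; split => // i _ /=; rewrite mem_enum.
elim: s => [|i s [cs ws]].
  have -> : [set` [::]] = set0 :> set I by apply/seteqP; split => //.
  rewrite bigcup_set0; split; [exact: closed0|exact: continuous_subspace0].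
have -> : [set` i :: s] = [set i] `|` [set` s].
  by apply/seteqP; split=> [j|j] /=; rewrite inE => /predU1P.
rewrite bigcup_setU bigcup_set1; split; first exact: closedU.
exact: withinU_continuous.
Qed.

(* [g0] only supplies values outside of the pieces. *)
Lemma paste (I : finType) (A : I -> set S) (g : I -> S -> T) (g0 : S -> T) :
  (forall i, closed (A i)) -> (forall i, {within A i, continuous (g i)}) ->
  (forall i j x, A i x -> A j x -> g i x = g j x) ->
  exists2 f : S -> T, {within \bigcup_(i in [set: I]) A i, continuous f} &
    forall i x, A i x -> f x = g i x.
Proof.
move=> cA cg gg.
pose f x := if [pick i | `[< A i x >]] is Some i then g i x else g0 x.
have fE i x : A i x -> f x = g i x.
  move=> Aix; rewrite /f; case: pickP => [j /asboolP Ajx|/(_ i)]; first exact: gg.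
  by rewrite asboolT.
exists f => //; apply: within_bigcup => // i.
by apply: within_eq (cg i) => x /fE.
Qed.

Lemma paste2 (A B : set S) (f g : S -> T) : closed A -> closed B -> A `|` B = setT ->
  {within A, continuous f} -> {within B, continuous g} ->
  (forall x, A x -> B x -> f x = g x) ->
  exists2 h : S -> T, continuous h & (forall x, A x -> h x = f x) /\ (forall x, B x -> h x = g x).
Proof.
move=> cA cB AB cf cg fg.
have [|||h ch hE] := @paste bool (fun b => if b then A else B) (fun b => if b then f else g) f.
- by case.
- by case.
- by move=> [] [] x //= ? ?; [exact: fg|apply/esym; exact: fg].
exists h; last by split => x; [apply: (hE true)|apply: (hE false)].
apply: within_setT; rewrite -AB.
apply: continuous_subspaceW ch => x [Ax|Bx]; [by exists true|by exists false].
Qed.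

End continuity.

(** * Uniformity from compactness *)

Section compactness.
Context {R : realType}.

(** Compactness as a near-covering property, for the filter [0^'+]. Monotonicity in [r] makes a
    local constant an eventual statement near 0, so that no finite subcover has to be extracted. *)
Lemma compact_unif (S : topologicalType) (A : set S) (P : R -> S -> Prop) :
  compact A -> (forall r r' x, 0 < r' -> r' <= r -> P r x -> P r' x) ->
  (forall x, A x -> exists2 r, 0 < r & \forall y \near x, A y -> P r y) ->
  exists2 r, 0 < r & forall x, A x -> P r x.
Proof.
move=> /compact_near_coveringP/near_covering_withinP cA Pm loc.
have [] := cA R (0^'+) (fun r x => 0 < r -> P r x).
  move=> x /loc[r r0 Pr]; exists ((fun y => A y -> P r y), [set i | i <= r]) => /=.
    by split=> //; exact: nbhs_right_le.
  by move=> [y i] [/= Pry ir] Ay i0; apply: Pm ir _ => //; exact: Pry.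
move=> e /= e0 He; exists (e / 2); first by rewrite divr_gt0.
move=> x /(He (e / 2)); apply; rewrite ?divr_gt0//=.
by rewrite sub0r normrN gtr0_norm ?divr_gt0// ltr_pdivrMr// ltr_pMr// ltr1n.
Qed.

Lemma unif_cont (S : pseudoMetricType R) (X : metricType R) (A : set S) (f : S -> X) (e : R) :
  compact A -> {within A, continuous f} -> 0 < e ->
  exists2 d, 0 < d & forall x y, A x -> A y -> ball x d y -> mdist (f x) (f y) < e.
Proof.
move=> cA /subspace_continuousP cf e0.
have e20 : 0 < e / 2 by rewrite divr_gt0.
have [||d d0 H] := @compact_unif S A
  (fun d x => forall y, A y -> ball x d y -> mdist (f x) (f y) < e) cA.
- by move=> r r' x _ rr' H y Ay xy; apply: H => //; exact: le_ball xy.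
- move=> x Ax; have := cf x Ax => /metricType_numDomainType.cvgrPdist_lt/(_ _ e20).
  rewrite near_withinE => /nbhs_ballP[r /= r0 Hr].
  exists (r / 2); first by rewrite divr_gt0.
  near=> y => Ay z Az yz.
  have xy : ball x (r / 2) y by near: y; apply: nbhsx_ballx; rewrite divr_gt0.
  apply: le_lt_trans (metric_triangle _ (f x) _) _.
  rewrite [ltRHS]splitr ltrD//; last first.
    by apply: Hr => //; rewrite [r]splitr; exact: ball_triangle yz.
  rewrite metric_sym; apply: Hr => //; apply: le_ball xy.
  by rewrite ler_pdivrMr// ler_pMr// ler1n.
by exists d => // x y Ax; apply: H.
Unshelve. all: by end_near. Qed.

Lemma gap (S T : topologicalType) (X : metricType R) (A : set S) (B : set T)
    (f : S -> X) (g : T -> X) :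
  compact A -> compact B -> {within A, continuous f} -> {within B, continuous g} ->
  (forall a b, A a -> B b -> f a <> g b) ->
  exists2 c, 0 < c & forall a b, A a -> B b -> c <= mdist (f a) (g b).
Proof.
move=> cA cB /subspace_continuousP cf /subspace_continuousP cg fg.
have [||d d0 H] := @compact_unif _ (A `*` B) (fun d x => d <= mdist (f x.1) (g x.2))
  (compact_setX cA cB).
- by move=> r r' x _; exact: le_trans.
- move=> [a b] [/= Aa Bb].
  have D0 : 0 < mdist (f a) (g b) by rewrite mdist_gt0; apply/eqP/fg.
  have D30 : 0 < mdist (f a) (g b) / 4 by rewrite divr_gt0.
  exists (mdist (f a) (g b) / 4) => //.
  have := cf a Aa => /metricType_numDomainType.cvgrPdist_lt/(_ _ D30); rewrite near_withinE => fa.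
  have := cg b Bb => /metricType_numDomainType.cvgrPdist_lt/(_ _ D30); rewrite near_withinE => gb.
  exists ([set y | A y -> mdist (f a) (f y) < mdist (f a) (g b) / 4],
      [set y | B y -> mdist (g b) (g y) < mdist (f a) (g b) / 4]) => //=.
  move=> [y z] /= [H1 H2] [/= /H1{}H1 /H2{}H2].
  have := metric_triangle (f a) (f y) (g b); have := metric_triangle (f y) (g z) (g b).
  rewrite (metric_sym (g z) (g b)); lra.
by exists d => // a b Aa Bb; apply: (H (a, b)).
Qed.

(** A closed part of [A] is compact and has a closed image. This gives the continuity of the
    coordinates in a ball. *)
Lemma within_inverse (S T : topologicalType) (A : set S) (h : S -> T) (k : T -> S) :
  hausdorff_space T -> compact A -> {within A, continuous h} ->
  (forall x, A x -> k (h x) = x) -> {within h @` A, continuous k}.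
Proof.
move=> hT cA ch hk; apply/continuous_closedP => W cW.
apply/closed_subspaceP; exists (h @` (A `&` W)).
  apply: compact_closed => //; apply: continuous_compact; last exact: compact_closedI.
  by apply: continuous_subspaceW ch; exact: subIsetl.
apply/seteqP; split => y [].
  move=> [x [Ax Wx] <-] _; split; last by exists x.
  by rewrite /from_subspace/= hk.
by rewrite /from_subspace/= => + [x Ax xy]; rewrite -xy hk// => Wx; split; exists x.
Qed.

End compactness.

(* [continuous] being a mere notation, the tactic [cts] needs a head symbol to
   match on. *)
Definition cts {S T : topologicalType} (f : S -> T) := continuous f.

(** * Closure properties behind the tactic [cts] *)

Section cts.
Context {R : realType} {S T U : topologicalType}.
Implicit Types f g : S -> R.

Lemma cts_cst (c : T) : cts (fun _ : S => c).
Proof. by move=> x; exact: cvg_cst. Qed.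
Lemma cts_id : cts (fun x : S => x).
Proof. by move=> x; exact: cvg_id. Qed.
Lemma cts_comp (h : T -> U) (f : S -> T) : cts h -> cts f -> cts (fun x => h (f x)).
Proof. by move=> ch cf x; apply: continuous_comp; [exact: cf|exact: ch]. Qed.
Lemma cts_pair (f : S -> T) (g : S -> U) : cts f -> cts g -> cts (fun x => (f x, g x)).
Proof. by move=> cf cg x; apply: cvg_pair; [exact: cf|exact: cg]. Qed.
Lemma cts_fst (f : S -> T * U) : cts f -> cts (fun x => (f x).1).
Proof. by move=> cf x; apply: cvg_comp (cf x) _; exact: cvg_fst. Qed.
Lemma cts_snd (f : S -> T * U) : cts f -> cts (fun x => (f x).2).
Proof. by move=> cf x; apply: cvg_comp (cf x) _; exact: cvg_snd. Qed.
Lemma cts_add f g : cts f -> cts g -> cts (fun x => f x + g x).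
Proof. by move=> cf cg x; apply: cvgD; [exact: cf|exact: cg]. Qed.
Lemma cts_opp f : cts f -> cts (fun x => - f x).
Proof. by move=> cf x; apply: cvgN; exact: cf. Qed.
Lemma cts_mul f g : cts f -> cts g -> cts (fun x => f x * g x).
Proof. by move=> cf cg x; apply: cvgM; [exact: cf|exact: cg]. Qed.
Lemma cts_inv f : cts f -> (forall x, f x != 0) -> cts (fun x => (f x)^-1).
Proof. by move=> cf f0 x; apply: cvgV; [exact: f0|exact: cf]. Qed.
Lemma cts_exp f n : cts f -> cts (fun x => f x ^+ n).
Proof.
move=> cf; elim: n => [|n IH]; first by move=> x; exact: cvg_cst.
by rewrite (_ : (fun _ => _) = fun x => f x * f x ^+ n); [exact: cts_mul|under eq_fun do rewrite exprS].
Qed.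
Lemma cts_norm f : cts f -> cts (fun x => `|f x|).
Proof. by move=> cf x; apply: cvg_comp (cf x) _; exact: norm_continuous. Qed.
Lemma cts_cos f : cts f -> cts (fun x => cos (f x)).
Proof. by move=> cf x; apply: cvg_comp (cf x) _; exact: continuous_cos. Qed.
Lemma cts_sin f : cts f -> cts (fun x => sin (f x)).
Proof. by move=> cf x; apply: cvg_comp (cf x) _; exact: continuous_sin. Qed.
Lemma cts_atan f : cts f -> cts (fun x => atan (f x)).
Proof. by move=> cf x; apply: cvg_comp (cf x) _; exact: continuous_atan. Qed.
Lemma cts_sqrt f : cts f -> cts (fun x => Num.sqrt (f x)).
Proof. by move=> cf x; exact: (continuous_comp (cf x) (@sqrt_continuous R (f x))). Qed.
Lemma cts_max f g : cts f -> cts g -> cts (fun x => Num.max (f x) (g x)).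
Proof. by move=> cf cg x; apply: continuous_max; [exact: cf|exact: cg]. Qed.
Lemma cts_min f g : cts f -> cts g -> cts (fun x => Num.min (f x) (g x)).
Proof. by move=> cf cg x; apply: continuous_min; [exact: cf|exact: cg]. Qed.
Lemma cts_sum (I : Type) (r : seq I) (P : pred I) (F : I -> S -> R) : (forall i, cts (F i)) ->
  cts (fun x => \sum_(i <- r | P i) F i x).
Proof.
move=> cF; elim: r => [|i r IH].
  by under eq_fun do rewrite big_nil; move=> x; exact: cvg_cst.
under eq_fun do rewrite big_cons.
by case: (P i) => //; apply: cts_add.
Qed.
Lemma cts_row n (F : 'I_n -> S -> R) : (forall i, cts (F i)) ->
  cts (fun x => \row_i F i x : 'rV[R]_n).
Proof.
move=> cF x A [B HB BA].
have : \forall y \near x, forall i j, B i j ((\row_k F k y : 'rV[R]_n) i j).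
  apply: filter_forall => i; apply: filter_forall => j.
  by under eq_near do rewrite mxE; apply: cF; have := HB i j; rewrite mxE.
by apply: filterS => y ?; exact: BA.
Qed.
Lemma cts_entry m n (f : S -> 'M[R]_(m, n)) i j : cts f -> cts (fun x => f x i j).
Proof. by move=> cf x; exact: (continuous_comp (cf x) (@coord_continuous R m n i j (f x))). Qed.
End cts.

Ltac cts_hook := fail.
Ltac cts1 := first [ cts_hook | lazymatch goal with
  | H : cts ?f |- cts ?f => exact: H
  | |- cts (fun x => x) => exact: cts_id
  | |- cts id => exact: cts_id
  | H : continuous ?f |- cts ?f => exact: H
  | |- cts (fun _ => ?c) => exact: cts_cst
  | |- cts (fun x => (@?f x, @?g x)) => apply: cts_pair
  | |- cts (fun x => (@?f x).1) => apply: cts_fst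
  | |- cts (fun x => (@?f x).2) => apply: cts_snd
  | |- cts (fun x => (@?f x + @?g x)%R) => apply: cts_add
  | |- cts (fun x => (- @?f x)%R) => apply: cts_opp
  | |- cts (fun x => @?f x * @?g x) => apply: cts_mul
  | |- cts (fun x => (@?f x)^-1) => apply: cts_inv
  | |- cts (fun x => @?f x ^+ _) => apply: cts_exp
  | |- cts (fun x => `|@?f x|) => apply: cts_norm
  | |- cts (fun x => cos (@?f x)) => apply: cts_cos
  | |- cts (fun x => sin (@?f x)) => apply: cts_sin
  | |- cts (fun x => atan (@?f x)) => apply: cts_atan
  | |- cts (fun x => Num.sqrt (@?f x)) => apply: cts_sqrt
  | |- cts (fun x => Num.max (@?f x) (@?g x)) => apply: cts_max
  | |- cts (fun x => Num.min (@?f x) (@?g x)) => apply: cts_min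
  | |- cts (fun x => \big[_/_]_(i <- _ | _) (@?f x i)) => apply: cts_sum => ?
  | |- cts (fun x => \row_i (@?f x i)) => apply: cts_row => ?
  | H : cts ?h |- cts (fun x => ?h (@?g x)) => apply: (cts_comp H)
  | H : continuous ?h |- cts (fun x => ?h (@?g x)) => apply: (cts_comp H)
  | H : forall i, cts (?h i) |- cts (fun x => ?h _ (@?g x)) => apply: (cts_comp (H _))
  | |- cts (fun x => fun_of_matrix (@?f x) _ _) => apply: cts_entry
  | |- cts (fun _ => _) => fail
  | |- cts ?f => change (cts (fun x => f x)); cts1
  end ].
Ltac cts := repeat cts1.

(** * The unit interval and the unit square *)

Section square.
Context {R : realType}.

Lemma small_invn (d : R) : 0 < d -> exists n : nat, n.+1%:R^-1 < d.
Proof.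
move=> d0; exists (Num.bound d^-1); rewrite -[ltRHS]invrK ltf_pV2 ?posrE ?invr_gt0//.
have dV : 0 <= d^-1 by rewrite invr_ge0 ltW.
by apply: lt_trans (archi_boundP dV) _; rewrite ltr_nat.
Qed.

Implicit Types (t u : R) (p : R * R).

(** [clamp] and [csq] are retractions onto the interval and the square. Composing with them turns
    maps known on [II R] or [sq R] into globally continuous ones, so that most later statements need
    no [within]. *)
Definition clamp t : R := Num.max 0 (Num.min 1 t).
Definition sq : set (R * R) := II R `*` II R.
Definition csq p := (clamp p.1, clamp p.2).

Lemma IIP t : II R t <-> 0 <= t <= 1.
Proof. by rewrite /II /= in_itv. Qed.
Lemma sqP p : sq p <-> 0 <= p.1 <= 1 /\ 0 <= p.2 <= 1.
Proof. by rewrite /sq/setX/= !IIP. Qed.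
Lemma compact_II : compact (II R).
Proof. exact: segment_compact. Qed.
Lemma compact_sq : compact sq.
Proof. by apply: compact_setX; exact: compact_II. Qed.
Lemma closed_II : closed (II R).
Proof. by apply: compact_closed; [exact: norm_hausdorff|exact: compact_II]. Qed.

Lemma clamp_ge0 t : 0 <= clamp t.
Proof. by rewrite /clamp le_max lexx. Qed.
Lemma clamp_le1 t : clamp t <= 1.
Proof. by rewrite /clamp ge_max ler01 ge_min lexx. Qed.
Lemma clamp_itv t : 0 <= clamp t <= 1.
Proof. by rewrite clamp_ge0 clamp_le1. Qed.
Lemma clamp_II t : II R (clamp t).
Proof. by rewrite IIP clamp_itv. Qed.
Lemma clamp_id t : 0 <= t <= 1 -> clamp t = t.
Proof. by move=> /andP[t0 t1]; rewrite /clamp (min_idPr t1) (max_idPr t0). Qed.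
Lemma clamp_le0 t : t <= 0 -> clamp t = 0.
Proof. by move=> t0; rewrite /clamp; apply/max_idPl; rewrite ge_min t0 orbT. Qed.
Lemma clamp_ge1 t : 1 <= t -> clamp t = 1.
Proof. by move=> t1; rewrite /clamp (min_idPl t1); apply/max_idPr. Qed.
Lemma segment_itv (p q s : R) : 0 <= p -> 0 <= q -> p + q <= 1 -> 0 <= s <= 1 ->
  0 <= p + q * s <= 1.
Proof.
move=> p0 q0 pq /andP[s0 s1]; have h1 : q * s <= q by rewrite ler_piMr.
by have h2 : 0 <= q * s; [exact: mulr_ge0|lra].
Qed.
Lemma csq_sq p : sq (csq p).
Proof. by split; exact: clamp_II. Qed.
Lemma csq_id p : sq p -> csq p = p.
Proof. by case: p => x y /sqP[/= ? ?]; rewrite /csq !clamp_id. Qed.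

Lemma cts_clamp (S : topologicalType) (f : S -> R) : cts f -> cts (fun x => clamp (f x)).
Proof. by move=> cf; rewrite /clamp; cts. Qed.
Lemma cts_csq (S : topologicalType) (f : S -> R * R) : cts f -> cts (fun x => csq (f x)).
Proof. by move=> cf; apply: cts_pair; apply: cts_clamp; cts. Qed.

Lemma within_csq (X : topologicalType) (f : R * R -> X) :
  {within sq, continuous f} -> continuous (fun p => f (csq p)).
Proof.
move=> cf; apply: within_setT; apply: within_comp cf _.
  by apply: continuous_subspaceT; apply: cts_csq; cts.
by move=> _ [p _ <-]; exact: csq_sq.
Qed.

End square.
Arguments sq : clear implicits.

Ltac cts_hook ::= match goal with
  | |- cts (fun x => clamp (@?f x)) => apply: cts_clamp
  | |- cts (fun x => csq (@?f x)) => apply: cts_csq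
  end.

(** * Invariance of domain in the plane *)

Section winding.
Context {R : realType}.
Implicit Types (z w : R * R) (t : R) (p : R * R).

(** In complex notation, [dot] and [crs] are the real and imaginary parts of conj(z) w. When
    [dot z w] is positive, [atan (crs z w / dot z w)] is the principal argument of w / z. *)
Definition dot z w := z.1 * w.1 + z.2 * w.2.
Definition crs z w := z.1 * w.2 - z.2 * w.1.

(** For [z] nonzero: [t] is an argument of the complex quotient w / z. *)
Definition rotated t z w := exists2 r, 0 < r &
  w.1 = r * (cos t * z.1 - sin t * z.2) /\ w.2 = r * (sin t * z.1 + cos t * z.2).

Lemma dot_gt0 z : z <> 0 -> 0 < dot z z.
Proof.
move=> z0; rewrite /dot -!expr2 lt_neqAle addr_ge0 ?sqr_ge0// andbT eq_sym.
rewrite paddr_eq0 ?sqr_ge0// !sqrf_eq0; apply/negP => /andP[/eqP z1 /eqP z2].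
by apply: z0; case: z z1 z2 => /= x y -> ->.
Qed.

Lemma cts_dot (S : topologicalType) (f g : S -> R * R) :
  cts f -> cts g -> cts (fun x => dot (f x) (g x)).
Proof. by move=> cf cg; rewrite /dot; cts. Qed.
Lemma cts_crs (S : topologicalType) (f g : S -> R * R) :
  cts f -> cts g -> cts (fun x => crs (f x) (g x)).
Proof. by move=> cf cg; rewrite /crs; cts. Qed.

Lemma rotated0 z : rotated 0 z z.
Proof. by exists 1 => //; rewrite cos0 sin0; split; ring. Qed.

Lemma rotated_step t z w w' : 0 < dot w w' -> rotated t z w ->
  rotated (t + atan (crs w w' / dot w w')) z w'.
Proof.
move=> D0 [r r0 [w1 w2]].
set q := crs w w' / dot w w'.
have c0 : 0 < cos (atan q) by rewrite cos_atan invr_gt0 sqrtr_gt0 ltr_pwDl// sqr_ge0.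
have sE : sin (atan q) = q * cos (atan q).
  by rewrite -[X in X * _]atanK /tan mulfVK// gt_eqF.
have N0 : 0 < dot w w.
  apply: dot_gt0 => w00; move: D0; rewrite w00 /dot /= !mul0r addr0.
  by rewrite ltxx.
have rw0 : r * dot w w' / (cos (atan q) * dot w w) > 0 by rewrite divr_gt0 ?mulr_gt0.
(* Since dot w w' = |w| |w'| cos (atan q), the ratio |w'| / |w| is dot w w' / (cos (atan q)
   |w|^2). *)
exists (r * dot w w' / (cos (atan q) * dot w w)) => //.
rewrite cosD sinD sE.
have E1 : cos t * z.1 - sin t * z.2 = w.1 / r by rewrite w1 mulrAC divff ?mul1r// gt_eqF.
have E2 : sin t * z.1 + cos t * z.2 = w.2 / r by rewrite w2 mulrAC divff ?mul1r// gt_eqF.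
have -> : (cos t * cos (atan q) - sin t * (q * cos (atan q))) * z.1 -
   (sin t * cos (atan q) + cos t * (q * cos (atan q))) * z.2 =
   cos (atan q) * (w.1 / r - q * (w.2 / r)) by rewrite -E1 -E2; ring.
have -> : (sin t * cos (atan q) + cos t * (q * cos (atan q))) * z.1 +
   (cos t * cos (atan q) - sin t * (q * cos (atan q))) * z.2 =
   cos (atan q) * (w.2 / r + q * (w.1 / r)) by rewrite -E1 -E2; ring.
have H1 := gt_eqF c0; have H2 := gt_eqF N0; have H3 := gt_eqF D0; have H4 := gt_eqF r0.
clear -H1 H2 H3 H4; move: H1 H2 H3; rewrite /q; move: (cos _) => c; rewrite /dot /crs.
move=> /negbT H1 /negbT H2 /negbT H3; move/negbT: H4 => H4.
by split; field; rewrite H1 H4 H3 H2.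
Qed.

(** The three inner products determine the cosine of [t - t']; [rotated_eq] and [rotated_opp] are
    the cases of equal and opposite vectors. *)
Lemma rotated_dot t t' z w w' : rotated t z w -> rotated t' z w' ->
  exists r r', [/\ 0 < r, 0 < r', dot w w = r ^+ 2 * dot z z, dot w' w' = r' ^+ 2 * dot z z &
    dot w w' = r * r' * cos (t - t') * dot z z].
Proof.
move=> [r r0 [w1 w2]] [r' r'0 [w1' w2']]; exists r, r'; split=> //.
- rewrite /dot w1 w2; have := cos2Dsin2 t; set c := cos t; set s := sin t => cs.
  transitivity (r ^+ 2 * ((c ^+ 2 + s ^+ 2) * (z.1 * z.1 + z.2 * z.2))); first by ring.
  by rewrite cs mul1r.
- rewrite /dot w1' w2'; have := cos2Dsin2 t'; set c := cos t'; set s := sin t' => cs.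
  transitivity (r' ^+ 2 * ((c ^+ 2 + s ^+ 2) * (z.1 * z.1 + z.2 * z.2))); first by ring.
  by rewrite cs mul1r.
- by rewrite /dot w1 w2 w1' w2' cosB; ring.
Qed.

Lemma rotated_eq t t' z w : z <> 0 -> rotated t z w -> rotated t' z w -> cos (t - t') = 1.
Proof.
move=> /dot_gt0 z0 a b; have [r [r' [r0 r'0 E1 E2 E3]]] := rotated_dot a b.
have rr : r = r'.
  apply: (@pexpIrn _ 2%N) => //; rewrite ?nnegrE ?ltW//.
  by apply: (mulIf (negbT (gt_eqF z0))); rewrite -E1.
apply: (@mulfI _ (r * r' * dot z z)); first by rewrite gt_eqF// !mulr_gt0.
by rewrite mulr1 mulrAC -E3 E1 -rr expr2.
Qed.

Lemma rotated_opp t t' z w : z <> 0 -> rotated t z w -> rotated t' z (- w) ->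
  cos (t - t') = -1.
Proof.
move=> /dot_gt0 z0 a b; have [r [r' [r0 r'0 E1 E2 E3]]] := rotated_dot a b.
have Dw : dot (- w) (- w) = dot w w by rewrite /dot /=; ring.
have Dw' : dot w (- w) = - dot w w by rewrite /dot /=; ring.
have rr : r = r'.
  apply: (@pexpIrn _ 2%N) => //; rewrite ?nnegrE ?ltW//.
  by apply: (mulIf (negbT (gt_eqF z0))); rewrite -E1 -E2 Dw.
apply: (@mulfI _ (r * r' * dot z z)); first by rewrite gt_eqF// !mulr_gt0.
by rewrite mulrN1 mulrAC -E3 Dw' E1 -rr expr2.
Qed.

Lemma rotated_sub t t' z w w' : rotated t z w -> rotated t' z w' -> rotated (t' - t) w w'.
Proof.
move=> [r r0 [w1 w2]] [r' r'0 [w1' w2']]; exists (r' / r); first exact: divr_gt0.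
rewrite w1 w2 w1' w2' cosB sinB; have := cos2Dsin2 t; have r00 := gt_eqF r0.
set c := cos t; set s := sin t => cs; split.
  transitivity (r' * ((c ^+ 2 + s ^+ 2) * (cos t' * z.1 - sin t' * z.2))).
    by rewrite cs mul1r.
  by field; rewrite r00.
transitivity (r' * ((c ^+ 2 + s ^+ 2) * (sin t' * z.1 + cos t' * z.2))).
  by rewrite cs mul1r.
by field; rewrite r00.
Qed.

(* The square is star-shaped about [0], so the argument of [G p] is a sum of
   principal arguments of the ratios of successive values of [G] on [[0, p]]. *)
Lemma angle_lift (G : R * R -> R * R) : cts G -> (forall p, sq R p -> G p <> 0) ->
  exists2 a : R * R -> R, cts a & forall p, sq R p -> rotated (a p) (G 0) (G p).
Proof.
move=> cG G0.
(* For [d]-close points the quotient of the values of [G] has positive real part, so that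
   [rotated_step] applies to it. *)
have [||d d0 Hd] := @compact_unif _ _ (sq R)
  (fun d p => forall q, sq R q -> ball p d q -> 0 < dot (G p) (G q)) compact_sq.
- by move=> r r' p _ rr' H q qs pq; apply: H => //; exact: le_ball pq.
- move=> p /G0 /dot_gt0 Gp.
  have : \forall xy \near (p, p), 0 < dot (G xy.1) (G xy.2).
    have cd : cts (fun xy : (R * R) * (R * R) => dot (G xy.1) (G xy.2)).
      by apply: cts_dot; cts.
    by have := cd (p, p) => /cvgr_gt; apply.
  move=> /nbhs_ballP[e /= e0 He].
  exists (e / 2); first by rewrite divr_gt0.
  near=> q => qs q' q's qq'.
  have pq : ball p (e / 2) q by near: q; apply: nbhsx_ballx; rewrite divr_gt0.
  apply: (He (q, q')); split => /=.
    by apply: le_ball pq; rewrite ler_pdivrMr// ler_pMr// ler1n.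
  by rewrite [e]splitr; exact: ball_triangle qq'.
have [n nd] := small_invn d0.
pose pt k p : R * R := (k%:R / n.+1%:R * clamp p.1, k%:R / n.+1%:R * clamp p.2).
have cpt k : cts (pt k) by rewrite /pt; cts.
have spt k p : (k <= n.+1)%N -> sq R (pt k p).
  move=> kn; have /andP[k0 k1] : 0 <= (k%:R / n.+1%:R : R) <= 1.
    by rewrite divr_ge0//= ler_pdivrMr// mul1r ler_nat.
  suff H (x : R) : 0 <= k%:R / n.+1%:R * clamp x <= 1 by apply/sqP; split; exact: H.
  by rewrite mulr_ge0 ?clamp_ge0//= mulr_ile1 ?clamp_ge0 ?clamp_le1.
have dpt k p : (k < n.+1)%N -> 0 < dot (G (pt k p)) (G (pt k.+1 p)).
  move=> kn; apply: Hd; [by apply: spt; exact: ltnW|exact: spt|].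
  suff H (x : R) : ball (k%:R / n.+1%:R * clamp x) d (k.+1%:R / n.+1%:R * clamp x) by split; exact: H.
  rewrite /ball/= -mulrBl -mulrBl -natr1 opprD addNKr mulN1r mulNr normrN.
  rewrite normrM !ger0_norm ?invr_ge0 ?clamp_ge0//; apply: le_lt_trans nd.
  by rewrite ler_piMr ?clamp_le1 ?invr_ge0.
pose ang k p := atan (crs (G (pt k p)) (G (pt k.+1 p)) / dot (G (pt k p)) (G (pt k.+1 p))).
have cang k : (k < n.+1)%N -> cts (ang k).
  move=> kn; apply: cts_atan; apply: cts_mul; first by apply: cts_crs; cts.
  by apply: cts_inv => [|p]; [apply: cts_dot; cts|rewrite gt_eqF// dpt].
have H k p : (k <= n.+1)%N -> rotated (\sum_(i < k) ang i p) (G 0) (G (pt k p)).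
  elim: k => [|k IH] kn.
    by rewrite big_ord0 /pt !mul0r; exact: rotated0.
  rewrite big_ord_recr/=; apply: rotated_step; first exact: dpt.
  by apply: IH; exact: ltnW.
exists (fun p => \sum_(i < n.+1) ang i p).
  by apply: cts_sum => i; apply: cang.
move=> p ps; have := H n.+1 p (leqnn _).
by rewrite /pt divff// !mul1r -/(csq p) csq_id.
Unshelve. all: by end_near. Qed.

(** If [d 0 < d 1], then [d] takes a value [d 0 + m] with 0 < m <= pi, whose cosine is k cos m
    because [sin (d 0) = 0]; but cos m < 1. *)
Lemma cos_const (d : R -> R) k : k != 0 -> cts d -> (forall t, 0 <= t <= 1 -> cos (d t) = k) ->
  (forall t, 0 <= t <= 1 -> sin (d t) = 0) -> d 0 = d 1.
Proof.
wlog : d / d 0 < d 1 => [W k0 cd dc ds|d01 k0 cd dc ds].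
  have [H|H|//] := ltgtP (d 0) (d 1); first exact: W dc ds.
  apply/oppr_inj; apply: (W (fun t => - d t)) => //; first by rewrite ltrN2.
  - by cts.
  - by move=> t ?; rewrite cosN dc.
  - by move=> t ?; rewrite sinN ds// oppr0.
pose m := Num.min pi (d 1 - d 0).
have m0 : 0 < m by rewrite lt_min pi_gt0 subr_gt0.
have mpi : m <= pi by rewrite ge_min lexx.
have md : d 0 + m <= d 1 by rewrite addrC -lerBrDr ge_min lexx orbT.
have [||c + cE] := @IVT R d 0 1 (d 0 + m) ler01.
- by apply: continuous_subspaceT.
- by rewrite (min_idPl (ltW d01)) (max_idPr (ltW d01)) md lerDl ltW.
rewrite in_itv/= => c01; have := dc _ c01; rewrite cE cosD dc ?lexx ?ler01//.
rewrite ds ?lexx ?ler01// mul0r subr0 => /(canRL (mulKf k0)); rewrite mulVf// => cm.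
have : cos m < cos 0 by rewrite ltr_cos ?in_itv/= ?lexx ?pi_ge0 ?mpi ?(ltW m0).
by rewrite cm cos0 ltxx.
Qed.

Lemma sin_eq0_cos t k : k ^+ 2 = 1 -> cos t = k -> sin t = 0.
Proof.
move=> k1 ck; have := cos2Dsin2 t; rewrite ck k1 => /eqP.
by rewrite -[X in _ == X]addr0 (inj_eq (addrI 1)) sqrf_eq0 => /eqP.
Qed.

Lemma cos_const1 (d : R -> R) : cts d -> (forall t, 0 <= t <= 1 -> cos (d t) = 1) -> d 0 = d 1.
Proof.
move=> cd d1; apply: (@cos_const d 1) => // t /d1.
by apply: sin_eq0_cos; rewrite expr1n.
Qed.

Lemma cos_constN1 (d : R -> R) : cts d -> (forall t, 0 <= t <= 1 -> cos (d t) = -1) -> d 0 = d 1.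
Proof.
move=> cd d1; apply: (@cos_const d (-1)) => // t /d1.
by apply: sin_eq0_cos; rewrite sqrrN expr1n.
Qed.

(** Winding number zero around the origin: an argument of [z], relative to [z 0], which closes
    up. *)
Definition winds0 (z : R -> R * R) := exists a : R -> R, [/\ cts a, a 0 = a 1 &
  forall t, 0 <= t <= 1 -> rotated (a t) (z 0) (z t)].

(** An argument on the whole square differs by a constant from the given one on the bottom side. It
    also increases equally along the two vertical sides, where [H] takes the same values; so it
    closes up on the top side. *)
Lemma winds0_homotopy (H : R * R -> R * R) : cts H -> (forall p, sq R p -> H p <> 0) ->
  (forall t, 0 <= t <= 1 -> H (0, t) = H (1, t)) ->
  winds0 (fun x => H (x, 0)) -> winds0 (fun x => H (x, 1)).
Proof.
move=> cH H0 Hl [a0 [ca0 a01 a0P]]; have [a ca aP] := angle_lift cH H0.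
have i0 : 0 <= (0 : R) <= 1 by rewrite lexx ler01.
have i1 : 0 <= (1 : R) <= 1 by rewrite lexx ler01.
have aP' x t : 0 <= x <= 1 -> 0 <= t <= 1 -> rotated (a (x, t)) (H (0, 0)) (H (x, t)).
  by move=> xi ti; apply: (aP (x, t)); apply/sqP.
have H00 : H (0, 0) <> 0 by apply: H0; apply/sqP.
have e1 : a (0, 0) - a0 0 = a (1, 0) - a0 1.
  apply: (@cos_const1 (fun x => a (x, 0) - a0 x)); first by cts.
  by move=> t ti; apply: rotated_eq H00 (aP' _ _ ti i0) (a0P _ ti).
have e2 : a (1, 0) - a (0, 0) = a (1, 1) - a (0, 1).
  apply: (@cos_const1 (fun t => a (1, t) - a (0, t))); first by cts.
  move=> t ti; apply: rotated_eq H00 (aP' _ _ i1 ti) _.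
  by rewrite -Hl//; exact: aP'.
exists (fun x => a (x, 1) - a (0, 1)); split; first by cts.
  by rewrite -e2 subrr; move: e1 a01; lra.
by move=> t ti; apply: rotated_sub (aP' _ _ i0 i1) (aP' _ _ ti i1).
Qed.

(** The increase of the argument over a half turn has cosine -1 and so is constant. The two half
    turns thus contribute equally, and a total increase of 0 would make each contribution 0, with
    cosine 1. *)
Lemma winds0_odd (z : R -> R * R) : z 0 <> 0 ->
  (forall t, 0 <= t <= 2^-1 -> z (t + 2^-1) = - z t) -> ~ winds0 z.
Proof.
move=> z0 zodd [a [ca a01 aP]].
have H t : 0 <= t <= 1 -> cos (a (t / 2) - a (t / 2 + 2^-1)) = -1.
  move=> ti; apply: rotated_opp z0 (aP _ _) _; first by lra.
  by rewrite -zodd; [apply: aP|]; lra.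
have E : a 0 - a (2^-1) = a (2^-1) - a 1.
  have := @cos_constN1 (fun t => a (t / 2) - a (t / 2 + 2^-1)).
  have -> : 1 / 2 + 2^-1 = 1 :> R by lra.
  by rewrite mul0r add0r div1r => -> //; cts.
have := H 0; rewrite mul0r add0r lexx ler01 => /(_ isT).
rewrite (_ : a 0 - _ = 0) ?cos0; last by move: E a01; lra.
by lra.
Qed.

End winding.

(** * The Euclidean norm and its disks *)

Section euclidean_norm.
Context {R : realType} {k : nat}.
Implicit Types (v : 'rV[R]_k) (c : R).

(** The norm [|v|] on row vectors is the maximum norm, whereas the disks and spheres are
    Euclidean. *)
Definition sqn v := \sum_i v ord0 i ^+ 2.
Definition nrm v := Num.sqrt (sqn v).

Lemma sqn_ge0 v : 0 <= sqn v.
Proof. by apply: sumr_ge0 => i _; exact: sqr_ge0. Qed.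
Lemma nrm_ge0 v : 0 <= nrm v.
Proof. exact: sqrtr_ge0. Qed.
Lemma sqr_nrm v : nrm v ^+ 2 = sqn v.
Proof. by rewrite sqr_sqrtr ?sqn_ge0. Qed.
Lemma sqnZ c v : sqn (c *: v) = c ^+ 2 * sqn v.
Proof. by rewrite /sqn mulr_sumr; apply: eq_bigr => i _; rewrite mxE exprMn. Qed.
Lemma nrmZ c v : nrm (c *: v) = `|c| * nrm v.
Proof. by rewrite /nrm sqnZ sqrtrM ?sqr_ge0// sqrtr_sqr. Qed.
Lemma nrm0 : nrm 0 = 0.
Proof. by rewrite -(scale0r 0) nrmZ normr0 mul0r. Qed.
Lemma sqn_cts : continuous sqn.
Proof. by rewrite -/(cts _) /sqn; cts. Qed.
Lemma nrm_cts : continuous nrm.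
Proof. by rewrite -/(cts _) /nrm /sqn; cts. Qed.

Lemma sqn_lt1 v : (sqn v < 1) = (nrm v < 1).
Proof. by rewrite -sqr_nrm expr_lt1// nrm_ge0. Qed.
Lemma sqn_le1 v : (sqn v <= 1) = (nrm v <= 1).
Proof. by rewrite -sqr_nrm expr_le1// nrm_ge0. Qed.
Lemma diskP v : disk R k v <-> nrm v <= 1.
Proof. by rewrite -sqn_le1. Qed.
Lemma open_diskP v : open_disk R k v <-> nrm v < 1.
Proof. by rewrite -sqn_lt1. Qed.
Lemma sphereP v : sphere R k v <-> nrm v = 1.
Proof.
rewrite /sphere/= -/(sqn v) -sqr_nrm; split=> [/eqP|->]; last by rewrite expr1n.
by rewrite sqrf_eq1 => /orP[/eqP//|/eqP nv]; have := nrm_ge0 v; rewrite nv; lra.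
Qed.
Lemma open_disk_sub v : open_disk R k v -> disk R k v.
Proof. by rewrite diskP open_diskP => /ltW. Qed.
Lemma sphere_disk v : sphere R k v -> disk R k v.
Proof. by rewrite sphereP diskP => ->. Qed.
Lemma disk_split v : disk R k v -> open_disk R k v \/ sphere R k v.
Proof. by rewrite diskP sphereP open_diskP le_eqVlt => /orP[/eqP|]; [right|left]. Qed.

Lemma entry_le_nrm v i : `|v ord0 i| <= nrm v.
Proof.
rewrite -sqrtr_sqr ler_sqrt ?sqn_ge0// /sqn (bigD1 i)//= lerDl.
by apply: sumr_ge0 => j _; exact: sqr_ge0.
Qed.

Lemma closed_disk : closed (disk R k).
Proof.
rewrite (_ : disk R k = sqn @^-1` [set x | x <= 1]) //.
by apply: preimage_closed; [move=> x _; exact: sqn_cts|exact: closed_le].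
Qed.
Lemma open_open_disk : open (open_disk R k).
Proof.
rewrite (_ : open_disk R k = sqn @^-1` [set x | x < 1]) //.
by apply: open_comp; [move=> x _; exact: sqn_cts|exact: open_lt].
Qed.
Lemma compact_disk : compact (disk R k).
Proof.
apply: bounded_closed_compact closed_disk.
exists 1; split; first exact: num_real.
move=> M M1 v /diskP nv; rewrite /= (_ : `|v| = mx_norm v)// mx_normrE; apply: bigmax_le => [|[i j] _] /=.
  by apply/ltW; exact: lt_trans M1.
by rewrite ord1; apply: le_trans (entry_le_nrm _ _) _; apply: le_trans nv (ltW M1).
Qed.

Definition retr v := (Num.max 1 (nrm v))^-1 *: v.
Lemma max1_gt0 x : 0 < Num.max 1 x :> R.
Proof. by rewrite lt_max ltr01. Qed.
Lemma retr_disk v : disk R k (retr v).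
Proof.
have m0 := max1_gt0 (nrm v); rewrite diskP nrmZ gtr0_norm ?invr_gt0//.
by rewrite ler_pdivrMl// mulr1 le_max lexx orbT.
Qed.
Lemma retr_id v : disk R k v -> retr v = v.
Proof. by rewrite diskP /retr => /max_idPl ->; rewrite invr1 scale1r. Qed.
End euclidean_norm.

Lemma cts_scale {R : realType} (S : topologicalType) k (f : S -> R) (g : S -> 'rV[R]_k) :
  cts f -> cts g -> cts (fun x => f x *: g x).
Proof. by move=> cf cg x; apply: cvgZ; [exact: cf|exact: cg]. Qed.
Lemma cts_nrm {R : realType} (S : topologicalType) k (g : S -> 'rV[R]_k) :
  cts g -> cts (fun x => nrm (g x)).
Proof. by move=> cg; apply: (cts_comp _ cg); exact: nrm_cts. Qed.
Lemma cts_vadd {R : realType} (S : topologicalType) (V : normedModType R) (f g : S -> V) :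
  cts f -> cts g -> cts (fun x => f x + g x).
Proof. by move=> cf cg x; apply: cvgD; [exact: cf|exact: cg]. Qed.
Lemma cts_vopp {R : realType} (S : topologicalType) (V : normedModType R) (f : S -> V) :
  cts f -> cts (fun x => - f x).
Proof. by move=> cf x; apply: cvgN; exact: cf. Qed.

Lemma within_retr {R : realType} k (X : topologicalType) (f : 'rV[R]_k -> X) :
  {within disk R k, continuous f} -> continuous (fun p => f (retr p)).
Proof.
move=> cf; apply: within_setT; apply: (within_comp (f := retr)) cf _.
  apply: continuous_subspaceT; apply: cts_scale; last by cts.
  apply: cts_inv; first by apply: cts_max; [cts|exact: nrm_cts].
  by move=> x; rewrite gt_eqF// max1_gt0.
by move=> _ [p _ <-]; exact: retr_disk.
Qed.

Ltac cts_hook ::= match goal with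
  | |- cts (fun x => clamp (@?f x)) => apply: cts_clamp
  | |- cts (fun x => csq (@?f x)) => apply: cts_csq
  | |- cts (fun x => @?f x *: @?g x) => apply: cts_scale
  | |- cts (fun x => nrm (@?g x)) => apply: cts_nrm
  | |- cts (fun x => (@?f x + @?g x)%R) => first [apply: cts_add | apply: cts_vadd]
  | |- cts (fun x => (- @?g x)%R) => first [apply: cts_opp | apply: cts_vopp]
  end.

(** * Injective maps of the disk to the plane *)

Section invariance_of_domain.
Context {R : realType}.
Implicit Types (v : 'rV[R]_2) (p : R * R).

Definition circ (a : R) : 'rV[R]_2 :=
  \row_i (if i == ord0 then cos (2 * pi * a) else sin (2 * pi * a)).

Lemma sqn2 v : sqn v = v ord0 ord0 ^+ 2 + v ord0 (lift ord0 ord0) ^+ 2.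
Proof. by rewrite /sqn big_ord_recl big_ord1. Qed.

Lemma nrm_circ a : nrm (circ a) = 1.
Proof. by rewrite /nrm sqn2 !mxE/= cos2Dsin2 sqrtr1. Qed.
Lemma circ_half a : circ (a + 2^-1) = - circ a.
Proof.
have E : 2 * pi * (a + 2^-1) = 2 * pi * a + pi by field.
by apply/rowP => i; rewrite !mxE; case: ifP => _; rewrite E ?cosDpi ?sinDpi.
Qed.
Lemma circ01 : circ 0 = circ 1.
Proof.
apply/rowP => i; rewrite !mxE mulr0 mulr1 cos0 sin0.
have E : 2 * pi = 0 + pi *+ 2 :> R by rewrite add0r mulr_natl.
by rewrite E cosD2pi sinD2pi cos0 sin0.
Qed.
Lemma cts_circ (S : topologicalType) (f : S -> R) : cts f -> cts (fun x => circ (f x)).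
Proof. by move=> cf; rewrite /circ; apply: cts_row => i; case: (i == ord0); cts. Qed.
Lemma disk_scale c v : `|c| <= 1 -> nrm v = 1 -> disk R 2 (c *: v).
Proof. by move=> c1 v1; rewrite diskP nrmZ v1 mulr1. Qed.
Lemma scale_inj (c c' : R) v : nrm v = 1 -> c *: v = c' *: v -> c = c'.
Proof.
move=> v1 /eqP; rewrite -subr_eq0 -scalerBl => /eqP E.
have : `|c - c'| * nrm v = 0 by rewrite -nrmZ E nrm0.
by rewrite v1 mulr1 => /eqP; rewrite normr_eq0 subr_eq0 => /eqP.
Qed.

Ltac cts_hook ::= match goal with
  | |- cts (fun x => clamp (@?f x)) => apply: cts_clamp
  | |- cts (fun x => csq (@?f x)) => apply: cts_csq
  | |- cts (fun x => @?f x *: @?g x) => apply: cts_scale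
  | |- cts (fun x => nrm (@?g x)) => apply: cts_nrm
  | |- cts (fun x => (@?f x + @?g x)%R) => first [apply: cts_add | apply: cts_vadd]
  | |- cts (fun x => (- @?g x)%R) => first [apply: cts_opp | apply: cts_vopp]
  | |- cts (fun x => circ (@?f x)) => apply: cts_circ
  end.

(* If [p] near [h 0] were missed by [h], then contracting the disk would make
   the loop [h (circ a) - p] wind zero times around the origin; but it is
   homotopic, through [h (circ a) - h 0], to the odd loop
   [h (circ a / 2) - h (- circ a / 2)]. *)
Lemma injective_disk_nbhs0 (h : 'rV[R]_2 -> R * R) : continuous h ->
  (forall v w, disk R 2 v -> disk R 2 w -> h v = h w -> v = w) ->
  nbhs (h 0) (h @` disk R 2).
Proof.
move=> ch hi.
have d0 : disk R 2 0 by rewrite diskP nrm0.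
have dc a : disk R 2 (circ a) by rewrite diskP nrm_circ.
have [|||m m0 Hm] := @compact_unif R _ (II R)
  (fun m a => m <= dot (h (circ a) - h 0) (h (circ a) - h 0)).
- exact: compact_II.
- by move=> r r' x _; exact: le_trans.
- move=> a _.
  have D0 : 0 < dot (h (circ a) - h 0) (h (circ a) - h 0).
    apply: dot_gt0 => /eqP; rewrite subr_eq0 => /eqP /hi E.
    have := nrm_circ a; rewrite E// nrm0; lra.
  exists (dot (h (circ a) - h 0) (h (circ a) - h 0) / 2); first by rewrite divr_gt0.
  have cD : cts (fun a => dot (h (circ a) - h 0) (h (circ a) - h 0)).
    by apply: cts_dot; cts.
  have /cvgr_gt H := cD a.
  have /H : dot (h (circ a) - h 0) (h (circ a) - h 0) / 2 <
    dot (h (circ a) - h 0) (h (circ a) - h 0) by lra.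
  by apply: filterS => b /ltW.
suff : [set p | dot (p - h 0) (p - h 0) < m] `<=` h @` disk R 2.
  move=> /filterS; apply.
  have cD : cts (fun p => dot (p - h 0) (p - h 0)) by apply: cts_dot; cts.
  have /cvgr_lt H := cD (h 0); apply: H.
  by rewrite subrr /dot/= mulr0 addr0.
move=> p /= pm; apply: contrapT => np.
have np' v : disk R 2 v -> h v <> p by move=> dv hv; apply: np; exists v.
have cst : winds0 (fun _ : R => h 0 - p).
  by exists (fun=> 0); split => // [|t _]; [cts|exact: rotated0].
have wE (z z' : R -> R * R) : (forall a, z a = z' a) -> winds0 z -> winds0 z'.
  by move=> /funext ->.
have w1 : winds0 (fun a => h (circ a) - p).
  have W := @winds0_homotopy _ (fun q => h (clamp q.2 *: circ q.1) - p).
  apply: (wE _ _ _ (W _ _ _ _)) => /=.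
  - by move=> a; rewrite clamp_ge1// scale1r.
  - by cts.
  - move=> q _ /eqP; rewrite subr_eq0 => /eqP; apply: np'.
    by apply: disk_scale (nrm_circ _); rewrite ger0_norm ?clamp_ge0 ?clamp_le1.
  - by move=> t _; rewrite circ01.
  - by apply: (wE _ _ _ cst) => a; rewrite clamp_le0// scale0r.
(* The base point moves from [p] to [h 0] on a segment. By the choice of [m] it is always closer to
   [h 0] than the loop is. *)
have w2 : winds0 (fun a => h (circ a) - h 0).
  have W := @winds0_homotopy _ (fun q => h (circ q.1) - h 0 -
    ((1 - q.2) * (p - h 0).1, (1 - q.2) * (p - h 0).2)).
  apply: (wE _ _ _ (W _ _ _ _)) => /=.
  - by move=> a; rewrite subrr !mul0r subr0.
  - by cts.
  - move=> [a t] /sqP[/= ai ti] /eqP; rewrite subr_eq0 => /eqP E.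
    have /Hm : II R a by rewrite IIP.
    have D z : dot ((1 - t) * z.1, (1 - t) * z.2) ((1 - t) * z.1, (1 - t) * z.2) =
      (1 - t) ^+ 2 * dot z z by rewrite /dot/=; ring.
    rewrite E (D (p - h 0)); apply/negP; rewrite -ltNge; apply: le_lt_trans pm.
    have tt : (1 - t) ^+ 2 <= 1 by rewrite expr_le1//; lra.
    by rewrite ler_piMl// /dot addr_ge0// -expr2 sqr_ge0.
  - by move=> t _; rewrite circ01.
  - apply: (wE _ _ _ w1) => a; rewrite subr0 !mul1r.
    by case: (h (circ a)) (h 0) p {pm np np' W cst w1} => [x y] [x' y'] [x'' y'']; congr pair => /=; ring.
have p1 (t : R) : 0 < 1 + clamp t by have := clamp_ge0 t; lra.
(* The two points stay on a common diameter at distance 1 from each other, so injectivity of [h]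
   keeps the difference nonzero. *)
have w3 : winds0 (fun a => h (2^-1 *: circ a) - h (- (2^-1 *: circ a))).
  have W := @winds0_homotopy _ (fun q => h ((1 + clamp q.2)^-1 *: circ q.1)
    - h (- (clamp q.2 / (1 + clamp q.2)) *: circ q.1)).
  apply: (wE _ _ _ (W _ _ _ _)) => /=.
  - by move=> a; rewrite clamp_ge1// div1r scaleNr.
  - by cts => q; rewrite gt_eqF.
  - move=> [a t] /sqP[/= ai ti] /eqP; rewrite subr_eq0 => /eqP /hi.
    have c0 := clamp_ge0 t; have pt := p1 t.
    have l1 : (1 + clamp t)^-1 <= 1 by rewrite invf_le1//; lra.
    have l2 : clamp t / (1 + clamp t) <= 1 by rewrite ler_pdivrMr//; lra.
    have g1 : 0 < (1 + clamp t)^-1 by rewrite invr_gt0.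
    have g2 : 0 <= clamp t / (1 + clamp t) by rewrite divr_ge0// ltW.
    have n1 : disk R 2 ((1 + clamp t)^-1 *: circ a).
      by apply: disk_scale (nrm_circ _); rewrite ger0_norm// ltW.
    have n2 : disk R 2 (- (clamp t / (1 + clamp t)) *: circ a).
      by apply: disk_scale (nrm_circ _); rewrite normrN ger0_norm.
    by move=> /(_ n1 n2) /(scale_inj (nrm_circ a)); move: g1 g2; lra.
  - by move=> t _; rewrite circ01.
  - by apply: (wE _ _ _ w2) => a; rewrite clamp_le0// addr0 invr1 scale1r mul0r oppr0 scale0r.
apply: winds0_odd w3.
  move=> /eqP; rewrite subr_eq0 => /eqP /hi.
  have n1 : disk R 2 (2^-1 *: circ 0) by apply: disk_scale (nrm_circ _); rewrite ger0_norm; lra.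
  have n2 : disk R 2 (- 2^-1 *: circ 0).
    by apply: disk_scale (nrm_circ _); rewrite normrN ger0_norm; lra.
  by rewrite -scaleNr => /(_ n1 n2) /(scale_inj (nrm_circ 0)); lra.
by move=> t _ /=; rewrite circ_half scalerN opprK opprB.
Qed.

(** Each point of the open disk is the centre of a smaller disk inside it, to which
    [injective_disk_nbhs0] applies after rescaling; [retr] makes the rescaled map globally
    continuous. *)
Lemma injective_disk_open (h : 'rV[R]_2 -> R * R) : cell_param h -> open (cell_int h).
Proof.
move=> [ch hi]; rewrite openE => _ [v vd <-] /=.
have /nbhs_ballP[e /= e0 He] : nbhs v (open_disk R 2) by apply: open_nbhs_nbhs; split => //; exact: open_open_disk.
pose g w := v + (e / 2) *: retr w.
have gb w : open_disk R 2 (g w).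
  apply: He; rewrite /g -ball_normE/= opprD addNKr normrN.
  rewrite (_ : `|_| = mx_norm ((e / 2) *: retr w))// mx_normrE.
  apply: bigmax_lt => // -[i j] _ /=; rewrite ord1 mxE normrM gtr0_norm ?divr_gt0//.
  apply: le_lt_trans (_ : e / 2 < e); last by lra.
  have e20 : 0 <= e / 2 by rewrite divr_ge0// ltW.
  rewrite ler_piMr//; apply: le_trans (entry_le_nrm _ _) _.
  by apply/diskP/retr_disk.
have E w : retr (g w) = g w by apply: retr_id; apply: open_disk_sub.
have gc : cts g.
  by rewrite /g /retr; cts => w; rewrite gt_eqF// max1_gt0.
have -> : h v = h (g 0) by rewrite /g retr_id ?scaler0 ?addr0// diskP nrm0.
suff N : nbhs (h (g 0)) ((fun w => h (g w)) @` disk R 2).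
  by apply: filterS N => _ [w wd <-]; exists (g w).
apply: (@injective_disk_nbhs0 (fun w => h (g w))).
- have := cts_comp (within_retr ch) gc; congr cts.
  by apply/funext => w; rewrite E.
- move=> w w' wd w'd /hi H.
  have /H : disk R 2 (g w) by apply: open_disk_sub.
  have /[swap] /[apply] : disk R 2 (g w') by apply: open_disk_sub.
  rewrite /g !retr_id// => /addrI /scalerI; apply.
  by rewrite gt_eqF// divr_gt0.
Qed.
End invariance_of_domain.

(** * Local contractibility *)

Section local_contractibility.
Context {R : realType} {X : metricType R}.
Context (lcX : locally_contractible X).

Definition mball (x : X) (d : R) : set X := [set y | mdist x y < d].

Lemma mball_nbhs x d : 0 < d -> nbhs x (mball x d).
Proof. by move=> d0; rewrite /mball -ballEmdist; exact: nbhsx_ballx. Qed.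

(** Loops in [A], given as the four sides of a square, bound in [B]. The sides are total functions
    with all their values in [A], so actual paths are clamped before use. *)
Definition fillable (A B : set X) := forall b tp l r : R -> X,
  [/\ cts b, cts tp, cts l & cts r] ->
  (forall t, [/\ A (b t), A (tp t), A (l t) & A (r t)]) ->
  [/\ b 0 = l 0, b 1 = r 0, tp 0 = l 1 & tp 1 = r 1] ->
  exists S : R * R -> X, [/\ cts S, forall p, B (S p) &
    forall t, 0 <= t <= 1 -> [/\ S (t, 0) = b t, S (t, 1) = tp t, S (0, t) = l t & S (1, t) = r t]].

Definition joinable (A B : set X) := forall y z, A y -> A z ->
  exists g : R -> X, [/\ cts g, g 0 = y, g 1 = z & forall t, B (g t)].

(** Go down the track of [y] to the centre [c], then up the track of [z]. *)
Lemma contraction_joinable (V U : set X) (H : X * R -> X) (c : X) :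
  map_on (V `*` II R) U H -> (forall y, V y -> H (y, 0) = y /\ H (y, 1) = c) -> joinable V U.
Proof.
move=> [cH HU] H01 y z Vy Vz.
have cHy v (f : R -> R) : V v -> cts f -> (forall t, II R (f t)) -> cts (fun t => H (v, f t)).
  move=> Vv cf fI; apply: within_setT; apply: (within_comp (f := fun t => (v, f t))) cH _.
    by apply: continuous_subspaceT; rewrite -/(cts _); cts.
  by move=> _ [t _ <-]; split => //; exact: fI.
have [||||||g cg [gA gB]] := @paste2 _ _ [set t : R | t <= 2^-1] [set t : R | 2^-1 <= t]
  (fun t => H (y, clamp (2 * t))) (fun t => H (z, clamp (2 - 2 * t))).
- exact: closed_le.
- exact: closed_ge.
- by apply/seteqP; split => // t _ /=; case: (lerP t 2^-1) => [|/ltW]; [left|right].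
- by apply: continuous_subspaceT; apply: cHy => //; [cts|move=> t; exact: clamp_II].
- by apply: continuous_subspaceT; apply: cHy => //; [cts|move=> t; exact: clamp_II].
- move=> t /= t1 t2; have -> : t = 2^-1 by apply/eqP; rewrite eq_le t1.
  by rewrite !clamp_ge1; [rewrite (H01 _ Vy).2 (H01 _ Vz).2|lra..].
exists g; split => //.
- by rewrite gA /=; [rewrite mulr0 clamp_le0// (H01 _ Vy).1|lra].
- by rewrite gB /=; [rewrite clamp_le0; [rewrite (H01 _ Vz).1|lra]|lra].
- move=> t; have [t1|/ltW t1] := lerP t 2^-1; [rewrite gA//|rewrite gB//]; apply: HU.
    by exists (y, clamp (2 * t)) => //; split => //; exact: clamp_II.
  by exists (z, clamp (2 - 2 * t)) => //; split => //; exact: clamp_II.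
Qed.

(** The sides of [[-1, 1]^2]: [i.1] selects the second coordinate as the fixed one, and [i.2] the
    value -1 for it. So [(true, true)] is the bottom, [(true, false)] the top, [(false, true)] the
    left and [(false, false)] the right. *)
Let side (i : bool * bool) : set (R * R) := [set q | -1 <= q.1 <= 1 /\ -1 <= q.2 <= 1 /\
  (if i.1 then q.2 else q.1) = (if i.2 then -1 else 1)].

Let closed_side i : closed (side i).
Proof.
have F (S : topologicalType) (f : S -> R) a b : cts f -> closed [set x | a <= f x <= b].
  move=> cf; rewrite (_ : [set x | _] = f @^-1` [set` `[a, b]]).
    by apply: preimage_closed; [move=> x _; exact: cf|exact: itv_closed].
  by apply/seteqP; split => x /=; rewrite in_itv.
rewrite (_ : side i = [set q | -1 <= q.1 <= 1] `&` ([set q | -1 <= q.2 <= 1] `&`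
  [set q | (if i.2 then -1 else 1) <= (if i.1 then q.2 else q.1) <= (if i.2 then -1 else 1)])).
  apply: closedI; first by apply: F; cts.
  by apply: closedI; apply: F; case: (i.1); cts.
by apply/seteqP; split => q [q1 [q2 q3]]; split => //; split => //=;
  [rewrite q3 lexx|apply/eqP; rewrite eq_le andbC].
Qed.

(* On the outer half of the square the filling runs the contraction along the
   radii; the inner half is sent to the centre of the contraction. *)
Lemma contraction_fillable (V U : set X) (H : X * R -> X) (c : X) :
  map_on (V `*` II R) U H -> (forall y, V y -> H (y, 0) = y /\ H (y, 1) = c) -> fillable V U.
Proof.
move=> [cH HU] H01 b tp l r [cb ctp cl cr] Vs [bl br tl tr].
pose hf (x : R) := (1 + x) / 2.
pose g (i : bool * bool) (q : R * R) := match i with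
  | (true, true) => b (hf q.1) | (true, false) => tp (hf q.1)
  | (false, true) => l (hf q.2) | (false, false) => r (hf q.2) end.
have chf : cts hf by rewrite /hf; cts.
have hf0 : hf (-1) = 0 by rewrite /hf; lra.
have hf1 : hf 1 = 1 by rewrite /hf; lra.
have cg i : cts (g i) by rewrite /g; case: i => [[] []]; cts.
have [|||be cbe beE] := @paste _ _ _ side g (g (true, true)).
- exact: closed_side.
- by move=> i; apply: continuous_subspaceT; exact: cg.
- move=> [[] []] [[] []] [x y] [/= x1 [y1 z1]] [x2 [y2 z2]];
    rewrite /= in z1 z2 *; try by [];
    try (by exfalso; move: z1 z2; lra); by rewrite z1 z2 ?hf0 ?hf1.
(* [m] is the distance to the centre in the maximum norm, scaled to be 1 on the boundary; [q] is the
   radial projection to the boundary, with [m] truncated below at 1/2 to avoid dividing by 0 at the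
   centre. *)
pose m (p : R * R) := Num.max `|2 * p.1 - 1| `|2 * p.2 - 1|.
pose m' p := Num.max (m p) 2^-1.
pose q p := ((2 * p.1 - 1) / m' p, (2 * p.2 - 1) / m' p).
have cm : cts m by rewrite /m; cts.
have m'0 p : 0 < m' p by rewrite /m' lt_max; apply/orP; right; lra.
have cq : cts q by rewrite /q/m'; cts => p; rewrite gt_eqF//; exact: m'0.
have nz (x y : R) : 2^-1 <= Num.max `|x| `|y| -> exists i,
    side i (x / Num.max (Num.max `|x| `|y|) 2^-1, y / Num.max (Num.max `|x| `|y|) 2^-1).
  move=> /[dup] h /max_idPl ->.
  have M0 : 0 < Num.max `|x| `|y| by lra.
  have B (z : R) : `|z| <= Num.max `|x| `|y| -> -1 <= z / Num.max `|x| `|y| <= 1.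
    move=> zM; rewrite -ler_norml normrM normfV (gtr0_norm M0).
    by rewrite ler_pdivrMr// mul1r.
  have Bx : -1 <= x / Num.max `|x| `|y| <= 1 by apply: B; rewrite le_max lexx.
  have By : -1 <= y / Num.max `|x| `|y| <= 1 by apply: B; rewrite le_max lexx orbT.
  have C (z : R) : z != 0 -> z / `|z| = if z < 0 then -1 else 1.
    move=> z0; case: (ltrgtP z 0) z0 => [h1 _|h1 _|//].
      by rewrite ltr0_norm// invrN mulrN divff// lt_eqF.
    by rewrite gtr0_norm// divff// gt_eqF.
  have [xy|/ltW xy] := lerP `|x| `|y|.
    rewrite (max_idPr xy) in Bx By M0.
    exists (true, y < 0); split; [exact: Bx|split; [exact: By|]] => /=.
    by rewrite C// -normr_gt0.
  rewrite (max_idPl xy) in Bx By M0.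
  exists (false, x < 0); split; [exact: Bx|split; [exact: By|]] => /=.
  by rewrite C// -normr_gt0.
have Vbe (z : R * R) : (\bigcup_(i in [set: bool * bool]) side i) z -> V (be z).
  move=> [i _ iz]; rewrite (beE _ _ iz) /g.
  by case: i {iz} => [[] []]; [case: (Vs (hf z.1))|case: (Vs (hf z.1))|
    case: (Vs (hf z.2))|case: (Vs (hf z.2))].
have Vq p : 2^-1 <= m p -> V (be (q p)).
  by move=> mp; apply: Vbe; have [i ip] := nz _ _ mp; exists i.
(* The time of the contraction: 0 on the boundary, 1 where [m p] is at most 1/2. *)
pose ka p := clamp (2 * (1 - m p)).
have [||||||S cS [SA SB]] := @paste2 _ _ [set p | m p <= 2^-1] [set p | 2^-1 <= m p]
  (fun _ => c) (fun p => H (be (q p), ka p)).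
- by apply: (@preimage_closed _ _ m [set x | x <= 2^-1]); [move=> x _; exact: cm|exact: closed_le].
- by apply: (@preimage_closed _ _ m [set x | 2^-1 <= x]); [move=> x _; exact: cm|exact: closed_ge].
- by apply/seteqP; split => // t _ /=; case: (lerP (m t) 2^-1) => [|/ltW]; [left|right].
- by apply: continuous_subspaceT => x; exact: cvg_cst.
- apply: (within_comp (f := fun p => (be (q p), ka p))) cH _.
    apply: within_pair; last by apply: continuous_subspaceT; rewrite -/(cts _) /ka; cts.
    apply: (within_comp (f := q)) cbe _; first exact: continuous_subspaceT.
    by move=> _ [p /= mp <-]; have [i ip] := nz _ _ mp; exists i.
  by move=> _ [p /= mp <-]; split; [exact: Vq|exact: clamp_II].
- move=> p /= p1 p2; have -> : ka p = 1 by rewrite /ka clamp_ge1//; lra.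
  by rewrite (H01 _ (Vq _ p2)).2.
have Uc : U c.
  have V0 : V (b 0) by case: (Vs 0).
  by rewrite -(H01 _ V0).2; apply: HU; exists (b 0, 1) => //; split => //; rewrite IIP ler01 lexx.
exists S; split => //.
  move=> p; have [p1|/ltW p1] := lerP (m p) 2^-1; [by rewrite SA|rewrite SB//]; apply: HU.
  by exists (be (q p), ka p) => //; split; [exact: Vq|exact: clamp_II].
have SE i p : side i (2 * p.1 - 1, 2 * p.2 - 1) -> S p = g i (2 * p.1 - 1, 2 * p.2 - 1).
  move=> ip; have mp : m p = 1.
    case: ip => /= a1 [a2 a3].
    apply/eqP; rewrite /m eq_le ge_max !ler_norml a1 a2 /= le_max; apply/orP.
    have n1 x : x = -1 \/ x = 1 -> 1 <= `|x : R| by move=> [->|->]; rewrite ?normrN normr1.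
    by case: (i.1) a3 => a3; [right|left]; apply: n1; rewrite a3; case: (i.2); auto.
  have qp : q p = (2 * p.1 - 1, 2 * p.2 - 1).
    by rewrite /q /m' mp (_ : Num.max _ _ = 1) ?divr1//; apply/max_idPl; lra.
  rewrite SB /=; last by rewrite mp; lra.
  rewrite /ka mp subrr mulr0 clamp_le0// (H01 _ _).1; last by apply: Vq; rewrite mp; lra.
  by rewrite qp (beE i).
have hE (x : R) : hf (2 * x - 1) = x by rewrite /hf; lra.
move=> t ti; split.
- by rewrite (SE (true, true)) /= ?hE//; split; [|split] => /=; lra.
- by rewrite (SE (true, false)) /= ?hE//; split; [|split] => /=; lra.
- by rewrite (SE (false, true)) /= ?hE//; split; [|split] => /=; lra.
- by rewrite (SE (false, false)) /= ?hE//; split; [|split] => /=; lra.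
Qed.

Lemma fillable_sub A A' B B' : A' `<=` A -> B `<=` B' -> fillable A B -> fillable A' B'.
Proof.
move=> AA BB f b tp l r cs As cn; have [|S [cS SB SE]] := f b tp l r cs _ cn.
  by move=> t; have [] := As t; split; exact: AA.
by exists S; split => // p; exact: BB.
Qed.

Lemma joinable_sub A A' B B' : A' `<=` A -> B `<=` B' -> joinable A B -> joinable A' B'.
Proof.
move=> AA BB f y z /AA Ay /AA Az; have [g [cg g0 g1 gB]] := f _ _ Ay Az.
by exists g; split => // t; exact: BB.
Qed.

(** The only place where local contractibility is unfolded: its radii become uniform along a compact
    image. *)
Lemma uniform_contractions (S : topologicalType) (A : set S) (w : S -> X) (e : R) :
  compact A -> {within A, continuous w} -> 0 < e ->
  exists2 d, 0 < d & forall s, A s ->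
    fillable (mball (w s) d) (mball (w s) e) /\ joinable (mball (w s) d) (mball (w s) e).
Proof.
move=> cA /subspace_continuousP cw e0.
apply: (compact_unif (P := fun d s => fillable (mball (w s) d) (mball (w s) e) /\
  joinable (mball (w s) d) (mball (w s) e)) cA).
  move=> r r' x _ rr' [f j]; have sub : mball (w x) r' `<=` mball (w x) r.
    by move=> y /= /lt_le_trans; apply.
  by split; [apply: fillable_sub f|apply: joinable_sub j].
move=> s As; have e20 : 0 < e / 2 by lra.
have [V [nV VU [H [c [Hm H01]]]]] := lcX (mball_nbhs (w s) e20).
have /nbhs_ballP[d /= d0 dV] := nV; rewrite ballEmdist in dV.
exists (d / 2); first by lra.
have := cw s As => /metricType_numDomainType.cvgrPdist_lt.
have m0 : 0 < Num.min (d / 2) (e / 2) by rewrite lt_min; apply/andP; split; lra.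
move=> /(_ _ m0); rewrite near_withinE; apply: filterS => s' + As' => /(_ As').
rewrite lt_min => /andP[h1 h2].
have s1 : mball (w s') (d / 2) `<=` V.
  move=> y; rewrite /mball/= => h3; apply: dV => /=; apply: le_lt_trans (metric_triangle _ (w s') _) _; lra.
have s2 : mball (w s) (e / 2) `<=` mball (w s') e.
  move=> y; rewrite /mball/= => h3; apply: le_lt_trans (metric_triangle _ (w s) _) _.
  rewrite (metric_sym (w s')); lra.
split.
  exact: fillable_sub s1 s2 (contraction_fillable Hm H01).
exact: joinable_sub s1 s2 (contraction_joinable Hm H01).
Qed.

(* Cut [[0,1]] finely, join corresponding cutting points by small paths, and fill
   the small squares so obtained. *)
Lemma close_paths_homotopic (w : R -> X) (e : R) : cts w -> 0 < e ->
  exists2 d, 0 < d & forall w' : R -> X, cts w' ->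
    (forall t, 0 <= t <= 1 -> mdist (w t) (w' t) < d) ->
    exists K : R * R -> X, [/\ cts K,
      forall t, 0 <= t <= 1 -> K (0, t) = w t /\ K (1, t) = w' t &
      forall p, sq R p -> mdist (w p.2) (K p) < e].
Proof.
move=> cw e0; have e20 : 0 < e / 2 by lra.
have cwI : {within II R, continuous w} by exact: continuous_subspaceT.
(* All four sides of a small square have to lie in the [r1]-ball where filling is possible. Rungs,
   the distance from [w] to [w'], and the motion of [w] over one interval each account for less than
   [r1 / 4]. *)
have [r1 r10 fil] := uniform_contractions compact_II cwI e20.
have r140 : 0 < r1 / 4 by lra.
have [r0 r00 joi] := uniform_contractions compact_II cwI r140.
have m0 : 0 < Num.min (r1 / 4) (e / 2) by rewrite lt_min; apply/andP; split; lra.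
have [d d0 Hd] := unif_cont compact_II cwI m0.
have [n nd] := small_invn d0.
exists (Num.min r0 (r1 / 4)); first by rewrite lt_min r00.
move=> w' cw' ww'.
pose N : R := n.+1%:R; have N0 : 0 < N by rewrite ltr0n.
(* Clamped, so that a rung can be chosen for every natural number. *)
pose ti (i : nat) := clamp (i%:R / N).
have tii i : 0 <= ti i <= 1 by exact: clamp_itv.
have tiE i : (i <= n.+1)%N -> ti i = i%:R / N.
  by move=> ni; rewrite /ti clamp_id// divr_ge0//= ler_pdivrMr// mul1r ler_nat.
have : forall i, exists g : R -> X, [/\ cts g, g 0 = w (ti i), g 1 = w' (ti i) &
    forall t, mdist (w (ti i)) (g t) < r1 / 4].
  move=> i; have [_] := joi (ti i) (clamp_II _); apply.
    by rewrite /mball/= mdistxx.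
  by have := ww' _ (tii i); rewrite lt_min => /andP[].
move=> /choice[ga gaP].
have stepI i u : (i < n.+1)%N -> 0 <= u <= 1 -> 0 <= i%:R / N + u / N <= 1.
  move=> ni ui; rewrite -mulrDl divr_ge0//= ?addr_ge0//; last by lra.
  rewrite ler_pdivrMr// mul1r; apply: le_trans (_ : i%:R + 1 <= _); first by lra.
  by rewrite natr1 ler_nat.
have near_ti i u : (i < n.+1)%N -> 0 <= u <= 1 ->
    mdist (w (ti i)) (w (i%:R / N + u / N)) < Num.min (r1 / 4) (e / 2).
  move=> ni ui; apply: Hd; [exact: clamp_II|by rewrite IIP; exact: stepI|].
  rewrite tiE ?(ltnW ni)// /ball/= opprD addNKr normrN ger0_norm; last by rewrite divr_ge0; lra.
  by apply: le_lt_trans nd; rewrite ler_piMl ?invr_ge0 ?(ltW N0)//; lra.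
have : forall i : 'I_n.+1, exists S : R * R -> X, [/\ cts S,
   forall p, mdist (w (ti i)) (S p) < e / 2 & forall t, 0 <= t <= 1 ->
   [/\ S (t, 0) = w (i%:R / N + t / N), S (t, 1) = w' (i%:R / N + t / N),
      S (0, t) = ga i t & S (1, t) = ga i.+1 t]].
  move=> i; have [+ _] := fil (ti i) (clamp_II _).
  move=> /(_ (fun t => w (i%:R / N + clamp t / N)) (fun t => w' (i%:R / N + clamp t / N))
    (fun t => ga i (clamp t)) (fun t => ga i.+1 (clamp t))).
  have c01 : clamp (0 : R) = 0 /\ clamp (1 : R) = 1 by rewrite clamp_le0// clamp_ge1.
  case.
  - by have [? _ _ _] := gaP i; have [? _ _ _] := gaP i.+1; split; cts.
  - move=> t; have ci := clamp_itv t.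
    have := near_ti i _ (ltn_ord i) ci; rewrite lt_min => /andP[h1 _].
    have := ww' _ (stepI i _ (ltn_ord i) ci); rewrite lt_min => /andP[_ h2].
    have [_ _ _ h3] := gaP i; have [_ _ _ h4] := gaP i.+1.
    have := near_ti i 1 (ltn_ord i); rewrite ler01 lexx => /(_ isT).
    rewrite (_ : i%:R / N + 1 / N = ti i.+1); last first.
      by rewrite tiE ?ltn_ord// -mulrDl natr1.
    rewrite lt_min => /andP[h5 _].
    split; rewrite /mball/=.
    + lra.
    + apply: le_lt_trans (metric_triangle _ (w (i%:R / N + clamp t / N)) _) _; lra.
    + by have := h3 (clamp t); lra.
    + apply: le_lt_trans (metric_triangle _ (w (ti i.+1)) _) _; have := h4 (clamp t); lra.
  - have [_ g0 g1 _] := gaP i; have [_ g0' g1' _] := gaP i.+1.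
    rewrite c01.1 c01.2 g0 g1 g0' g1' mul0r addr0 -mulrDl natr1 tiE ?(ltnW (ltn_ord i))//.
    by rewrite tiE ?ltn_ord.
  - move=> S [cS S1 S2]; exists S; split => // t t1.
    by have [] := S2 t t1; rewrite clamp_id//.
move=> /choice[S SP].
pose A (i : 'I_n.+1) : set (R * R) := [set p | i%:R / N <= p.2 <= i.+1%:R / N].
(* In [S i] the path parameter comes first and the homotopy parameter second; in [K] it is the
   opposite. *)
pose g (i : 'I_n.+1) (p : R * R) := S i (clamp (N * p.2 - i%:R), clamp p.1).
have [|||K cK KE] := @paste _ _ _ A g (g ord0).
- move=> i; rewrite (_ : A i = snd @^-1` [set` `[i%:R / N, i.+1%:R / N]]).
    by apply: preimage_closed; [move=> x _; exact: cvg_snd|exact: itv_closed].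
  by apply/seteqP; split => x; rewrite /A /= in_itv.
- by move=> i; apply: continuous_subspaceT; have [? _ _] := SP i; rewrite /g -/(cts _); cts.
- move=> i j; wlog : i j / (i <= j)%N => [W p Ai Aj|ij p /andP[_ Ai] /andP[Aj _]].
    by have /orP[ij|ij] := leq_total i j; [apply: W|apply/esym/W].
  have : j%:R / N <= i.+1%:R / N by exact: le_trans Aj Ai.
  rewrite ler_pM2r ?invr_gt0// ler_nat => ji.
  have [/val_inj -> //|ni] := eqVneq (i : nat) j.
  have E : (j : nat) = i.+1 by apply/eqP; rewrite eqn_leq ji ltn_neqAle ni.
  have pE : p.2 = i.+1%:R / N by apply/eqP; rewrite eq_le Ai -E Aj.
  have e0' : N * (i.+1%:R / N) - j%:R = 0 by rewrite mulrC divfK ?gt_eqF// E subrr.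
  have e1 : N * (i.+1%:R / N) - i%:R = 1.
    by rewrite mulrC divfK ?gt_eqF// -natr1 addrAC subrr add0r.
  rewrite /g pE e0' e1.
  have [_ _ /(_ _ (clamp_itv p.1))[_ _ _ h1]] := SP i.
  have [_ _ /(_ _ (clamp_itv p.1))[_ _ h2 _]] := SP j.
  by rewrite [clamp 1]clamp_ge1// [clamp 0]clamp_le0// h1 h2 E.
have cover t : 0 <= t <= 1 -> exists i : 'I_n.+1, i%:R / N <= t <= i.+1%:R / N.
  move=> /andP[t0 t1].
  have Nt0 : 0 <= N * t by rewrite mulr_ge0// ltW.
  have tr := truncn_itv Nt0; set k := Num.truncn (N * t) in tr.
  have [kn|nk] := ltnP k n.+1.
    exists (Ordinal kn) => /=; rewrite ler_pdivrMr// ler_pdivlMr// mulrC.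
    by case/andP: tr => -> /ltW ->.
  exists ord_max => /=; rewrite ler_pdivrMr// ler_pdivlMr// !(mulrC t).
  apply/andP; split; last by rewrite ler_piMr// ltW.
  case/andP: tr => + _; apply: le_trans; rewrite ler_nat; exact: leq_trans nk.
exists (fun p => K (csq p)); split.
- apply: within_csq; apply: continuous_subspaceW cK => p /sqP[_ /cover[i ip]].
  by exists i.
- move=> t ti'; have s0 : sq R (0, t) by apply/sqP; rewrite lexx ler01.
  have s1 : sq R (1, t) by apply/sqP; rewrite lexx ler01.
  rewrite !csq_id//.
  have [i ip] := cover t ti'.
  have ci : 0 <= N * t - i%:R <= 1.
    move: ip; rewrite ler_pdivrMr// ler_pdivlMr// mulrC -natr1 => /andP[? ?]; lra.
  have [_ _ /(_ _ ci)[h1 h2 _ _]] := SP i.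
  rewrite !(KE i)// /g/= [clamp 0]clamp_le0// [clamp 1]clamp_ge1// clamp_id// h1 h2.
  by rewrite -mulrDl addrC subrK mulrC mulKf// gt_eqF.
- move=> p /[dup] ps /sqP[p1 p2]; rewrite csq_id//.
  have [i ip] := cover _ p2; rewrite (KE i)//.
  have ci : 0 <= N * p.2 - i%:R <= 1.
    move: ip; rewrite ler_pdivrMr// ler_pdivlMr// mulrC -natr1 => /andP[? ?]; lra.
  have [_ h _] := SP i; have := near_ti i _ (ltn_ord i) ci.
  rewrite -mulrDl addrC subrK mulrC mulKf ?gt_eqF// lt_min => /andP[_ h2].
  rewrite [e]splitr; apply: le_lt_trans (metric_triangle _ (w (ti i)) _) _.
  by apply: ltrD; [rewrite metric_sym|exact: h].
Qed.

End local_contractibility.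

(** * Grid decompositions of the disk *)

Lemma continuous_at_scale {R : realType} (S : topologicalType) k (f : S -> R)
    (g : S -> 'rV[R]_k) x :
  {for x, continuous f} -> {for x, continuous g} -> {for x, continuous (fun y => f y *: g y)}.
Proof. by move=> cf cg; apply: cvgZ. Qed.

(** * Euclidean balls and cubes *)

Section disk_cube.
Context {R : realType} {k : nat}.
Implicit Types (v w : 'rV[R]_k).

(* Radial homeomorphism from the euclidean ball to the cube, and its inverse;
   both send [0] to [0] because [0 / 0 = 0]. *)
Definition cube v : 'rV[R]_k := (nrm v / `|v|) *: v.
Definition uncube w : 'rV[R]_k := (`|w| / nrm w) *: w.

Lemma mxnorm_le v c : 0 <= c -> (forall i, `|v ord0 i| <= c) -> `|v| <= c.
Proof.
move=> c0 H; rewrite (_ : `|v| = mx_norm v)// mx_normrE; apply: bigmax_le => // -[i j] _ /=.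
by rewrite ord1.
Qed.
Lemma entry_le_mxnorm v i : `|v ord0 i| <= `|v|.
Proof.
rewrite (_ : `|v| = mx_norm v)// mx_normrE.
exact: (@le_bigmax _ _ _ _ (fun ij : 'I_1 * 'I_k => `|v ij.1 ij.2|) (ord0, i)).
Qed.
Lemma mxnorm_le_nrm v : `|v| <= nrm v.
Proof. by apply: mxnorm_le; [exact: nrm_ge0|exact: entry_le_nrm]. Qed.

Lemma nrm_gt0 v : v != 0 -> 0 < nrm v.
Proof. by move=> v0; apply: lt_le_trans (mxnorm_le_nrm v); rewrite normr_gt0. Qed.
Lemma cube_norm v : `|cube v| = nrm v.
Proof.
have [->|v0] := eqVneq v 0; first by rewrite /cube nrm0 mul0r scale0r normr0.
by rewrite normrZ normrM normfV !ger0_norm ?nrm_ge0// mulfVK// normr_eq0.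
Qed.
Lemma uncube_nrm w : nrm (uncube w) = `|w|.
Proof.
have [->|w0] := eqVneq w 0; first by rewrite /uncube normr0 mul0r scale0r nrm0.
by rewrite nrmZ normrM normfV normr_id (ger0_norm (nrm_ge0 _)) mulfVK// gt_eqF// nrm_gt0.
Qed.
Lemma cubeK : cancel cube uncube.
Proof.
move=> v; rewrite /uncube cube_norm; have [->|v0] := eqVneq v 0.
  by rewrite nrm0 mul0r scale0r.
rewrite /cube nrmZ normrM normfV normr_id (ger0_norm (nrm_ge0 _)) scalerA.
have n0 : nrm v != 0 by rewrite gt_eqF// nrm_gt0.
have m0 : `|v| != 0 by rewrite normr_eq0.
rewrite (_ : _ / _ * _ = 1) ?scale1r//.
by field; rewrite n0 m0.
Qed.
Lemma uncubeK : cancel uncube cube.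
Proof.
move=> w; rewrite /cube uncube_nrm; have [->|w0] := eqVneq w 0.
  by rewrite normr0 mul0r scale0r.
rewrite /uncube normrZ normrM normfV normr_id (ger0_norm (nrm_ge0 _)) scalerA.
have n0 : nrm w != 0 by rewrite gt_eqF// nrm_gt0.
have m0 : `|w| != 0 by rewrite normr_eq0.
rewrite (_ : _ / _ * _ = 1) ?scale1r//.
by field; rewrite n0 m0.
Qed.

(** At the origin, continuity comes from [cube_norm]; elsewhere the scalar factor is continuous. *)
Lemma cube_cts : continuous cube.
Proof.
move=> v; have [->|v0] := eqVneq v 0.
  have c0 : cube 0 = 0 by rewrite /cube nrm0 mul0r scale0r.
  rewrite /continuous_at c0; apply/(@cvgrPdist_lt _ _ _ _ (nbhs_filter (0 : 'rV[R]_k))) => e e0; have := @nrm_cts R k 0; rewrite /continuous_at nrm0.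
  move=> /cvgr_lt/(_ _ e0); apply: filterS => w.
  by rewrite sub0r normrN cube_norm.
apply: (continuous_at_scale (f := fun v => nrm v / `|v|) (g := fun v => v)); last exact: cvg_id.
have nv : `|v| != 0 by rewrite normr_eq0.
by apply: (cvgM (@nrm_cts R k v) (cvgV nv (@norm_continuous R 'rV[R]_k v))).
Qed.

Lemma uncube_cts : continuous uncube.
Proof.
move=> v; have [->|v0] := eqVneq v 0.
  have c0 : uncube 0 = 0 by rewrite /uncube normr0 mul0r scale0r.
  rewrite /continuous_at c0; apply/(@cvgrPdist_lt _ _ _ _ (nbhs_filter (0 : 'rV[R]_k))) => e e0; have := @norm_continuous R 'rV[R]_k 0.
  rewrite /continuous_at normr0 => /cvgr_lt/(_ _ e0); apply: filterS => w.
  by move=> we; rewrite sub0r normrN (le_lt_trans (mxnorm_le_nrm _))// uncube_nrm.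
apply: (continuous_at_scale (f := fun v => `|v| / nrm v) (g := fun v => v)); last exact: cvg_id.
have nv : nrm v != 0 by rewrite gt_eqF// nrm_gt0.
by apply: (cvgM (@norm_continuous R 'rV[R]_k v) (cvgV nv (@nrm_cts R k v))).
Qed.

End disk_cube.

(** * The disk and the unit square *)

Section disk_square.
Context {R : realType}.
Implicit Types (v : 'rV[R]_2) (p : R * R).

Definition pair_row p : 'rV[R]_2 := \row_i (if i == ord0 then p.1 else p.2).
Lemma pair_rowK v : pair_row (v ord0 ord0, v ord0 (lift ord0 ord0)) = v.
Proof.
apply/rowP => i; rewrite !mxE /=; case: (unliftP ord0 i) => [j ->|->] //=.
by rewrite (ord1 j).
Qed.
Lemma cts_pair_row (S : topologicalType) (f : S -> R * R) :
  cts f -> cts (fun x => pair_row (f x)).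
Proof. by move=> cf; rewrite /pair_row; apply: cts_row => i; case: (i == ord0); cts. Qed.
Lemma pair_row_norm p (c : R) : 0 <= c -> (`|pair_row p| <= c) = (`|p.1| <= c) && (`|p.2| <= c).
Proof.
move=> c0; apply/idP/andP => [H|[H1 H2]].
  split; apply: le_trans H.
    by have := entry_le_mxnorm (pair_row p) ord0; rewrite mxE.
  by have := entry_le_mxnorm (pair_row p) (lift ord0 ord0); rewrite mxE.
by apply: mxnorm_le => // i; rewrite mxE; case: ifP.
Qed.

(** [dsq] and [sqd] are inverse homeomorphisms of the plane under which the round disk corresponds
    to [sq R]. *)
Definition dsq v : R * R :=
  ((1 + cube v ord0 ord0) / 2, (1 + cube v ord0 (lift ord0 ord0)) / 2).
Definition sqd p : 'rV[R]_2 := uncube (pair_row (2 * p.1 - 1, 2 * p.2 - 1)).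

Lemma dsqK : cancel dsq sqd.
Proof.
move=> v; rewrite /sqd /dsq /= (_ : (_, _) = (cube v ord0 ord0, cube v ord0 (lift ord0 ord0))).
  by rewrite pair_rowK cubeK.
by congr pair; field.
Qed.
Lemma sqdK : cancel sqd dsq.
Proof. by move=> [x y]; rewrite /dsq uncubeK !mxE/=; congr pair; field. Qed.
Lemma dsq_cts : continuous dsq.
Proof. by have := @cube_cts R 2; rewrite -!/(cts _) /dsq => ?; cts. Qed.
Lemma sqd_cts : continuous sqd.
Proof.
have := @uncube_cts R 2; rewrite -!/(cts _) /sqd => H.
by apply: (cts_comp H); apply: cts_pair_row; cts.
Qed.
Lemma sqd_disk p : disk R 2 (sqd p) <-> sq R p.
Proof.
rewrite diskP uncube_nrm pair_row_norm// sqP /= !ler_norml; split.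
  by move=> /andP[? ?]; split; lra.
by move=> [? ?]; apply/andP; split; lra.
Qed.
Lemma dsq_sq v : sq R (dsq v) <-> disk R 2 v.
Proof. by rewrite -sqd_disk dsqK. Qed.

End disk_square.

(** * The square grid as a cell complex *)

Section grid.
Context {R : realType}.
Implicit Types (al be : bool).

(** A product cell has dimension [al + be], where the booleans tell which of the factors are
    intervals. Entries are read at natural numbers, with value 0 out of range, to avoid casts of
    ordinals; the second coordinate is entry [al], since it comes first when the first factor is a
    point. *)
Definition ent n (w : 'rV[R]_n) (i : nat) : R := \sum_(j < n | j == i :> nat) w ord0 j.
Definition coords al be (w : 'rV[R]_(al + be)) : R * R := (al%:R * ent w 0, be%:R * ent w al).

Lemma cts_coords al be : continuous (@coords al be).
Proof. by rewrite -/(cts _) /coords /ent; cts. Qed.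

Lemma entE n (w : 'rV[R]_n) (j : 'I_n) : ent w j = w ord0 j.
Proof.
rewrite /ent (bigD1 j)//= big1 ?addr0// => i /andP[/eqP ij].
by rewrite -val_eqE/= ij eqxx.
Qed.

Lemma coords1 al be (w : 'rV[R]_(al + be)) : ~~ al -> (coords w).1 = 0.
Proof. by case: al w => // w _; rewrite /coords /= mul0r. Qed.
Lemma coords2 al be (w : 'rV[R]_(al + be)) : ~~ be -> (coords w).2 = 0.
Proof. by case: be w => // w _; rewrite /coords /= mul0r. Qed.

Lemma coords_entry al be (w : 'rV[R]_(al + be)) (j : 'I_(al + be)) :
  w ord0 j = if al && (j == 0 :> nat) then (coords w).1 else (coords w).2.
Proof.
case: al be w j => [] [] w j /=; rewrite ?mul1r.
- by case: (unliftP ord0 j) => [i ->|->] /=; rewrite -entE//= (ord1 i).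
- by rewrite (ord1 j) /= -entE.
- by rewrite (ord1 j) /= -entE.
- by case: j.
Qed.

Lemma coords_inj al be : injective (@coords al be).
Proof. by move=> v w vw; apply/rowP => j; rewrite !coords_entry vw. Qed.

Lemma coords_surj al be (s : R * R) : (~~ al -> s.1 = 0) -> (~~ be -> s.2 = 0) ->
  exists w : 'rV[R]_(al + be), coords w = s.
Proof.
case: s => x y /= s1 s2.
exists (\row_j if al && (j == 0 :> nat) then x else y).
case: al be s1 s2 => [] [] s1 s2; rewrite /coords /ent /= ?mul1r ?mul0r.
- rewrite (big_pred1 (ord0 : 'I_2)) ?mxE//; congr pair.
  by rewrite (big_pred1 (lift ord0 ord0 : 'I_2)) ?mxE.
- by rewrite (big_pred1 (ord0 : 'I_1)) ?mxE// s2.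
- by rewrite (big_pred1 (ord0 : 'I_1)) ?mxE// s1.
- by rewrite s1// s2.
Qed.

Lemma coords_norm al be (w : 'rV[R]_(al + be)) :
  `|w| = Num.max `|(coords w).1| `|(coords w).2|.
Proof.
apply/eqP; rewrite eq_le; apply/andP; split.
  apply: mxnorm_le => [|j]; first by rewrite le_max normr_ge0.
  by rewrite coords_entry le_max; case: ifP; rewrite lexx ?orbT.
rewrite ge_max; apply/andP; split.
  case: al w => w; last by rewrite coords1// normr0.
  have := entry_le_mxnorm w (ord0 : 'I_(1 + be)); by rewrite coords_entry.
case: be w => w; last by rewrite coords2// normr0.
have ial : (al < al + true)%N by rewrite addn1.
have E : al && ((al : nat) == 0%N) = false by case: (al).
by have := entry_le_mxnorm w (Ordinal ial); rewrite coords_entry /= E.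
Qed.

Context (n : nat).
Context (n0 : (0 < n)%N).
Let N : R := n%:R.
Let N2 : R := 2 * N.

(* The cells of the subdivision of [[0, 1]] into [n] intervals are numbered from
   left to right: even numbers for the vertices, odd ones for the intervals. *)
Definition cl1 (a : nat) (x : R) := `|N2 * x - a%:R| <= (odd a)%:R.
Definition op1 (a : nat) (x : R) := `|N2 * x - a%:R| < 1 /\ (~~ odd a -> N2 * x = a%:R).
Definition face1 (a' a : nat) := (a' == a) || odd a && ((a' == a.+1) || (a'.+1 == a)).

Let N0 : 0 < N. Proof. by rewrite ltr0n. Qed.
Let N20 : 0 < N2. Proof. by rewrite mulr_gt0. Qed.

Lemma op_cl1 a x : op1 a x -> cl1 a x.
Proof.
rewrite /op1 /cl1; case: (odd a) => [[/ltW//]|[_ -> //]].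
by rewrite subrr normr0.
Qed.

(** Distinct cells with a common point would have consecutive numbers. One number is then even,
    which puts the point at that vertex, at distance exactly 1 from the other number. *)
Lemma op1_inj a a' x : op1 a x -> op1 a' x -> a = a'.
Proof.
wlog aa' : a a' / (a <= a')%N => [W o o'|o o'].
  by have /orP[h|h] := leq_total a a'; [exact: W|apply/esym/W].
move: o o' => [h e] [h' e'].
have : a'%:R < a%:R + 2 :> R.
  by move: h h'; rewrite !ltr_norml => /andP[? ?] /andP[? ?]; lra.
rewrite -natrD ltr_nat addn2 ltnS => a'a.
have [//|na] := eqVneq a a'.
have E : a' = a.+1 by apply/eqP; rewrite eqn_leq a'a ltn_neqAle na.
have D : `|a%:R - a'%:R : R| = 1 by rewrite E -natr1 opprD addNKr normrN1.
have [oa|oa] := boolP (odd a).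
  by move: h; rewrite e' ?E/= ?oa// -E distrC D ltxx.
by move: h'; rewrite e// D ltxx.
Qed.

Lemma op1_exists x : 0 <= x <= 1 -> exists a : 'I_n.*2.+1, op1 a x.
Proof.
move=> /andP[x0 x1]; have Nx0 : 0 <= N * x by rewrite mulr_ge0// ltW.
have := truncn_itv Nx0; set k := Num.truncn _ => /andP[k1 k2].
have NxN : N * x <= N by rewrite ler_piMr// ltW.
have [E|ne] := eqVneq (N * x) k%:R.
  have kn : (k.*2 < n.*2.+1)%N by rewrite ltnS leq_double -(ler_nat R) -E.
  have E2 : N2 * x = k.*2%:R by rewrite /N2 -mulrA E -muln2 natrM mulrC.
  by exists (Ordinal kn); split => [|_] /=; rewrite E2// subrr normr0.
have k1' : k%:R < N * x by rewrite lt_neqAle k1 eq_sym ne.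
have kn : (k.*2.+1 < n.*2.+1)%N.
  by rewrite ltnS ltn_double -(ltr_nat R); apply: lt_le_trans k1' NxN.
exists (Ordinal kn); split; rewrite /= ?odd_double//.
have E2 : (k.*2.+1%:R : R) = 2 * k%:R + 1 by rewrite -natr1 -muln2 natrM mulrC.
rewrite E2 /N2 ltr_norml -mulrA; move: k1' k2; rewrite -natr1 => ? ?.
by apply/andP; split; lra.
Qed.

Lemma cl1_face a' a x : face1 a' a -> cl1 a' x -> cl1 a x.
Proof.
rewrite /face1 => /predU1P[->//|/andP[oa aa]].
have oa' : odd a' = false by case/orP: aa oa => /eqP; [move=> -> /=|move=> <- /=]; case: odd.
rewrite /cl1 oa oa' normr_le0 subr_eq0 => /eqP ->.
case/orP: aa => /eqP E; [rewrite E|rewrite -E]; rewrite -natr1.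
  by rewrite addrAC subrr add0r normr1.
by rewrite opprD addNKr normrN1.
Qed.

Lemma odd_face1 a' a : face1 a' a -> (odd a' <= odd a)%N /\ (a' != a -> odd a' < odd a)%N.
Proof.
case/predU1P => [->|/andP[oa aa]]; first by rewrite leqnn eqxx.
have -> : odd a' = false by case/orP: aa oa => /eqP; [move=> -> /=|move=> <- /=]; case: odd.
by rewrite oa.
Qed.

Lemma face1_op a' a x : face1 a' a -> cl1 a' x -> op1 a x -> a' = a.
Proof.
case/predU1P => [->//|/andP[oa aa]] c [+ _].
have oa' : odd a' = false by case/orP: aa oa => /eqP; [move=> -> /=|move=> <- /=]; case: odd.
move: c; rewrite /cl1 oa' normr_le0 subr_eq0 => /eqP ->.
case/orP: aa => /eqP E; [rewrite E|rewrite -E]; rewrite -natr1.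
  by rewrite addrAC subrr add0r normr1 ltxx.
by rewrite opprD addNKr normrN1 ltxx.
Qed.

Lemma cl1_itv (a : 'I_n.*2.+1) x : cl1 a x -> 0 <= x <= 1.
Proof.
have an : a%:R <= N2.
  by rewrite /N2 /N -natrM mul2n ler_nat -ltnS.
rewrite /cl1; have [oa|oa] /= := boolP (odd a); rewrite ?mulr1n.
  have a1 : 1 <= a%:R :> R by rewrite ler1n; case: (a : nat) oa.
  have an' : a%:R + 1 <= N2.
    rewrite natr1 /N2 /N -natrM mul2n ler_nat ltn_neqAle -ltnS ltn_ord andbT.
    by apply/eqP => E; move: oa; rewrite E odd_double.
  rewrite ler_norml => /andP[h1 h2]; rewrite -(pmulr_rge0 _ N20) -[x <= 1](ler_pM2l N20).
  by rewrite mulr1; apply/andP; split; lra.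
rewrite normr_le0 subr_eq0 => /eqP E; rewrite -(pmulr_rge0 _ N20) -[x <= 1](ler_pM2l N20).
by rewrite mulr1 E ler0n.
Qed.

Lemma cl1_op_face (a : 'I_n.*2.+1) x : cl1 a x -> exists a' : 'I_n.*2.+1, face1 a' a /\ op1 a' x.
Proof.
move=> c; have [a' oa'] := op1_exists (cl1_itv c); exists a'; split => //.
rewrite /face1; have [//|ne] := eqVneq (a' : nat) a.
move: c; rewrite /cl1; have [oa|oa] /= := boolP (odd a); last first.
  rewrite normr_le0 subr_eq0 => /eqP E; exfalso; move/eqP: ne; apply.
  by apply: op1_inj oa' _; split => //; rewrite E subrr normr0.
rewrite le_eqVlt => /orP[/eqP E|lt1]; last first.
  by exfalso; move/eqP: ne; apply; apply: op1_inj oa' _; split => //; rewrite oa.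
have op_ev b : (b < n.*2.+1)%N -> ~~ odd b -> N2 * x = b%:R -> a' = b :> nat.
  by move=> bn ob E'; apply: op1_inj oa' _; split => //; rewrite E' subrr normr0.
have a0 := odd_gt0 oa.
have [p|p] := ler0P (N2 * x - a%:R); move: E; [rewrite ler0_norm//|rewrite gtr0_norm//] => E.
  have Ep : a.-1.+1 = a by rewrite prednK.
  have -> : a' = a.-1 :> nat.
    apply: op_ev; [by apply: leq_ltn_trans (leq_pred _) _|by move: oa; rewrite -Ep|].
    by move: E; rewrite -[X in X%:R]Ep -natr1; rewrite mulr1n; lra.
  by rewrite Ep eqxx orbT.
have -> : a' = a.+1 :> nat; last by rewrite eqxx.
apply: op_ev; last by rewrite -natr1; move: E; rewrite mulr1n; lra.
  rewrite ltnS ltn_neqAle -ltnS ltn_ord andbT.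
  by apply/eqP => E'; move: oa; rewrite E' odd_double.
by rewrite /= oa.
Qed.

Definition gcell (c : 'I_n.*2.+1 * 'I_n.*2.+1) : set (R * R) :=
  [set p | cl1 c.1 p.1 /\ cl1 c.2 p.2].
Definition gcell_int (c : 'I_n.*2.+1 * 'I_n.*2.+1) : set (R * R) :=
  [set p | op1 c.1 p.1 /\ op1 c.2 p.2].
Definition gdim (c : 'I_n.*2.+1 * 'I_n.*2.+1) : nat := odd c.1 + odd c.2.
Definition gpt (c : 'I_n.*2.+1 * 'I_n.*2.+1) (s : R * R) : R * R :=
  ((c.1%:R + s.1) / N2, (c.2%:R + s.2) / N2).
(** The model disk is made a cube first, so that the affine map [gpt] fits it to a rectangular
    cell. *)
Definition gparam c (w : 'rV[R]_(gdim c)) : 'rV[R]_2 := sqd (gpt c (coords (cube w))).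

Lemma gparam_cts c : continuous (@gparam c).
Proof.
have h := @cube_cts R (gdim c); have h' := @cts_coords (odd c.1) (odd c.2).
rewrite -/(cts _) /gparam; apply: (cts_comp (@sqd_cts R)); rewrite /gpt.
apply: (cts_comp (h := fun s : R * R => ((c.1%:R + s.1) / N2, (c.2%:R + s.2) / N2))).
  by cts.
exact: (cts_comp h' h).
Qed.

Lemma gpt_inj c : injective (gpt c).
Proof.
move=> [x y] [x' y'] [/= /(mulIf _) + /(mulIf _)]; rewrite invr_eq0 gt_eqF//.
by move=> /(_ isT) /addrI -> /(_ isT) /addrI ->.
Qed.

Lemma gparam_inj c : injective (@gparam c).
Proof.
by move=> v w /(can_inj sqdK) /gpt_inj /coords_inj /(can_inj cubeK).
Qed.

Lemma gptE c s : (N2 * (gpt c s).1 - c.1%:R = s.1) * (N2 * (gpt c s).2 - c.2%:R = s.2).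
Proof. by split; rewrite /gpt/= mulrC divfK ?gt_eqF// addrC addKr. Qed.

Lemma gparam_disk c w : gcell c (dsq (@gparam c w)) <-> disk R _ w.
Proof.
rewrite /gparam sqdK /gcell /mkset /cl1 !gptE diskP -cube_norm coords_norm ge_max.
set s := coords _; split => [[h1 h2]|/andP[h1 h2]].
  by apply/andP; split; [apply: le_trans h1 _|apply: le_trans h2 _]; rewrite lern1 leq_b1.
by split; [case: (boolP (odd c.1)) => [//|o]; rewrite /s coords1// normr0|
  case: (boolP (odd c.2)) => [//|o]; rewrite /s coords2// normr0].
Qed.

Lemma gparam_open_disk c w : gcell_int c (dsq (@gparam c w)) <-> open_disk R _ w.
Proof.
rewrite /gparam sqdK /gcell_int /mkset /op1 open_diskP -cube_norm coords_norm gt_max.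
have E a x b : N2 * x - a%:R = b -> (N2 * x = a%:R) <-> b = 0.
  by move=> <-; split => [->|/eqP]; rewrite ?subrr// subr_eq0 => /eqP.
rewrite (E _ _ _ (gptE c _).1) (E _ _ _ (gptE c _).2) !gptE.
set s := coords _; split => [[[h1 _] [h2 _]]|/andP[h1 h2]]; first by rewrite h1.
by split; split => // o; rewrite /s ?coords1 ?coords2.
Qed.

Lemma gparam_surj c p : gcell c p -> exists w, p = dsq (@gparam c w).
Proof.
move=> [h1 h2].
have [||w ws] := @coords_surj (odd c.1) (odd c.2) (N2 * p.1 - c.1%:R, N2 * p.2 - c.2%:R).
- by move=> o; move: h1; rewrite /cl1 (negbTE o) normr_le0 => /eqP.
- by move=> o; move: h2; rewrite /cl1 (negbTE o) normr_le0 => /eqP.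
exists (uncube w); rewrite /gparam sqdK uncubeK ws /gpt/=.
rewrite !(addrC _%:R) !subrK.
by case: (p) => x y /=; congr pair; rewrite mulrC mulKf// gt_eqF.
Qed.

Lemma gcell_int_sub c : gcell_int c `<=` gcell c.
Proof. by move=> p [/op_cl1 ? /op_cl1 ?]. Qed.

Lemma gparam_carrier c : cell_carrier (@gparam c) = sqd @` gcell c.
Proof.
apply/seteqP; split => [_ [w /gparam_disk wd <-]|_ [p pc <-]].
  by exists (dsq (gparam w)) => //; rewrite dsqK.
have [w pw] := gparam_surj pc; exists w; last by rewrite pw dsqK.
by apply/gparam_disk; rewrite -pw.
Qed.

Lemma gparam_int c : cell_int (@gparam c) = sqd @` gcell_int c.
Proof.
apply/seteqP; split => [_ [w /gparam_open_disk wd <-]|_ [p pc <-]].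
  by exists (dsq (gparam w)) => //; rewrite dsqK.
have [w pw] := gparam_surj (gcell_int_sub pc); exists w; last by rewrite pw dsqK.
by apply/gparam_open_disk; rewrite -pw.
Qed.

Lemma gparam_bd c : cell_bd (@gparam c) = sqd @` (gcell c `\` gcell_int c).
Proof.
apply/seteqP; split => [_ [w ws <-]|_ [p [pc pi] <-]].
  exists (dsq (gparam w)); last by rewrite dsqK.
  split; first by apply/gparam_disk; exact: sphere_disk.
  by move=> /gparam_open_disk /open_diskP; move/sphereP: ws => ->; rewrite ltxx.
have [w pw] := gparam_surj pc; exists w; last by rewrite pw dsqK.
have /disk_split[|//] : disk R _ w by apply/gparam_disk; rewrite -pw.
by move=> /gparam_open_disk; rewrite -pw.
Qed.

Lemma gdim_le2 c : (gdim c <= 2)%N.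
Proof. by rewrite /gdim; case: odd; case: odd. Qed.

Lemma gparamP c : cell_param (@gparam c).
Proof.
split; first by apply: continuous_subspaceT; exact: gparam_cts.
by move=> v w _ _; exact: gparam_inj.
Qed.

Lemma grid_cover : disk R 2 = \bigcup_(c in [set: _]) cell_int (@gparam c).
Proof.
apply/seteqP; split => [v /dsq_sq /sqP[v1 v2]|v [c _]].
  have [a oa] := op1_exists v1; have [b ob] := op1_exists v2.
  by exists (a, b) => //; rewrite gparam_int; exists (dsq v) => //; rewrite dsqK.
rewrite gparam_int => -[p /gcell_int_sub[/cl1_itv p1 /cl1_itv p2] <-].
by apply/sqd_disk/sqP.
Qed.

Lemma grid_triv : trivIset [set: _] (fun c => cell_int (@gparam c)).
Proof.
move=> [a b] [a' b'] _ _ [v []]; rewrite !gparam_int.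
move=> [p [ o1 o2] <-] [p' [ o1' o2'] /(can_inj sqdK) pp].
rewrite pp in o1' o2'; congr pair; apply: val_inj.
  exact: op1_inj o1 o1'.
exact: op1_inj o2 o2'.
Qed.

Lemma grid_bdP c : exists2 D : set ('I_n.*2.+1 * 'I_n.*2.+1),
  (forall d, D d -> (gdim d < gdim c)%N) &
  cell_bd (@gparam c) = \bigcup_(d in D) cell_carrier (@gparam d).
Proof.
exists [set d : 'I_n.*2.+1 * 'I_n.*2.+1 | [/\ face1 d.1 c.1, face1 d.2 c.2 & d <> c]].
  move=> [a' b'] [/= fa fb ne]; rewrite /gdim.
  have [la sa] := odd_face1 fa; have [lb sb] := odd_face1 fb.
  have [aa|na] := eqVneq (a' : nat) c.1.
    rewrite aa /= ltn_add2l; apply: sb; apply/eqP => bb; apply: ne.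
    by case: (c) aa bb => a b /= /val_inj -> /val_inj ->.
  by rewrite -addSn leq_add// sa.
rewrite gparam_bd; apply/seteqP; split => [_ [p [[c1 c2] nc] <-]|v [[a' b'] [fa fb ne]]].
  have [a' [fa oa]] := cl1_op_face c1; have [b' [fb ob]] := cl1_op_face c2.
  exists (a', b').
    by split => //= E; apply: nc; rewrite -E.
  by rewrite gparam_carrier; exists p => //; split; exact: op_cl1.
rewrite gparam_carrier => -[p [/= c1 c2] <-]; exists p => //; split.
  by split; [exact: cl1_face fa c1|exact: cl1_face fb c2].
move=> [ o1 o2]; apply: ne; move: (face1_op fa c1 o1) (face1_op fb c2 o2).
by case: (c) => a b /= /val_inj -> /val_inj ->.
Qed.

Definition grid : cell_complex R := CellComplex gdim_le2 gparamP grid_cover grid_triv grid_bdP.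

End grid.

(** * From P-DADP* to FRP* *)

Section polyhedra.
Context {R : realType}.
Implicit Types K L : complex1.

Definition edge_pt n (i j : 'I_n) (t : R) : 'rV[R]_n :=
  (1 - t) *: delta_mx ord0 i + t *: delta_mx ord0 j.

Lemma cts_edge_pt (S : topologicalType) n (i j : 'I_n) (f : S -> R) :
  cts f -> cts (fun x => edge_pt i j (f x)).
Proof. by move=> cf; rewrite /edge_pt; cts. Qed.

Lemma edge_pt_vertex n (i : 'I_n) t : edge_pt i i t = delta_mx ord0 i.
Proof. by rewrite /edge_pt -scalerDl subrK scale1r. Qed.
Lemma edge_pt0 n (i j : 'I_n) : edge_pt i j 0 = delta_mx ord0 i.
Proof. by rewrite /edge_pt subr0 scale1r scale0r addr0. Qed.
Lemma edge_pt1 n (i j : 'I_n) : edge_pt i j 1 = delta_mx ord0 j.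
Proof. by rewrite /edge_pt subrr scale1r scale0r add0r. Qed.
Lemma edge_ptC n (i j : 'I_n) t : edge_pt i j t = edge_pt j i (1 - t).
Proof. by rewrite /edge_pt opprB addrCA subrr addr0 addrC. Qed.

Lemma vertex_poly K i : polyhedron R K (delta_mx ord0 i).
Proof.
exists i, i, 0; split; [by left|by rewrite lexx ler01|].
by rewrite -/(edge_pt _ _ _) edge_pt0.
Qed.
Lemma edge_poly K (i j : 'I_(vert K)) t : adj i j -> 0 <= t <= 1 -> polyhedron R K (edge_pt i j t).
Proof. by move=> ij ti; exists i, j, t; split => //; right. Qed.

Lemma compact_edge n (i j : 'I_n) : compact (edge_pt i j @` II R).
Proof.
apply: continuous_compact; last exact: compact_II.
by apply: continuous_subspaceT; apply: cts_edge_pt; exact: cts_id.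
Qed.

Lemma compact_bigcup_fin (S : topologicalType) (I : finType) (A : I -> set S) :
  (forall i, compact (A i)) -> compact (\bigcup_(i in [set: I]) A i).
Proof.
move=> cA; rewrite -bigsetU_fset_set ?fset_setT//; last exact: finite_finset.
by apply: bigsetU_compact.
Qed.

Lemma compact_poly K : compact (polyhedron R K).
Proof.
pose A (ij : 'I_(vert K) * 'I_(vert K)) :=
  if (ij.1 == ij.2) || adj ij.1 ij.2 then edge_pt ij.1 ij.2 @` II R else set0.
rewrite (_ : polyhedron R K = \bigcup_(ij in [set: _]) A ij).
  apply: compact_bigcup_fin => ij; rewrite /A; case: ifP => _; last exact: compact0.
  exact: compact_edge.
apply/seteqP; split => [x [i [j [t [ij ti ->]]]]|x [[i j] _]].
  exists (i, j) => //; rewrite /A /= ifT; last by case: ij => [->|->]; rewrite ?eqxx ?orbT.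
  by exists t => //; rewrite IIP.
rewrite /A; case: ifP => //= ij [t /IIP ti <-]; exists i, j, t; split => //.
by case/predU1P: ij; [left|right].
Qed.

Lemma closed_poly K : closed (polyhedron R K).
Proof. by apply: compact_closed; [exact: norm_hausdorff|exact: compact_poly]. Qed.

Lemma compact_cyl K : compact (cyl R K).
Proof. by apply: compact_setX; [exact: compact_poly|exact: compact_II]. Qed.

End polyhedra.

(** * The boundary circle lies in the 1-skeleton *)

Section cells2.
Context {R : realType}.

(** Removes the dependent dimension [cdim c] once it is known to be 2. *)
Lemma cell2_param (S : topologicalType) k (h : 'rV[R]_k -> S) : k = 2%N -> cell_param h ->
  exists b : 'rV[R]_2 -> S,
    [/\ cell_param b, cell_carrier b = cell_carrier h & cell_int b = cell_int h].
Proof. by move=> k2; move: h; rewrite k2 => h; exists h. Qed.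

Definition row_pair (v : 'rV[R]_2) : R * R := (v ord0 ord0, v ord0 (lift ord0 ord0)).
Lemma cts_row_pair : cts row_pair.
Proof. by rewrite /row_pair; cts. Qed.
Lemma row_pair_inj : injective row_pair.
Proof. by move=> v w H; rewrite -(pair_rowK v) -(pair_rowK w) -/(row_pair _) H. Qed.

(** A point [x] of the circle inside an open 2-cell would, by invariance of domain, have points (1 +
    e / 2) x of that cell beyond it, outside of the disk. *)
Lemma sphere_skeleton1 (T : cell_complex R) : sphere R 2 `<=` skeleton1 T.
Proof.
move=> x xs; have : disk R 2 x by exact: sphere_disk.
rewrite (cell_cover T) => -[c _ xc].
have [c1|c2] := leqP (cdim c) 1.
  exists c => //; case: xc => v vd <-; exists v => //; exact: open_disk_sub.
have {}c2 : cdim c = 2%N by apply/eqP; rewrite eqn_leq cdim_le2 c2.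
have [b [[cb bi] bE bI]] := cell2_param c2 (cparamP c).
have xb : cell_int b x by rewrite bI.
have bd v : cell_int b v -> disk R 2 v by rewrite bI (cell_cover T) => ?; exists c.
have cp : cell_param (row_pair \o b).
  split; last by move=> v w vd wd /row_pair_inj /bi; exact.
  by apply: within_compT cb _; exact: cts_row_pair.
have /(_ (row_pair x)) := injective_disk_open cp; rewrite /interior.
have -> : cell_int (row_pair \o b) = row_pair @` cell_int b by rewrite /cell_int image_comp.
have cs : cts (fun s : R => row_pair (s *: x)) by apply: (cts_comp cts_row_pair); cts.
move=> op; have /op : (row_pair @` cell_int b) (row_pair x) by exists x.
rewrite -{1}(scale1r x) => /(cs 1) /nbhs_ballP[e /= e0 H].
have : ball (1 : R) e (1 + e / 2).
  by rewrite /ball/= opprD addNKr normrN gtr0_norm ?divr_gt0//; lra.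
move=> /H[v /bd + /row_pair_inj vE]; rewrite diskP vE nrmZ.
by move/sphereP: xs => ->; rewrite mulr1 gtr0_norm; lra.
Qed.

End cells2.

(** * Disjoint approximation of arcs *)

Section disjoint_arcs.
Context {R : realType} {X : metricType R}.

(** A common consequence of both properties. It clears the walls over the vertices in one direction
    and the grid lines in the other. *)
Definition arcs_disjoint := forall (w : R -> X) (L : complex1) (al : 'rV[R]_(vert L) -> X) (e : R),
  cts w -> {within polyhedron R L, continuous al} -> 0 < e ->
  exists (w' : R -> X) (al' : 'rV[R]_(vert L) -> X),
    [/\ cts w' /\ {within polyhedron R L, continuous al'},
      forall t, 0 <= t <= 1 -> mdist (w t) (w' t) < e,
      eps_approximation (polyhedron R L) e al al' &
      forall t x, 0 <= t <= 1 -> polyhedron R L x -> w' t <> al' x].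

Lemma map_onT (S : topologicalType) (Z : set S) (f : S -> X) :
  {within Z, continuous f} -> map_on Z setT f.
Proof. by move=> cf; split. Qed.

(** The path is spread over the disk as a function of the first coordinate, and read back on the
    upper half circle, which lies in the 1-skeleton of every cell complex of the disk. *)
Lemma P_DADP_arcs_disjoint : P_DADP_star X -> arcs_disjoint.
Proof.
move=> P w L al e cw cal e0.
pose f (v : 'rV[R]_2) := w ((1 + v ord0 ord0) / 2).
have cf : cts f by rewrite /f; cts.
have [T [f' [al' [[[cf' _] ff'] [[cal' al'T] aal'] _]]]] :=
  P f L al e (map_onT (continuous_subspaceT cf)) (map_onT cal) e0.
pose a (t : R) : 'rV[R]_2 :=
  pair_row (2 * clamp t - 1, Num.sqrt (1 - (2 * clamp t - 1) ^+ 2)).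
have as1 t : sphere R 2 (a t).
  rewrite sphereP /nrm sqn2 !mxE/= sqr_sqrtr; first by rewrite addrC subrK sqrtr1.
  have /andP[t0 t1] := clamp_itv t; rewrite subr_ge0 expr2; nra.
have ca : cts a by rewrite /a; apply: cts_pair_row; cts.
exists (fun t => f' (a t)), al'; split => //.
- split=> //; apply: within_setT; apply: (within_comp (f := a)) cf' _.
    exact: continuous_subspaceT.
  by move=> _ [t _ <-]; exact/sphere_disk.
- move=> t ti; have := ff' _ (sphere_disk (as1 t)).
  by rewrite /f /a mxE /= clamp_id// (_ : (1 + _) / 2 = t); last field.
- move=> t x _ xL E; have /al'T : (al' @` polyhedron R L) (al' x) by exists x.
  by apply; exists (a t) => //; exact/sphere_skeleton1/as1.
Qed.

End disjoint_arcs.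

(** * Walls, collars and strips *)

Section tools.
Context {R : realType} {X : metricType R}.

Lemma fin_min (I : finType) (P : I -> R -> Prop) :
  (forall i r r', 0 < r' -> r' <= r -> P i r -> P i r') ->
  (forall i, exists2 r, 0 < r & P i r) -> exists2 r, 0 < r & forall i, P i r.
Proof.
move=> Pm H; suff : forall s : seq I, exists2 r, 0 < r & forall i, i \in s -> P i r.
  by move=> /(_ (enum I))[r r0 Pr]; exists r => // i; apply: Pr; rewrite mem_enum.
elim=> [|i s [r r0 Pr]]; first by exists 1.
have [r' r'0 Pr'] := H i.
have m0 : 0 < Num.min r r' by rewrite lt_min r0.
exists (Num.min r r') => // j; rewrite inE => /predU1P[->|js].
  by apply: Pm Pr' => //; rewrite ge_min lexx orbT.
by apply: Pm (Pr _ js) => //; rewrite ge_min lexx.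
Qed.

(** Walls are cleared one at a time. Clearing the next one moves [al] by less than half of the gap
    obtained so far, so the earlier walls keep half of it. *)
Lemma disjoint_walls (V : finType) (w : V -> R -> X) (L : complex1)
    (al : 'rV[R]_(vert L) -> X) (e : R) : arcs_disjoint (X := X) ->
  (forall i, cts (w i)) -> {within polyhedron R L, continuous al} -> 0 < e ->
  exists (w' : V -> R -> X) (al' : 'rV[R]_(vert L) -> X) (c : R),
  [/\ (forall i, cts (w' i)) /\ {within polyhedron R L, continuous al'},
    forall i t, 0 <= t <= 1 -> mdist (w i t) (w' i t) < e,
    eps_approximation (polyhedron R L) e al al', 0 < c &
    forall i t x, 0 <= t <= 1 -> polyhedron R L x -> c <= mdist (w' i t) (al' x)].
Proof.
move=> AD cw cal e0.
suff : forall s : seq V, exists (w' : V -> R -> X) (al' : 'rV[R]_(vert L) -> X) (c : R),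
  [/\ (forall i, cts (w' i)) /\ {within polyhedron R L, continuous al'},
    forall i t, 0 <= t <= 1 -> mdist (w i t) (w' i t) < e,
    eps_approximation (polyhedron R L) e al al', 0 < c &
    forall i t x, i \in s -> 0 <= t <= 1 -> polyhedron R L x -> c <= mdist (w' i t) (al' x)].
  move=> /(_ (enum V)) [w' [al' [c [H1 H2 H3 H4 H5]]]]; exists w', al', c; split => // i t x.
  by apply: H5; rewrite mem_enum.
move=> s; elim: s e e0 => [|i s IH] e e0.
  exists w, al, 1; split => // [i t _|x _]; by rewrite mdistxx.
have e20 : 0 < e / 2 by lra.
have [w1 [al1 [c [[cw1 cal1] h2 h3 c0 h5]]]] := IH _ e20.
have m0 : 0 < Num.min (e / 2) (c / 2) by rewrite lt_min e20; lra.
have [wi [al2 [[cwi cal2] k2 k3 k4]]] := AD _ _ _ _ (cw1 i) cal1 m0.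
have cwi' : {within II R, continuous wi} by apply: continuous_subspaceT.
have [|d d0 dP] := gap compact_II (compact_poly (K := L)) cwi' cal2.
  by move=> t x /IIP ti xL; exact: k4.
exists (fun j => if j == i then wi else w1 j), al2, (Num.min (c / 2) d); split.
- by split=> // j; case: ifP.
- move=> j t ti; have h := h2 j t ti; case: eqP => [ji|_]; last by lra.
  have := k2 t ti; rewrite lt_min -ji => /andP[k _].
  by apply: le_lt_trans (metric_triangle _ (w1 j t) _) _; lra.
- move=> x xL; have := k3 x xL; rewrite lt_min => /andP[k _].
  by apply: le_lt_trans (metric_triangle _ (al1 x) _) _; have := h3 x xL; lra.
- by rewrite lt_min d0 andbT; lra.
- move=> j t x; rewrite inE ge_min; case: eqP => [->|_] /= js ti xL.
    by rewrite dP ?orbT ?IIP.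
  have := k3 x xL; rewrite lt_min => /andP[_ k]; apply/orP; left.
  have := metric_triangle (w1 j t) (al2 x) (al1 x); have := h5 j t x js ti xL.
  by rewrite (metric_sym (al2 x)); lra.
Qed.

Lemma closed_halves (f : R * R -> R) c : cts f ->
  [/\ closed [set p | f p <= c], closed [set p | c <= f p] &
    [set p | f p <= c] `|` [set p | c <= f p] = setT].
Proof.
move=> cf; split.
- by apply: (@preimage_closed _ _ f [set x | x <= c]); [move=> x _; exact: cf|exact: closed_le].
- by apply: (@preimage_closed _ _ f [set x | c <= x]); [move=> x _; exact: cf|exact: closed_ge].
- by apply/seteqP; split => // t _ /=; case: (lerP (f t) c) => [|/ltW]; [left|right].
Qed.

Lemma paste_at (f : R * R -> R) c (A B : R * R -> X) : cts f -> cts A -> cts B ->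
  (forall p, f p = c -> A p = B p) ->
  exists G : R * R -> X, [/\ cts G, forall p, f p <= c -> G p = A p & forall p, c <= f p -> G p = B p].
Proof.
move=> cf cA cB AB; have [cl1 cl2 cov] := closed_halves c cf.
have [|||h ch [hA hB]] := @paste2 _ _ _ _ A B cl1 cl2 cov.
- exact: continuous_subspaceT.
- exact: continuous_subspaceT.
- by move=> p /= p1 p2; apply: AB; apply/eqP; rewrite eq_le p1.
- by exists h.
Qed.

(** Changes the sides of a square: [G] is squeezed into the columns from [h] to [1 - h], and [K0],
    [K1] lead in the margins from the new sides, at parameter 0, to those of [G], at parameter 1. *)
Lemma collar (G K0 K1 : R * R -> X) (h : R) : cts G -> cts K0 -> cts K1 -> 0 < h < 2^-1 ->
  (forall t, 0 <= t <= 1 -> K0 (1, t) = G (0, t)) ->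
  (forall t, 0 <= t <= 1 -> K1 (1, t) = G (1, t)) ->
  exists G' : R * R -> X, [/\ cts G',
    forall t, 0 <= t <= 1 -> G' (0, t) = K0 (0, t) /\ G' (1, t) = K1 (0, t) &
    forall u t, 0 <= u <= 1 -> 0 <= t <= 1 ->
    [/\ u <= h -> exists2 s, 0 <= s <= 1 & G' (u, t) = K0 (s, t),
        h <= u <= 1 - h -> G' (u, t) = G ((u - h) / (1 - 2 * h), t) &
        1 - h <= u -> exists2 s, 0 <= s <= 1 & G' (u, t) = K1 (s, t)]].
Proof.
move=> cG cK0 cK1 /andP[h0 h1] e0 e1.
have d0 : 0 < 1 - 2 * h by lra.
have c0 : clamp (0 : R) = 0 by exact: clamp_le0.
have c1 : clamp (1 : R) = 1 by exact: clamp_ge1.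
have [||||G1 [cG1 GA GB]] := @paste_at fst (1 - h)
    (fun p => G (clamp ((p.1 - h) / (1 - 2 * h)), clamp p.2))
    (fun p => K1 (clamp ((1 - p.1) / h), clamp p.2)).
- by cts.
- by cts.
- by cts.
- move=> p ->; have -> : 1 - h - h = 1 - 2 * h by ring.
  have -> : 1 - (1 - h) = h by ring.
  by rewrite !divff ?gt_eqF// c1 e1 ?clamp_itv.
have [||||G' [cG' GC GD]] := @paste_at fst h
    (fun p => K0 (clamp (p.1 / h), clamp p.2)) G1.
- by cts.
- by cts.
- by cts.
- move=> p ph; rewrite ph divff ?gt_eqF// c1 e0 ?clamp_itv// GA ?ph; last by lra.
  by rewrite subrr mul0r c0.
exists G'; split => //.
  move=> t ti; rewrite GC ?ltW//= GD ?GB //=; [|lra|lra].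
  by rewrite mul0r c0 clamp_id// subrr mul0r c0.
move=> u t ui ti; split.
- by move=> uh; rewrite GC//=; exists (clamp (u / h)); [exact: clamp_itv|rewrite (clamp_id ti)].
- move=> /andP[u1 u2]; rewrite GD//= GA//= (clamp_id ti) clamp_id//.
  by rewrite divr_ge0 ?ler_pdivrMr// ?mul1r; lra.
- move=> u1; rewrite GD/= ?GB//=; last by lra.
  by exists (clamp ((1 - u) / h)); [exact: clamp_itv|rewrite (clamp_id ti)].
Qed.

Definition joined (x y : X) := exists g : R -> X, [/\ cts g, g 0 = x & g 1 = y].

Lemma joined_refl x : joined x x.
Proof. by exists (fun=> x); split => //; cts. Qed.
Lemma joined_sym x y : joined x y -> joined y x.
Proof.
move=> [g [cg g0 g1]]; exists (fun t => g (1 - t)).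
by split; rewrite ?subr0 ?subrr//; cts.
Qed.

Lemma cat_squares (A B : R * R -> X) : cts A -> cts B -> (forall t, A (1, t) = B (0, t)) ->
  exists f : R * R -> X, [/\ cts f, forall u t, u <= 1 -> f (u / 2, t) = A (u, t),
    forall u t, 0 <= u -> f ((1 + u) / 2, t) = B (u, t),
    forall t, f (0, t) = A (0, t) & forall t, f (1, t) = B (1, t)].
Proof.
move=> cA cB AB.
have [||||f [cf fA fB]] := @paste_at fst 2^-1 (fun p => A (2 * p.1, p.2)) (fun p => B (2 * p.1 - 1, p.2)).
- by cts.
- by cts.
- by cts.
- by move=> p ->; rewrite divff ?subrr.
exists f; split => // [u t u0|u t u0|t|t].
- by rewrite fA /=; [congr (A (_, _)); field|lra].
- by rewrite fB /=; [congr (B (_, _)); field|lra].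
- by rewrite fA /=; [congr (A (_, _)); ring|lra].
- by rewrite fB /=; [congr (B (_, _)); ring|lra].
Qed.

Lemma joined_trans x y z : joined x y -> joined y z -> joined x z.
Proof.
move=> [g [cg g0 g1]] [k [ck k0 k1]].
have [|||f [cf _ _ f0 f1]] := @cat_squares (fun p => g p.1) (fun p => k p.1).
- by cts.
- by cts.
- by move=> t /=; rewrite g1 k0.
by exists (fun u => f (u, 0)); split; [cts|rewrite f0|rewrite f1].
Qed.

(** Shrink [w] to its initial point, follow the path [g], then let [w'] grow from its initial
    point. *)
Lemma connect_sides (w w' : R -> X) : cts w -> cts w' -> joined (w 0) (w' 0) ->
  exists J : R * R -> X, [/\ cts J, forall t, J (0, t) = w t & forall t, J (1, t) = w' t].
Proof.
move=> cw cw' [g [cg g0 g1]].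
have [|||f [cf _ _ f0 f1]] := @cat_squares (fun p => g p.1) (fun p => w' (p.1 * p.2)).
- by cts.
- by cts.
- by move=> t /=; rewrite g1 mul0r.
have [|||J [cJ _ _ J0 J1]] := @cat_squares (fun p => w ((1 - p.1) * p.2)) f.
- by cts.
- exact: cf.
- by move=> t /=; rewrite subrr mul0r f0.
by exists J; split => // t; [rewrite J0 subr0 mul1r|rewrite J1 f1 mul1r].
Qed.

(** The strict inequalities leave margins on both sides of each strip; [slide] needs them. *)
Lemma embed_squares (I : eqType) (G : I -> R * R -> X) (x0 : X) (s : seq I) :
  (forall i, cts (G i)) -> (forall i, joined x0 (G i (0, 0))) ->
  exists f : R * R -> X, [/\ cts f, joined x0 (f (0, 0)) &
    forall i, i \in s -> exists p q, [/\ 0 < p, 0 < q, p + q < 1 &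
      forall u t, 0 <= u <= 1 -> f (p + q * u, t) = G i (u, t)]].
Proof.
move=> cG jG; elim: s => [|i s [f [cf jf fP]]].
  by exists (fun=> x0); split => //; [cts|exact: joined_refl].
have [|||J [cJ J0 J1]] := @connect_sides (fun t => G i (1, t)) (fun t => f (0, t)).
- by have cGi := cG i; cts.
- by cts.
- apply: joined_trans jf; apply: joined_trans (joined_sym (jG i)).
  apply: joined_sym; exists (fun u => G i (u, 0)); split => //.
  by have cGi := cG i; cts.
have [|f1 [cf1 _ f1B f10 _]] := @cat_squares J f cJ cf.
  by move=> t; rewrite J1.
have [|||f2 [cf2 f2A f2B f20 _]] := @cat_squares (fun p => G i (clamp (3 * p.1 - 1), p.2)) f1.
- by have cGi := cG i; cts.
- exact: cf1.
- by move=> t /=; rewrite f10 J0 clamp_ge1//; lra.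
exists f2; split => //.
  by rewrite f20 clamp_le0 /=; [exact: jG|lra].
move=> j; rewrite inE => /predU1P[->|/fP[p [q [p0 q0 pq H]]]].
  (* [G i] fills the middle third of the left half. *)
  exists 6^-1, 6^-1; split; [lra|lra|lra|] => u t ui.
  have -> : 6^-1 + 6^-1 * u = ((1 + u) / 3) / 2 by field.
  rewrite f2A /=; last by lra.
  by congr (G i (_, _)); rewrite clamp_id; lra.
(* The previous map [f] fills the right half of the right half. *)
exists ((3 + p) / 4), (q / 4); split; [lra|lra|lra|] => u t ui.
have qu : 0 <= q * u by rewrite mulr_ge0; lra.
have -> : (3 + p) / 4 + q / 4 * u = (1 + (1 + (p + q * u)) / 2) / 2 by field.
rewrite f2B; last by lra.
by rewrite f1B ?H//; lra.
Qed.

End tools.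

(** * Piecewise affine homeomorphisms of the interval *)

Section slides.
Context {R : realType}.
Implicit Types f g : R -> R.

Definition incr_inverse f f' := [/\ {homo f : x y / x <= y}, {homo f' : x y / x <= y},
  cancel f f' & cancel f' f].

Lemma incr_inverse_sym f f' : incr_inverse f f' -> incr_inverse f' f.
Proof. by case. Qed.

(** For increasing bijections the inverse of a minimum is the maximum of the inverses. A piecewise
    affine homeomorphism and its inverse can thus be written without cases. *)
Lemma incr_inverse_min f f' g g' : incr_inverse f f' -> incr_inverse g g' ->
  incr_inverse (fun x => Num.min (f x) (g x)) (fun x => Num.max (f' x) (g' x)).
Proof.
move=> [hf hf' fK f'K] [hg hg' gK g'K]; split.
- by move=> x y xy; rewrite le_min !ge_min hf// hg// orbT.
- by move=> x y xy; rewrite ge_max !le_max hf'// hg'// orbT.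
- move=> x; have [fg|gf] := lerP (f x) (g x).
    by rewrite fK; apply/max_idPl; rewrite -[leRHS]gK hg'.
  by rewrite gK; apply/max_idPr; rewrite -[leRHS]fK hf'// ltW.
- move=> x; have [fg|gf] := lerP (f' x) (g' x).
    by rewrite g'K; apply/min_idPr; rewrite -[leLHS]f'K hf.
  by rewrite f'K; apply/min_idPl; rewrite -[leLHS]g'K hg// ltW.
Qed.

Lemma incr_inverse_max f f' g g' : incr_inverse f f' -> incr_inverse g g' ->
  incr_inverse (fun x => Num.max (f x) (g x)) (fun x => Num.min (f' x) (g' x)).
Proof.
by move=> /incr_inverse_sym h1 /incr_inverse_sym h2; apply/incr_inverse_sym/incr_inverse_min.
Qed.

Lemma incr_inverse_affine (a b : R) : 0 < a ->
  incr_inverse (fun x => a * x + b) (fun x => (x - b) / a).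
Proof.
move=> a0; have an : a != 0 by rewrite gt_eqF.
split => [x y xy|x y xy|x|x].
- by rewrite lerD2r ler_pM2l.
- by rewrite ler_pM2r ?invr_gt0// lerD2r.
- by field.
- by field.
Qed.

(* The witness [k] is piecewise affine and maps [[h, 1 - h]] linearly onto
   [[p, p + q]] for a small [h]. *)
Lemma slide (p q e : R) : 0 < p -> 0 < q -> p + q < 1 -> 0 < e -> exists k k' : R -> R,
  [/\ cts k /\ cts k', cancel k k' /\ cancel k' k,
    forall u, 0 <= u <= 1 -> 0 <= k u <= 1, forall x, 0 <= x <= 1 -> 0 <= k' x <= 1 &
    forall u, 0 <= u <= 1 -> exists2 v, 0 <= v <= 1 & `|u - v| <= e /\
      Num.max p (Num.min (p + q) (k u)) = p + q * v].
Proof.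
move=> p0 q0 pq e0.
have [z zE z0] : exists2 z, z = 1 - p - q & 0 < z by exists (1 - p - q) => //; lra.
(* The three pieces have slopes a = p / h, b = q / (1 - 2 h) and c = z / h. From h <= 1/4 one gets b
   <= 2 q, and the last two bounds then make [b] the smallest slope: this is what lets a minimum
   followed by a maximum select the right piece. *)
have [h [h0 he h4 hz [hp hzq]]] : exists h : R,
    [/\ 0 < h, h <= e, h <= 4^-1, h <= z & 2 * q * h <= p /\ 2 * q * h <= z].
  exists (Num.min (Num.min e 4^-1) (Num.min (p / (2 * q)) (Num.min (z / (2 * q)) z))).
  rewrite ![2 * q * _]mulrC -!ler_pdivlMr ?mulr_gt0// !ge_min !lexx ?orbT; split => //.
  by rewrite !lt_min e0 z0 !divr_gt0 ?mulr_gt0//=; lra.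
have d0 : 0 < 1 - 2 * h by lra.
have [b [b0 bE b2 bq]] : exists b, [/\ 0 < b, b * (1 - 2 * h) = q, b <= 2 * q & q <= b].
  exists (q / (1 - 2 * h)); rewrite divr_gt0 ?divfK ?gt_eqF// ler_pdivrMr// ler_pdivlMr//.
  by split => //; nra.
have [a a0 aE] : exists2 a, 0 < a & a * h = p.
  by exists (p / h); rewrite ?divr_gt0 ?divfK ?gt_eqF.
have [c c0 cE] : exists2 c, 0 < c & c * h = z.
  by exists (z / h); rewrite ?divr_gt0 ?divfK ?gt_eqF.
have bh : b * h <= 2 * q * h by rewrite ler_pM2r.
have ba : b <= a by rewrite -(ler_pM2r h0); lra.
have bc : b <= c by rewrite -(ler_pM2r h0); lra.
have iA := incr_inverse_affine 0 a0.
have iB := incr_inverse_affine (p - b * h) b0.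
have iC := incr_inverse_affine (1 - c) c0.
have [hk hk' kK k'K] := incr_inverse_max (incr_inverse_min iA iB) iC.
exists (fun x => Num.max (Num.min (a * x + 0) (b * x + (p - b * h))) (c * x + (1 - c))),
  (fun x => Num.min (Num.max ((x - 0) / a) ((x - (p - b * h)) / b)) ((x - (1 - c)) / c)).
split => //.
- by split; cts.
- move=> u /andP[u0 u1]; rewrite le_max le_min ge_max ge_min.
  have B0 : 0 <= b * u + (p - b * h) by rewrite addr_ge0 ?mulr_ge0 ?(ltW b0)//; lra.
  have A0 : 0 <= a * u + 0 by rewrite addr0 mulr_ge0// ltW.
  have bu : b * u <= b by rewrite ler_piMr// ltW.
  have cu : c * u <= c by rewrite ler_piMr// ltW.
  have B1 : b * u + (p - b * h) <= 1.
    have bb : b * (1 - 2 * h) = b - 2 * (b * h) by ring.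
    by rewrite bb in bE; lra.
  by rewrite A0 B0 B1 orbT /=; lra.
- move=> x /andP[x0 x1]; rewrite le_min le_max ge_min ge_max.
  have cz : 1 <= c by rewrite -(ler_pM2r h0); lra.
  have X1 : 0 <= (x - 0) / a by rewrite subr0 divr_ge0// ltW.
  have X2 : 0 <= (x - (1 - c)) / c by rewrite divr_ge0 ?(ltW c0)//; lra.
  have X3 : (x - (1 - c)) / c <= 1 by rewrite ler_pdivrMr// mul1r; lra.
  by rewrite X1 X2 X3 orbT.
move=> u /andP[u0 u1]; clear iA iB iC hk hk' kK k'K.
set k := Num.max (Num.min _ _) _; set r := Num.max p _.
have r1 : p <= r <= p + q by rewrite /r le_max lexx ge_max ge_min lexx /=; lra.
have qn : q != 0 by rewrite gt_eqF.
exists ((r - p) / q).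
  clear -q0 r1; by rewrite divr_ge0 ?(ltW q0)//= ?ler_pdivrMr//; lra.
split; last by field.
suff /andP[r2 r3] : p + q * (u - h) <= r <= p + q * (u + h).
  apply: le_trans he; rewrite -(ler_pM2l q0) -{1}(gtr0_norm q0) -normrM.
  rewrite (_ : q * (u - (r - p) / q) = q * u - (r - p)); last by field.
  by rewrite ler_norml; move: r2 r3; rewrite !mulrDr mulrN; lra.
have bu : b * (1 - 2 * h) * (u - h) = b * (u - h) - 2 * (b * h) * (u - h) by ring.
apply/andP; split.
  have [uh|hu] := lerP u h.
    have : q * (u - h) <= 0 by rewrite mulr_ge0_le0 ?(ltW q0)//; lra.
    by lra.
  rewrite /r le_max; apply/orP; right; rewrite le_min; apply/andP; split.
    by rewrite lerD2l ler_piMr ?(ltW q0)//; lra.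
  rewrite /k le_max; apply/orP; left; rewrite le_min.
  have uh0 : 0 <= u - h by lra.
  have k1 := ler_wpM2r uh0 bq; have k2 := ler_wpM2r uh0 ba.
  rewrite (_ : a * u + 0 = p + a * (u - h)); last by rewrite mulrBr aE; ring.
  rewrite (_ : b * u + _ = p + b * (u - h)); last by ring.
  by apply/andP; split; lra.
have [uh|hu] := lerP (1 - h) u.
  have : q * 1 <= q * (u + h) by rewrite ler_pM2l//; lra.
  by rewrite mulr1; lra.
have quh : 0 <= q * (u + h) by rewrite mulr_ge0 ?(ltW q0)//; lra.
rewrite /r ge_max ge_min; apply/andP; split; first by lra.
apply/orP; right.
have kB : b * (u - h) <= q * (u + h).
  rewrite -bE (_ : b * (1 - 2 * h) * (u + h) = b * (u - h) + 2 * (b * h) * (1 - u - h)); last by ring.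
  by rewrite lerDl !mulr_ge0 ?(ltW b0) ?(ltW h0)//; lra.
have Bp : b * u + (p - b * h) = p + b * (u - h) by ring.
rewrite /k ge_max ge_min Bp; apply/andP; split; first by apply/orP; right; lra.
have uh0 : 0 <= 1 - h - u by lra.
have k2 := ler_wpM2r uh0 bc.
have C1 : c * u + (1 - c) = 1 - z - c * (1 - h - u) by rewrite -cE; ring.
have B1 : p + b * (u - h) = p + q - b * (1 - h - u) by rewrite -bE; ring.
by rewrite C1; move: B1 k2 kB; lra.
Qed.

End slides.

(** * Running through several homotopies *)

Section concatenation.
Context {R : realType} {X : metricType R}.

Lemma closed_rect (S T : topologicalType) (A : set S) (B : set T) :
  closed A -> closed B -> closed (A `*` B).
Proof.
move=> cA cB; rewrite (_ : A `*` B = fst @^-1` A `&` snd @^-1` B)//.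
apply: closedI; apply: preimage_closed => //; move=> x _; [exact: cvg_fst|exact: cvg_snd].
Qed.

Lemma concat_homotopies (L : complex1) (al : 'rV[R]_(vert L) -> X) (W : set X) (e : R)
    (I : eqType) (C : I -> set X) (s : seq I) : 0 < e ->
  {within polyhedron R L, continuous al} -> (forall z, polyhedron R L z -> W (al z)) ->
  (forall i, i \in s -> exists H : 'rV[R]_(vert L) * R -> X,
    [/\ {within cyl R L, continuous H},
      forall p, cyl R L p -> W (H p) /\ mdist (al p.1) (H p) < e,
      forall z, polyhedron R L z -> H (z, 0) = al z &
      forall z, polyhedron R L z -> ~ C i (H (z, 1))]) ->
  exists F : 'rV[R]_(vert L) * R -> X,
    [/\ {within cyl R L, continuous F},
      forall p, cyl R L p -> W (F p) /\ mdist (al p.1) (F p) < e,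
      forall z, polyhedron R L z -> F (z, 0) = al z &
      forall i, i \in s -> exists2 t, 0 <= t <= 1 & forall z, polyhedron R L z -> ~ C i (F (z, t))].
Proof.
move=> e0 cal Wal; elim: s => [|i s IH] Hs.
  exists (fun p => al p.1); split => //; last by move=> p [pz _]; rewrite mdistxx; split => //; exact: Wal.
  apply: (within_comp (f := fst)) cal _; first by apply: continuous_subspaceT => p; exact: cvg_fst.
  by move=> _ [[z t] [zL _] <-].
have [|F0 [cF0 F0W F00 F0C]] := IH; first by move=> j js; apply: Hs; rewrite inE js orbT.
have [|H [cH HW H0 H1]] := Hs i; first by rewrite inE eqxx.
pose A (b : bool) := polyhedron R L `*` (if b then [set` `[0, 2^-1]] else [set` `[2^-1, 1]] : set R).
(* The tent function 1 - |4 t - 1| runs [H] out and back, reaching its end at time 1/4; at time 1/2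
   both pieces are at [al]. *)
pose g (b : bool) (p : 'rV[R]_(vert L) * R) :=
  if b then H (p.1, clamp (1 - `|4 * p.2 - 1|)) else F0 (p.1, clamp (2 * p.2 - 1)).
have [|||F cF FE] := @paste _ _ _ A g F0.
- by move=> b; apply: closed_rect; [exact: closed_poly|case: b; exact: itv_closed].
- have Acyl (k : R -> R) b : cts k ->
      {within A b, continuous (fun p : 'rV[R]_(vert L) * R => (p.1, clamp (k p.2)))} /\
      (fun p => (p.1, clamp (k p.2))) @` A b `<=` cyl R L.
    move=> ck; split; first by apply: continuous_subspaceT; rewrite -/(cts _); cts.
    by move=> _ [[z t] [zL _] <-]; split => //; exact: clamp_II.
  case; rewrite /g.
    have ck : cts (fun t : R => 1 - `|4 * t - 1|) by cts.
    have [c1 c2] := Acyl _ true ck.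
    exact: (within_comp c1 cH c2).
  have ck : cts (fun t : R => 2 * t - 1) by cts.
  have [c1 c2] := Acyl _ false ck.
  exact: (within_comp c1 cF0 c2).
- have key (p : 'rV[R]_(vert L) * R) : A true p -> A false p -> g true p = g false p.
    move=> [pL /= t1] [_ /= t2]; have -> : p = (p.1, 2^-1).
      rewrite [LHS]surjective_pairing; congr pair; apply/eqP; rewrite eq_le.
      by move: t1 t2; rewrite !in_itv/= => /andP[_ ->] /andP[-> _].
    rewrite /g/= !clamp_le0 ?H0 ?F00//; first by lra.
    have -> : 4 * 2^-1 - 1 = 1 :> R by lra.
    by rewrite normr1 subrr.
  by case=> [] [] p //= a1 a2; [exact: key|apply/esym/key].
have Acov z t : polyhedron R L z -> 0 <= t <= 1 ->
    (A true (z, t) /\ t <= 2^-1) \/ (A false (z, t) /\ 2^-1 <= t).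
  move=> zL /andP[t0 t1]; have [th|/ltW th] := lerP t 2^-1; [left|right].
    by split => //; split => //=; rewrite in_itv/= t0.
  by split => //; split => //=; rewrite in_itv/= t1 andbT.
exists F; split.
- apply: continuous_subspaceW cF => -[z t] [/= zL /IIP /(Acov z _ zL)].
  by case=> [[? _]|[? _]]; [exists true|exists false].
- move=> [z t] [/= zL /IIP /(Acov z _ zL)].
  by case=> -[At _]; rewrite (FE _ _ At) /g/=; [apply: (HW (_, _))|apply: (F0W (_, _))];
    split => //=; exact: clamp_II.
- move=> z zL; have [|[At _]|[_]] := Acov z 0 zL; [by rewrite lexx ler01| |by move=> ?; exfalso; lra].
  rewrite (FE _ _ At) /g/= mulr0 sub0r normrN normr1 subrr clamp_le0//.
  exact: H0.
move=> j; rewrite inE => /predU1P[->|/F0C[t ti tC]].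
  exists 4^-1; first by lra.
  move=> z zL; have [|[At _]|[_]] := Acov z 4^-1 zL; [by lra| |by move=> ?; exfalso; lra].
  by rewrite (FE _ _ At) /g/= divff// subrr normr0 subr0 clamp_ge1//; exact: H1.
exists ((1 + t) / 2); first by lra.
move=> z zL; have At : A false (z, (1 + t) / 2).
  by split => //=; rewrite in_itv/=; lra.
by rewrite (FE _ _ At) /g/= mulrC divfK// addrC addKr clamp_id//; exact: tC.
Qed.

(* [fractured_over] with the unit square as domain of the first map and the
   projection as second topographical map. *)
Definition fracture (G : R * R -> X) (L : complex1) (F : 'rV[R]_(vert L) * R -> X) :=
  exists (J : finType) (B : J -> 'rV[R]_2 -> R * R),
  [/\ forall j, cell_param (B j) /\ cell_carrier (B j) `<=` sq R,
      trivIset [set: J] (fun j => cell_carrier (B j)),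
      forall p, sq R p -> (F @` cyl R L) (G p) -> exists j, cell_int (B j) p &
      forall j, exists2 t, 0 <= t <= 1 & forall x, polyhedron R L x ->
        ~ (G @` cell_carrier (B j)) (F (x, t))].

End concatenation.

(** * Fracturing squares in one path component *)

Section families_of_squares.
Context {R : realType} {X : metricType R}.

Lemma eps_homotopy_mdist (S : topologicalType) (Z : set S) (W : set X) (e : R)
    (H : S * R -> X) (a b : S -> X) : eps_homotopy Z W e H a b ->
  forall z t, Z z -> 0 <= t <= 1 -> mdist (a z) (H (z, t)) < e.
Proof.
move=> [_ H01 Hd] z t Zz ti; have [<- _] := H01 z Zz; rewrite -lte_fin.
apply: le_lt_trans (Hd z Zz); apply: ereal_sup_ubound.
exists (H (z, 0), H (z, t)) => //; split.
  by exists (z, 0) => //; split => //; rewrite IIP lexx ler01.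
by exists (z, t) => //; split => //; rewrite IIP.
Qed.

Lemma sphere_cell_skeleton1 (T : cell_complex R) (c : cell T) : (cdim c <= 2)%N ->
  cell_bd (cparam T c) `<=` skeleton1 T.
Proof.
move=> c2; have [D Dd ->] := cell_bdP c => v [d Dd' vd]; exists d => //=.
by rewrite -ltnS; apply: leq_trans (Dd _ Dd') c2.
Qed.

Lemma cell2_param_bd (S : topologicalType) k (h : 'rV[R]_k -> S) : k = 2%N -> cell_param h ->
  exists b : 'rV[R]_2 -> S,
    [/\ cell_param b, cell_carrier b = cell_carrier h, cell_int b = cell_int h &
      cell_bd b = cell_bd h].
Proof. by move=> k2; move: h; rewrite k2 => h; exists h. Qed.

(** [cell_cover] puts the interiors of the cells in the disk; their boundaries follow by induction
    on the dimension. *)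
Lemma cell_disk (T : cell_complex R) (c : cell T) : cell_carrier (cparam T c) `<=` disk R 2.
Proof.
move: {2}(cdim c) (leqnn (cdim c)) => n; elim: n c => [|n IH] c cn _ [w wd <-].
  case: (disk_split wd) => [wo|ws].
    by rewrite (cell_cover T); exists c => //; exists w.
  have [D Dd E] := cell_bdP c.
  have : cell_bd (cparam T c) (cparam T c w) by exists w.
  by rewrite E => -[d /Dd dc]; have := leq_trans dc cn.
case: (disk_split wd) => [wo|ws].
  by rewrite (cell_cover T); exists c => //; exists w.
have [D Dd E] := cell_bdP c.
have : cell_bd (cparam T c) (cparam T c w) by exists w.
rewrite E => -[d /Dd dc]; apply: IH.
by rewrite -ltnS; apply: leq_trans cn.
Qed.

(* The strips carrying the maps [G i] are disjoint in a single disk, but the cells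
   of its decomposition may meet several of them.  Retracting the disk onto the
   [i]-th strip makes it a valid domain for the [i]-th map: the part of the disk
   off the strip goes to the sides of the strip, which miss [al]. *)
Lemma fractured_connected (I : finType) (G : I -> R * R -> X) (x0 : X) (L : complex1)
    (al : 'rV[R]_(vert L) -> X) (e : R) : P_DADP_star X ->
  (forall i, cts (G i)) -> (forall i, joined x0 (G i (0, 0))) ->
  {within polyhedron R L, continuous al} ->
  (forall i t x, 0 <= t <= 1 -> polyhedron R L x -> G i (0, t) <> al x /\ G i (1, t) <> al x) ->
  0 < e ->
  exists (G' : I -> R * R -> X) (F : 'rV[R]_(vert L) * R -> X),
    [/\ forall i, cts (G' i), forall i p, sq R p -> mdist (G i p) (G' i p) < e,
      {within cyl R L, continuous F}, forall p, cyl R L p -> mdist (al p.1) (F p) < e &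
      forall i, fracture (G' i) F].
Proof.
move=> P cG jG cal miss e0.
have [f [cf _ fP]] := @embed_squares _ _ I G x0 (enum I) cG jG.
have {fP} : forall i, exists pq : R * R, [/\ 0 < pq.1, 0 < pq.2, pq.1 + pq.2 < 1 &
    forall u t, 0 <= u <= 1 -> f (pq.1 + pq.2 * u, t) = G i (u, t)].
  by move=> i; have [|p [q H]] := fP i; [rewrite mem_enum|exists (p, q)].
move=> /choice[pq pqP].
have [c c0 cP] : exists2 c, 0 < c & forall i t x, 0 <= t <= 1 -> polyhedron R L x ->
    c <= mdist (G i (0, t)) (al x) /\ c <= mdist (G i (1, t)) (al x).
  apply: (fin_min (P := fun i c => forall t x, 0 <= t <= 1 -> polyhedron R L x ->
    c <= mdist (G i (0, t)) (al x) /\ c <= mdist (G i (1, t)) (al x))).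
    move=> i r r' _ rr' H t x ti xL; have [h1 h2] := H t x ti xL.
    by split; apply: le_trans rr' _.
  move=> i; have cGi := cG i.
  have g (s : R) : exists2 c, 0 < c & (s = 0 \/ s = 1 -> forall t x, II R t -> polyhedron R L x ->
      c <= mdist (G i (s, t)) (al x)).
    have [s01|?] := pselect (s = 0 \/ s = 1); last by exists 1.
    have [||d d0 dP] := @gap _ _ _ _ (II R) (polyhedron R L) (fun t => G i (s, t)) al
      compact_II (@compact_poly _ L) _ cal.
    - by apply: continuous_subspaceT; rewrite -/(cts _); cts.
    - by move=> t x /IIP ti xL; case: s01 => ->; have [] := miss i t x ti xL.
    - by exists d.
  have [c0 c00 H0] := g 0; have [c1 c10 H1] := g 1.
  exists (Num.min c0 c1); first by rewrite lt_min c00.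
  move=> t x /IIP ti xL; split; rewrite ge_min ?(H0 _ _ _ ti xL) ?(H1 _ _ _ ti xL) ?orbT//.
    by left.
  by right.
have e10 : 0 < Num.min (e / 3) (c / 3) by rewrite lt_min; apply/andP; split; lra.
(* On the sides of a strip [G i] is at distance at least [c] from [al]. There [f2] is within [e1] of
   [G i], and [F] within 2 e1 of [al], so 3 e1 <= c excludes a meeting. *)
have [e1 e1p [e1e e1c]] : exists2 e1, 0 < e1 & 3 * e1 <= e /\ 3 * e1 <= c.
  exists (Num.min (e / 3) (c / 3)) => //.
  by split; rewrite mulrC -ler_pdivlMr// ge_min lexx ?orbT.
have cd : cts (@dsq R) := @dsq_cts R.
have cfd : cts (fun v => f (dsq v)) by cts.
have [T [f' [al' [[[cf' _] ff'] [[cal' al'W] aal'] HT]]]] := P (fun v => f (dsq v)) L al e1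
  (map_onT (continuous_subspaceT cfd)) (map_onT cal) e1p.
pose f2 p := f' (sqd (csq p)).
have sqdd p : disk R 2 (sqd (csq p)) by apply/sqd_disk; exact: csq_sq.
have cf2 : cts f2.
  apply: within_setT; apply: (within_comp (f := fun p => sqd (csq p))) cf' _.
    by apply: continuous_subspaceT; have := @sqd_cts R; rewrite -!/(cts _) => ?; cts.
  by move=> _ [p _ <-].
have f2f p : sq R p -> mdist (f p) (f2 p) < e1.
  by move=> ps; have := ff' _ (sqdd p); rewrite /f2 /= sqdK csq_id.
have f2d v : disk R 2 v -> f2 (dsq v) = f' v.
  by move=> vd; rewrite /f2 csq_id ?dsqK//; apply/dsq_sq.
have [||F [cF FW _ FC]] := @concat_homotopies _ _ L al' (~` (f' @` skeleton1 T)) e1 (cell T)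
  (fun c => f' @` cell_carrier (cparam T c)) (enum [pred c | cdim c == 2%N]) e1p cal'.
- by move=> z zL; apply: al'W; exists z.
- move=> a; rewrite mem_enum inE => /eqP /HT [H [al2 [[_ al2W] hH]]].
  exists H; have [[cH HW] H01 _] := hH; split => //.
  + move=> [z t] [zL /IIP ti]; split; last exact: eps_homotopy_mdist hH _ _ zL ti.
    by apply: HW; exists (z, t) => //; split => //; exact/IIP.
  + by move=> z /H01[].
  + move=> z zL; have [_ ->] := H01 z zL.
    by apply: al2W; exists z.
have Fal p : cyl R L p -> mdist (al p.1) (F p) < 2 * e1.
  move=> pL; have [_ h1] := FW p pL; have [pL1 _] := pL.
  by apply: le_lt_trans (metric_triangle _ (al' p.1) _) _; have := aal' _ pL1; lra.
pose CF := F @` cyl R L.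
have closedCF : closed CF.
  apply: compact_closed; first exact: metric_hausdorff.
  by apply: continuous_compact cF _; exact: compact_cyl.
suff /choice[G' G'P] : forall i, exists G' : R * R -> X,
    [/\ cts G', forall p, sq R p -> mdist (G i p) (G' p) < e & fracture G' F].
  exists G', F; split => //.
  - by move=> i; have [] := G'P i.
  - by move=> i; have [] := G'P i.
  - by move=> p /Fal; lra.
  - by move=> i; have [] := G'P i.
move=> i; case: (pq i) (pqP i) => p q [/= p0 q0 pq1 fG].
pose rho (x : R) := Num.max p (Num.min (p + q) x).
pose phi (z : R * R) := f2 (rho z.1, z.2).
have cphi : cts phi by rewrite /phi /rho; cts.
have rho_in x : p <= x <= p + q -> rho x = x.
  by move=> /andP[x1 x2]; rewrite /rho (min_idPr x2) (max_idPr x1).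
have off z : 0 <= z.2 <= 1 -> CF (phi z) -> p < z.1 < p + q.
  move=> zi [w wL Fw]; apply: contrapT => /negP; rewrite negb_and -!leNgt => zoff.
  have [s [s01 rs]] : exists s, (s = 0 \/ s = 1) /\ rho z.1 = p + q * s.
    case/orP: zoff => h.
      exists 0; split; first by left.
      by rewrite mulr0 addr0 /rho; apply/max_idPl; rewrite ge_min h orbT.
    exists 1; split; first by right.
    by rewrite mulr1 /rho (min_idPl h); apply/max_idPr; lra.
  have si : 0 <= s <= 1 by case: s01 => ->; rewrite ?lexx ?ler01.
  have h1 : mdist (G i (s, z.2)) (phi z) < e1.
    rewrite -fG// -rs; apply: f2f; apply/sqP; split => //=.
    by rewrite rs; apply: segment_itv => //; exact: ltW.
  have h2 := Fal w wL.
  have h3 : c <= mdist (G i (s, z.2)) (al w.1).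
    by case: wL => wL _; have [] := cP i z.2 w.1 zi wL; case: s01 => ->.
  have := metric_triangle (G i (s, z.2)) (phi z) (al w.1).
  by rewrite -Fw (metric_sym (F w)) in h1 *; move: h1 h2 h3 e1c; rewrite Fw; lra.
have on z : 0 <= z.2 <= 1 -> CF (phi z) -> phi z = f2 z.
  move=> zi Cz; have /andP[h1 h2] := off z zi Cz.
  by rewrite /phi rho_in ?(ltW h1) ?(ltW h2)//; case: (z).
have skel v : disk R 2 v -> skeleton1 T v -> ~ CF (phi (dsq v)).
  move=> vd vT Cv; have /sqP[_ vi] : sq R (dsq v) by apply/dsq_sq.
  move: (Cv); rewrite (on _ vi Cv) f2d// => -[w /FW[+ _] Fw].
  by apply; rewrite Fw; exists v.
pose J := {c : cell T | cdim c == 2%N}.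
have : forall j : J, exists b : 'rV[R]_2 -> 'rV[R]_2, [/\ cell_param b,
    cell_carrier b = cell_carrier (cparam T (val j)), cell_int b = cell_int (cparam T (val j)) &
    cell_bd b = cell_bd (cparam T (val j))].
  by move=> j; apply: cell2_param_bd; [exact/eqP/(valP j)|exact: cparamP].
move=> /choice[b bP].
have bdisk j u : disk R 2 u -> disk R 2 (b j u).
  by move=> ud; have [_ E _ _] := bP j; apply: (@cell_disk T (val j)); rewrite -E; exists u.
(* The boundary of a 2-cell lies in the 1-skeleton, whose image misses the closed set [CF]; by
   compactness the points sent to [CF] stay away from the boundary. *)
have : forall j, exists r, [/\ 0 < r, r <= 1 &
    forall u, disk R 2 u -> CF (phi (dsq (b j u))) -> nrm u <= 1 - r].
  move=> j; have [[cb _] _ _ bbd] := bP j.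
  have [||r r0 rP] := @compact_unif _ _ (disk R 2)
    (fun r u => CF (phi (dsq (b j u))) -> nrm u <= 1 - r) (@compact_disk _ _).
  - by move=> r r' u r'0 rr' H /H; lra.
  - move=> u ud; case: (disk_split ud) => [/open_diskP uo|us].
      exists ((1 - nrm u) / 2); first by lra.
      have /cvgr_lt := @nrm_cts R 2 u; have : nrm u < (1 + nrm u) / 2 by lra.
      by move=> /[swap] /[apply]; apply: filterS => v; lra.
    exists 1 => //.
    have nC : (~` CF) (phi (dsq (b j u))).
      apply: skel; first exact: bdisk.
      by apply: (@sphere_cell_skeleton1 T (val j)); [exact: cdim_le2|rewrite -bbd; exists u].
    have cpb : {within disk R 2, continuous (fun u => phi (dsq (b j u)))}.
      by apply: (within_compT (g := fun v => phi (dsq v)) cb); have := @dsq_cts R; rewrite -!/(cts _) => ?; cts.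
    have h : nbhs (phi (dsq (b j u))) (~` CF).
      by apply: open_nbhs_nbhs; split => //; exact: closed_openC.
    move/subspace_continuousP : cpb => /(_ u ud) cpb.
    have : \forall v \near within (disk R 2) (nbhs u), (~` CF) (phi (dsq (b j v))) := cpb _ h.
    by rewrite near_withinE; apply: filterS => v hv vd Cv; case: (hv vd).
  exists (Num.min r 1); split.
  - by rewrite lt_min r0 ltr01.
  - by rewrite ge_min lexx orbT.
  - move=> u ud Cu; apply: le_trans (rP u ud Cu) _.
    by rewrite lerD2l lerN2 ge_min lexx.
move=> /choice[rr rrP].
(* Strictly between [1 - rr j] and 1: the shrunk closed cells lie in the open ones, hence are
   disjoint, and still contain all meeting points in their interiors. *)
pose s j := 1 - rr j / 2.
have sj j : 0 < s j < 1 by have [r0 r1 _] := rrP j; rewrite /s; lra.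
have sdisk j u : disk R 2 u -> open_disk R 2 (s j *: u).
  move=> /diskP un; apply/open_diskP; have /andP[s0 s1] := sj j.
  by rewrite nrmZ gtr0_norm//; apply: le_lt_trans s1; rewrite ler_piMr// ltW.
have cGi : {within sq R, continuous (G i)} by apply: continuous_subspaceT; exact: cG.
have e30 : 0 < e / 3 by rewrite divr_gt0.
have [d d0 dP] := unif_cont compact_sq cGi e30.
have d20 : 0 < d / 2 by rewrite divr_gt0.
(* The 2-cells fill the whole disk, so the square has to be matched with the whole disk and not with
   the strip only; [k] does this while moving strip parameters by at most [d / 2]. *)
have [k [k' [[ck ck'] [kK k'K] k01 k'01 kv]]] := slide p0 q0 pq1 d20.
exists (fun z => phi (k z.1, z.2)); split.
- by cts.
- move=> z /[dup] zs /sqP[z1 z2].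
  have [v vi [uv rv]] := kv _ z1.
  have h1 : mdist (G i z) (G i (v, z.2)) < e / 3.
    apply: dP; [by []|by apply/sqP|].
    split; last exact: ballxx.
    by rewrite /ball/=; apply: le_lt_trans uv _; clear -d0; lra.
  have h2 : mdist (f (p + q * v, z.2)) (phi (k z.1, z.2)) < e1.
    rewrite /phi /rho /= rv; apply: f2f; apply/sqP; split => //=.
    by apply: segment_itv => //; exact: ltW.
  rewrite fG// in h2.
  by apply: le_lt_trans (metric_triangle _ (G i (v, z.2)) _) _; lra.
exists J, (fun j u => (k' (dsq (b j (s j *: u))).1, (dsq (b j (s j *: u))).2)).
have bint j u : disk R 2 u -> cell_int (cparam T (val j)) (b j (s j *: u)).
  by move=> ud; have [_ _ <- _] := bP j; exists (s j *: u) => //; exact: sdisk.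
have bsq j u : disk R 2 u -> sq R (dsq (b j (s j *: u))).
  by move=> ud; apply/dsq_sq; apply: bdisk; apply: open_disk_sub; exact: sdisk.
split.
- move=> j; have [[cb bi] _ _ _] := bP j; split; first split.
  + have cbs : {within disk R 2, continuous (fun u => b j (s j *: u))}.
      have c1 : {within disk R 2, continuous (fun u : 'rV[R]_2 => s j *: u)}.
        by apply: continuous_subspaceT; rewrite -/(cts _); cts.
      have c2 : (fun u : 'rV[R]_2 => s j *: u) @` disk R 2 `<=` disk R 2.
        by move=> _ [u ud <-]; apply: open_disk_sub; exact: sdisk.
      exact: (within_comp c1 cb c2).
    apply: (within_compT (g := fun v => (k' (dsq v).1, (dsq v).2)) cbs).
    by rewrite -/(cts _); cts.
  + move=> u u' ud u'd [/(can_inj k'K) h1 h2].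
    have /(can_inj dsqK) /bi : dsq (b j (s j *: u)) = dsq (b j (s j *: u')).
      exact: (congr2 pair h1 h2).
    move=> h; have /h : disk R 2 (s j *: u) by apply: open_disk_sub; exact: sdisk.
    move=> {}h; have /h : disk R 2 (s j *: u') by apply: open_disk_sub; exact: sdisk.
    have s0 : s j != 0 by have /andP[s0 _] := sj j; rewrite gt_eqF.
    by move=> /(scalerI s0).
  + move=> _ [u ud <-]; have /sqP[b1 b2] := bsq j u ud.
    by apply/sqP; split => //=; exact: k'01.
- move=> j j' _ _ [z [[u ud <-] [u' u'd [/(can_inj k'K) h1 h2]]]].
  have /(can_inj dsqK) h : dsq (b j' (s j' *: u')) = dsq (b j (s j *: u)).
    exact: (congr2 pair h1 h2).
  apply: val_inj; have ct := @cell_triv R T; apply: ct => //.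
  by exists (b j (s j *: u)); split; [exact: bint|rewrite -h; exact: bint].
- move=> z /sqP[z1 z2] Cz; pose z' : R * R := (k z.1, z.2).
  have z's : sq R z' by apply/sqP; split => //; exact: k01.
  have zE := on z' z2 Cz.
  have vd : disk R 2 (sqd z') by apply/sqd_disk.
  have nsk : ~ skeleton1 T (sqd z') by move=> /(skel _ vd); rewrite sqdK.
  have := vd; rewrite (cell_cover T) => -[cc _ vc].
  have c2 : cdim cc == 2%N.
    rewrite eqn_leq cdim_le2 ltnNge; apply/negP => c1; apply: nsk; exists cc => //.
    by case: vc => w wo <-; exists w => //; exact: open_disk_sub.
  pose j : J := exist _ cc c2.
  have [_ _ bI _] := bP j; have := vc; rewrite -[cc]/(val j) -bI => -[u uo bu].
  have [r0 r1 rP] := rrP j; have /andP[s0 s1] := sj j.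
  have un : nrm u <= 1 - rr j.
    by apply: rP; [exact: open_disk_sub|rewrite bu sqdK].
  exists j; exists ((s j)^-1 *: u).
    apply/open_diskP; rewrite nrmZ gtr0_norm ?invr_gt0// ltr_pdivrMl// mulr1 /s.
    by lra.
  rewrite scalerA divff ?gt_eqF// scale1r bu sqdK /z' /= kK.
  by case: (z).
- move=> j; have [|t ti tC] := FC (val j); first by rewrite mem_enum inE (valP j).
  exists t => // x xL [z [u ud <-]] /=; rewrite k'K => E.
  have xt : cyl R L (x, t) by split => //; exact/IIP.
  have bd := bint j u ud; have /sqP[_ b2] := bsq j u ud.
  apply: (tC x xL); rewrite -E.
  have -> : ((dsq (b j (s j *: u))).1, (dsq (b j (s j *: u))).2) = dsq (b j (s j *: u)).
    by rewrite -surjective_pairing.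
  rewrite on//; last first.
    by exists (x, t) => //; rewrite -E -surjective_pairing.
  have bds : disk R 2 (s j *: u) by apply: open_disk_sub; exact: sdisk.
  rewrite f2d; last exact: bdisk.
  exists (b j (s j *: u)) => //.
  by have [_ <- _ _] := bP j; exists (s j *: u).
Qed.

End families_of_squares.

(** * Separating the path components *)

Section path_components.
Context {R : realType} {X : metricType R}.
Context (lcX : locally_contractible X).

Lemma close_joined (S : topologicalType) (A : set S) (w : S -> X) : compact A ->
  {within A, continuous w} ->
  exists2 d, 0 < d & forall s y, A s -> mdist (w s) y < d -> joined (w s) y.
Proof.
move=> cA cw; have [d d0 H] := uniform_contractions lcX cA cw ltr01.
exists d => // s y As sy; have [_ j] := H s As.
have [|g [cg g0 g1 _]] := j (w s) y _ sy; first by rewrite /mball/= mdistxx.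
by exists g.
Qed.

(* Maps into different path components are treated separately; [al] splits into
   the clopen parts lying in the various components. *)
Lemma fractured_family (I : finType) (G : I -> R * R -> X) (L : complex1)
    (al : 'rV[R]_(vert L) -> X) (e : R) : P_DADP_star X ->
  (forall i, cts (G i)) -> {within polyhedron R L, continuous al} ->
  (forall i t x, 0 <= t <= 1 -> polyhedron R L x -> G i (0, t) <> al x /\ G i (1, t) <> al x) ->
  0 < e ->
  exists (G' : I -> R * R -> X) (F : 'rV[R]_(vert L) * R -> X),
    [/\ forall i, cts (G' i), forall i p, sq R p -> mdist (G i p) (G' i p) < e,
      {within cyl R L, continuous F}, forall p, cyl R L p -> mdist (al p.1) (F p) < e &
      forall i, fracture (G' i) F].
Proof.
move=> P cG cal miss e0.
have [d1 d10 j1] := close_joined (@compact_poly _ L) cal.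
have [d2 d20 j2] : exists2 d, 0 < d & forall i s y, sq R s -> mdist (G i s) y < d -> joined (G i s) y.
  apply: (fin_min (P := fun i d => forall s y, sq R s -> mdist (G i s) y < d -> joined (G i s) y)).
    by move=> i r r' _ rr' H s y ss sy; apply: H => //; exact: lt_le_trans rr'.
  move=> i; apply: close_joined compact_sq _.
  by apply: continuous_subspaceT; exact: cG.
have [e1 e1p [e1e e1d1 e1d2]] : exists2 e1, 0 < e1 & [/\ e1 <= e, e1 <= d1 & e1 <= d2].
  exists (Num.min e (Num.min d1 d2)); first by rewrite !lt_min e0 d10.
  by rewrite !ge_min !lexx ?orbT.
pose o := (0, 0) : R * R.
pose same r i := `[< joined (G i o) (G r o) >].
(* For each [r], squares outside of the component of [G r] are replaced by [G r] itself, which keeps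
   the index type and makes the family connected. *)
have : forall r, exists GF : (I -> R * R -> X) * ('rV[R]_(vert L) * R -> X),
    [/\ forall i, cts (GF.1 i),
      forall i p, sq R p -> mdist ((if same r i then G i else G r) p) (GF.1 i p) < e1,
      {within cyl R L, continuous GF.2}, forall p, cyl R L p -> mdist (al p.1) (GF.2 p) < e1 &
      forall i, fracture (GF.1 i) GF.2].
  move=> r; have [|||G' [F H]] := @fractured_connected _ _ I
    (fun i => if same r i then G i else G r) (G r o) L al e1 P _ _ cal _ e1p.
  - by move=> i; case: ifP.
  - move=> i; case: ifPn => [/asboolP h|_]; [exact: joined_sym|exact: joined_refl].
  - by move=> i t x ti xL; case: ifP => _; exact: miss.
  - by exists (G', F).
move=> /choice[GF GFP].
(* [pick] applied to equal predicates gives equal results, so [rep] depends on the path component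
   only. It is [None] on components with no square, where [F] stays at [al]. *)
pose rep y := [pick r | `[< joined y (G r o) >]].
have repE y y' : joined y y' -> rep y = rep y'.
  move=> yy'; apply: eq_pick => r; apply/asboolP/asboolP => h; last exact: joined_trans h.
  exact: joined_trans (joined_sym yy') h.
have repG i : exists2 r, rep (G i o) = Some r & same r i.
  rewrite /rep; case: pickP => [r h|/(_ i) /negP[]]; first by exists r.
  by apply/asboolP; exact: joined_refl.
pose G' i := if rep (G i o) is Some r then (GF r).1 i else G i.
pose br (a : option I) p := if a is Some r then (GF r).2 p else al p.1.
pose F p := br (rep (al p.1)) p.
have brP a : {within cyl R L, continuous (br a)} /\
    forall p, cyl R L p -> mdist (al p.1) (br a p) < e1.
  case: a => [r|] /=; first by have [_ _ h1 h2 _] := GFP r.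
  split; last by move=> p _; rewrite mdistxx.
  have c1 : {within cyl R L, continuous (fst : 'rV[R]_(vert L) * R -> _)}.
    by apply: continuous_subspaceT => p; exact: cvg_fst.
  have c2 : (fst : 'rV[R]_(vert L) * R -> _) @` cyl R L `<=` polyhedron R L.
    by move=> _ [[z t] [zL _] <-].
  exact: (within_comp c1 cal c2).
have Fal p : cyl R L p -> mdist (al p.1) (F p) < e1 by apply: (brP _).2.
have G'G i p : sq R p -> mdist (G i p) (G' i p) < e1.
  move=> ps; rewrite /G'; have [r -> ri] := repG i.
  by have [_ + _ _ _] := GFP r => /(_ i p ps); rewrite ri.
(* A meeting of [F] with [G' i] forces both into one component, so it already occurs for the maps
   attached to the representative [r]. *)
have meet i r z w : rep (G i o) = Some r -> sq R z -> cyl R L w -> F w = G' i z -> F w = (GF r).2 w.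
  move=> ri zs wL Fw; rewrite /F (_ : rep (al w.1) = Some r)//.
  rewrite -ri; apply: repE; apply: joined_trans (_ : joined _ (F w)) _.
    by case: (wL) => wL1 _; apply: j1 => //; apply: lt_le_trans (Fal w wL) _.
  rewrite Fw; apply: joined_trans (_ : joined _ (G i z)) _.
    by apply/joined_sym/j2 => //; apply: lt_le_trans (G'G i z zs) _.
  apply/joined_sym; exists (fun u => G i (u * z.1, u * z.2)); split.
  - by have cGi := cG i; cts.
  - by rewrite !mul0r.
  - by rewrite !mul1r; case: (z).
exists G', F; split.
- move=> i; rewrite /G'; have [r -> _] := repG i.
  by have [h _ _ _ _] := GFP r.
- by move=> i p /(G'G i); lra.
(* Along [al] the representative is locally constant, so near a point [F] coincides with a single
   branch. *)
- apply/subspace_continuousP => p pL W FW.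
  have /subspace_continuousP/(_ p pL) /(_ W FW) h1 := (brP (rep (al p.1))).1.
  have h2 : \forall q \near within (cyl R L) (nbhs p), rep (al q.1) = rep (al p.1).
    have /subspace_continuousP/(_ p pL) := (brP None).1.
    move=> /metricType_numDomainType.cvgrPdist_lt/(_ _ d10); rewrite !near_withinE.
    apply: filterS => q h qL; apply/esym/repE/j1; last exact: h.
    by case: pL.
  have h3 : \forall q \near within (cyl R L) (nbhs p), W (br (rep (al p.1)) q) := h1.
  have : \forall q \near within (cyl R L) (nbhs p), W (F q).
    by apply: filterS2 h2 h3 => q; rewrite /F => ->.
  by [].
- by move=> p /Fal; lra.
move=> i; have [r ri _] := repG i; have [_ _ _ _ /(_ i)] := GFP r.
have G'E : G' i = (GF r).1 i by rewrite /G' ri.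
rewrite -G'E => -[J [B [B1 B2 B3 B4]]]; exists J, B; split => //.
  move=> p ps [w wL Fw]; apply: B3 => //; exists w => //.
  by rewrite -(meet i r p w ri ps wL Fw).
move=> j; have [t ti tB] := B4 j; exists t => // x xL [z zB E].
have [_ /(_ z zB) zs] := B1 j.
have xt : cyl R L (x, t) by split => //; exact/IIP.
apply: (tB x xL); exists z => //.
by rewrite E (meet i r z (x, t) ri zs xt).
Qed.

End path_components.

(** * Edges of a 1-complex and gluing over them *)

Section edges.
Context {R : realType} {X : metricType R}.
Context (K : complex1).
Let n := vert K.

(** [adj] may hold in one direction or both, and between a vertex and itself; each proper edge is
    taken once, with increasing ends. *)
Definition edge_set := {p : 'I_n * 'I_n | (p.1 < p.2)%N && (adj p.1 p.2 || adj p.2 p.1)}.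
Definition src (a : edge_set) : 'I_n := (val a).1.
Definition tgt (a : edge_set) : 'I_n := (val a).2.
Definition on_edge (a : edge_set) (u : R) : 'rV[R]_n := edge_pt (src a) (tgt a) u.

Lemma src_tgt a : src a != tgt a.
Proof. by have /andP[ij _] := valP a; rewrite -val_eqE /= neq_ltn ij. Qed.

Lemma on_edge_coord a u k : on_edge a u ord0 k =
  if k == tgt a then u else if k == src a then 1 - u else 0.
Proof.
rewrite /on_edge /edge_pt !mxE eqxx /=; have st := src_tgt a.
case: (eqVneq k (tgt a)) => [->|_]; first by rewrite eq_sym (negbTE st) mulr0 mulr1 add0r.
by case: (eqVneq k (src a)) => _; rewrite ?mulr0 ?mulr1 addr0.
Qed.

Lemma on_edge_tgt a u : on_edge a u ord0 (tgt a) = u.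
Proof. by rewrite on_edge_coord eqxx. Qed.

Lemma on_edge_poly a u : 0 <= u <= 1 -> polyhedron R K (on_edge a u).
Proof.
move=> ui; have /andP[_ /orP[aij|aji]] := valP a; first exact: edge_poly.
by rewrite /on_edge edge_ptC; apply: edge_poly => //; lra.
Qed.

Lemma poly_cases x : polyhedron R K x ->
  (exists i, x = delta_mx ord0 i) \/ exists a u, 0 <= u <= 1 /\ x = on_edge a u.
Proof.
move=> [i [j [t [ij ti ->]]]]; rewrite -/(edge_pt _ _ _).
have [->|ne] := eqVneq i j; first by left; exists j; rewrite edge_pt_vertex.
have {}ij : adj i j by case: ij => // ij; rewrite ij eqxx in ne.
right; have [lt|gt|/val_inj E] := ltngtP i j; last by rewrite E eqxx in ne.
  have p : ((i, j).1 < (i, j).2)%N && (adj (i, j).1 (i, j).2 || adj (i, j).2 (i, j).1).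
    by rewrite /= lt ij.
  by exists (exist _ (i, j) p), t.
have p : ((j, i).1 < (j, i).2)%N && (adj (j, i).1 (j, i).2 || adj (j, i).2 (j, i).1).
  by rewrite /= gt ij orbT.
by exists (exist _ (j, i) p), (1 - t); split; [lra|rewrite edge_ptC].
Qed.

(** The nonzero coordinates of an interior point determine the edge, and the one at [tgt a] is the
    parameter. *)
Lemma on_edge_inj a a' u u' : 0 < u < 1 -> on_edge a u = on_edge a' u' -> a = a' /\ u = u'.
Proof.
move=> /andP[u0 u1] E; have st := src_tgt a.
have sup k : on_edge a u ord0 k != 0 -> (k == tgt a') || (k == src a').
  by rewrite E on_edge_coord; case: (k == tgt a') => //; case: (k == src a'); rewrite ?eqxx.
have ht : (tgt a == tgt a') || (tgt a == src a').
  by apply: sup; rewrite on_edge_tgt gt_eqF.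
have hs : (src a == tgt a') || (src a == src a').
  by apply: sup; rewrite on_edge_coord (negbTE st) eqxx gt_eqF// subr_gt0.
have aa : a = a'.
  apply: val_inj; move: ht hs; rewrite /tgt /src.
  have /andP[ij _] := valP a; have /andP[ij' _] := valP a'.
  move: ij ij'; move: (val a) (val a') => [i j] [i' j'] /= ij ij'.
  move=> /orP[/eqP h1|/eqP h1] /orP[/eqP h2|/eqP h2]; rewrite ?h1 ?h2//.
  - by move: ij; rewrite h1 h2 ltnn.
  - by move: ij; rewrite h1 h2 ltnNge ltnW.
  - by move: ij; rewrite h1 h2 ltnn.
by split => //; rewrite -(on_edge_tgt a u) E aa on_edge_tgt.
Qed.

Lemma delta_inj (i j : 'I_n) : delta_mx ord0 i = delta_mx ord0 j :> 'rV[R]_n -> i = j.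
Proof.
move=> /rowP /(_ i); rewrite !mxE !eqxx /=; case: eqVneq => // _ /eqP.
by rewrite oner_eq0.
Qed.

Lemma cts_on_edge (S : topologicalType) a (f : S -> R) : cts f -> cts (fun x => on_edge a (f x)).
Proof. exact: cts_edge_pt. Qed.

(** The vertices are pieces of their own because a vertex may lie on no edge. *)
Lemma glue_edges (G : edge_set -> R * R -> X) (g : 'I_n -> R -> X) (g0 : 'rV[R]_n * R -> X) :
  (forall a, cts (G a)) -> (forall i, cts (g i)) ->
  (forall a t, 0 <= t <= 1 -> G a (0, t) = g (src a) t /\ G a (1, t) = g (tgt a) t) ->
  exists f : 'rV[R]_n * R -> X, [/\ {within cyl R K, continuous f},
    forall a u t, 0 <= u <= 1 -> 0 <= t <= 1 -> f (on_edge a u, t) = G a (u, t) &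
    forall i t, 0 <= t <= 1 -> f (delta_mx ord0 i, t) = g i t].
Proof.
move=> cG cg Gg.
pose A (k : edge_set + 'I_n) : set ('rV[R]_n * R) :=
  (match k with inl a => on_edge a @` II R | inr i => [set delta_mx ord0 i] end) `*` II R.
pose h (k : edge_set + 'I_n) (p : 'rV[R]_n * R) :=
  match k with inl a => G a (p.1 ord0 (tgt a), p.2) | inr i => g i p.2 end.
have vtx a i u t : 0 <= t <= 1 -> on_edge a u = delta_mx ord0 i -> G a (u, t) = g i t.
  move=> ti E; have := on_edge_tgt a u; rewrite E mxE eqxx /=.
  case: eqVneq => [<- <-|_ u0]; first exact: (Gg a t ti).2.
  have : on_edge a 0 = delta_mx ord0 i by rewrite -E -u0.
  by rewrite /on_edge edge_pt0 => /delta_inj <-; rewrite -u0; exact: (Gg a t ti).1.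
have [|||f cf fE] := @paste _ _ _ A h g0.
- case=> [a|i]; apply: closed_rect; try exact: closed_II.
    by apply: compact_closed; [exact: norm_hausdorff|exact: compact_edge].
  by apply: compact_closed; [exact: norm_hausdorff|exact: compact_set1].
- case=> [a|i]; apply: continuous_subspaceT; rewrite /h -/(cts _).
    by have cGa := cG a; cts.
  by have cgi := cg i; cts.
- have key a i x t : 0 <= t <= 1 -> (exists2 u, 0 <= u <= 1 & x = on_edge a u) ->
      x = delta_mx ord0 i -> h (inl a) (x, t) = g i t.
    by move=> ti [u ui ->] E; rewrite /h /= on_edge_tgt; apply: vtx.
  have A1 a x t : A (inl a) (x, t) -> 0 <= t <= 1 /\ exists2 u, 0 <= u <= 1 & x = on_edge a u.
    by move=> [[u /IIP ui /= <-] /IIP ti]; split => //; exists u.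
  have A2 i x t : A (inr i) (x, t) -> 0 <= t <= 1 /\ x = delta_mx ord0 i.
    by move=> [/= -> /IIP ti].
  case=> [a|i] [a'|i'] [x t].
  + move=> /A1[ti xa] /A1[_ xa']; have [u ui xE] := xa.
    have [ui'|ui'] := boolP (0 < u < 1).
      by have [u' _ xE'] := xa'; rewrite xE in xE'; have [-> _] := on_edge_inj ui' xE'.
    have [i xi] : exists i, x = delta_mx ord0 i.
      have [u0|u1] : u = 0 \/ u = 1.
        move: ui ui' => /andP[u0 u1]; rewrite !lt_neqAle u0 u1 !andbT negb_and !negbK.
        by case/orP => /eqP; [left|right].
        by exists (src a); rewrite xE u0 /on_edge edge_pt0.
      by exists (tgt a); rewrite xE u1 /on_edge edge_pt1.
    by rewrite (key a i) ?(key a' i).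
  + by move=> /A1[ti xa] /A2[_ xi]; rewrite (key a i').
  + by move=> /A2[ti xi] /A1[_ xa]; rewrite (key a' i).
  + by move=> /A2[ti ->] /A2[_ /delta_inj ->].
exists f; split.
- apply: continuous_subspaceW cf => -[x t] [/= /poly_cases xc ti].
  case: xc => [[i ->]|[a [u [ui ->]]]]; first by exists (inr i).
  by exists (inl a) => //; split => //; exists u => //; exact/IIP.
- move=> a u t ui ti; rewrite (fE (inl a)) /h /= ?on_edge_tgt//.
  by split; [exists u => //; exact/IIP|exact/IIP].
- by move=> i t ti; rewrite (fE (inr i))//; split => //; exact/IIP.
Qed.

End edges.

(** * Assembling the maps on the cylinder *)

Section P_DADP_to_FRP.
Context {R : realType} {X : metricType R}.
Context (lcX : locally_contractible X).

Lemma unif_cont_family (I : finType) (G : I -> R * R -> X) (e : R) :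
  (forall i, cts (G i)) -> 0 < e ->
  exists2 d, 0 < d & forall i u v t, 0 <= u <= 1 -> 0 <= v <= 1 -> 0 <= t <= 1 ->
    `|u - v| < d -> mdist (G i (u, t)) (G i (v, t)) < e.
Proof.
move=> cG e0; apply: (fin_min (P := fun i d => forall u v t, 0 <= u <= 1 -> 0 <= v <= 1 ->
  0 <= t <= 1 -> `|u - v| < d -> mdist (G i (u, t)) (G i (v, t)) < e)).
  move=> i r r' _ rr' H u v t ui vi ti uv; apply: H => //; exact: lt_le_trans rr'.
move=> i; have cGi : {within sq R, continuous (G i)} by apply: continuous_subspaceT; exact: cG.
have [d d0 dP] := unif_cont compact_sq cGi e0; exists d => // u v t ui vi ti uv.
apply: dP; [by apply/sqP|by apply/sqP|].
by split => //; exact: ballxx.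
Qed.

Lemma homotopies_to_close_paths (V : finType) (w : V -> R -> X) (e : R) :
  (forall i, cts (w i)) -> 0 < e ->
  exists2 d, 0 < d & forall i (w' : R -> X), cts w' ->
    (forall t, 0 <= t <= 1 -> mdist (w i t) (w' t) < d) ->
    exists K : R * R -> X, [/\ cts K,
      forall t, 0 <= t <= 1 -> K (0, t) = w i t /\ K (1, t) = w' t &
      forall p, sq R p -> mdist (w i p.2) (K p) < e].
Proof.
move=> cw e0; apply: (fin_min (P := fun i d => forall w' : R -> X, cts w' ->
    (forall t, 0 <= t <= 1 -> mdist (w i t) (w' t) < d) ->
    exists K : R * R -> X, [/\ cts K,
      forall t, 0 <= t <= 1 -> K (0, t) = w i t /\ K (1, t) = w' t &
      forall p, sq R p -> mdist (w i p.2) (K p) < e])).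
  by move=> i r r' _ rr' H w' cw' ww'; apply: H => // t /ww' /lt_le_trans; apply.
by move=> i; apply: close_paths_homotopic.
Qed.

(** A common width serves all edges. [w] gives the new sides, while [v] is the wall against which
    the margins are measured: the old one in the first use, the new one itself in the second. *)
Lemma collar_family (K : complex1) (G : edge_set K -> R * R -> X) (w v : 'I_(vert K) -> R -> X)
    (H0 H1 : edge_set K -> R * R -> X) (e : R) : 0 < e -> (forall a, cts (G a)) ->
  (forall a, [/\ cts (H0 a), forall t, 0 <= t <= 1 -> H0 a (0, t) = w (src a) t,
    forall t, 0 <= t <= 1 -> H0 a (1, t) = G a (0, t) &
    forall p, sq R p -> mdist (v (src a) p.2) (H0 a p) < e]) ->
  (forall a, [/\ cts (H1 a), forall t, 0 <= t <= 1 -> H1 a (0, t) = w (tgt a) t,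
    forall t, 0 <= t <= 1 -> H1 a (1, t) = G a (1, t) &
    forall p, sq R p -> mdist (v (tgt a) p.2) (H1 a p) < e]) ->
  forall d, 0 < d -> exists (G' : edge_set K -> R * R -> X) (h : R),
    [/\ forall a, cts (G' a), 0 < h < 2^-1 /\ h < d,
      forall a t, 0 <= t <= 1 -> G' a (0, t) = w (src a) t /\ G' a (1, t) = w (tgt a) t &
      forall a u t, 0 <= u <= 1 -> 0 <= t <= 1 ->
        [/\ u <= h -> mdist (v (src a) t) (G' a (u, t)) < e,
          h <= u <= 1 - h -> G' a (u, t) = G a ((u - h) / (1 - 2 * h), t) &
          1 - h <= u -> mdist (v (tgt a) t) (G' a (u, t)) < e]].
Proof.
move=> e0 cG H0P H1P d d0.
have [h h0 [h1 hd]] : exists2 h : R, 0 < h & h < 2^-1 /\ h < d.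
  exists (Num.min 4^-1 (d / 2)); first by rewrite lt_min divr_gt0//; lra.
  by rewrite !gt_min; split; apply/orP; [left|right]; lra.
have h01 : 0 < h < 2^-1 by rewrite h0 h1.
have : forall a, exists G' : R * R -> X, [/\ cts G',
    forall t, 0 <= t <= 1 -> G' (0, t) = H0 a (0, t) /\ G' (1, t) = H1 a (0, t) &
    forall u t, 0 <= u <= 1 -> 0 <= t <= 1 ->
    [/\ u <= h -> exists2 s, 0 <= s <= 1 & G' (u, t) = H0 a (s, t),
        h <= u <= 1 - h -> G' (u, t) = G a ((u - h) / (1 - 2 * h), t) &
        1 - h <= u -> exists2 s, 0 <= s <= 1 & G' (u, t) = H1 a (s, t)]].
  move=> a; have [c0 _ e01 _] := H0P a; have [c1 _ e11 _] := H1P a.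
  exact: collar (cG a) c0 c1 h01 e01 e11.
move=> /choice[G' G'P]; exists G', h; split => //.
- by move=> a; have [] := G'P a.
- move=> a t ti; have [_ /(_ t ti)[-> ->] _] := G'P a.
  by have [_ -> // _ _] := H0P a; have [_ -> // _ _] := H1P a.
- move=> a u t ui ti; have [_ _ /(_ u t ui ti)[k1 k2 k3]] := G'P a; split => //.
    by move=> /k1[s si ->]; have [_ _ _ h4] := H0P a; apply: (h4 (s, t)); apply/sqP.
  by move=> /k3[s si ->]; have [_ _ _ h4] := H1P a; apply: (h4 (s, t)); apply/sqP.
Qed.

Lemma collar_coord (h u : R) : 0 < h < 2^-1 -> h <= u <= 1 - h ->
  0 <= (u - h) / (1 - 2 * h) <= 1 /\ `|(u - h) / (1 - 2 * h) - u| <= h.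
Proof.
move=> /andP[h0 h1] /andP[u0 u1]; have d0 : 0 < 1 - 2 * h by lra.
split; first by rewrite divr_ge0 ?ler_pdivrMr ?mul1r//; lra.
rewrite (_ : _ - u = h * (2 * u - 1) / (1 - 2 * h)); last by field; rewrite gt_eqF.
rewrite ler_norml ler_pdivrMr// ler_pdivlMr//; apply/andP; split; nra.
Qed.

Lemma collar_close (K : complex1) (F G G' : edge_set K -> R * R -> X)
    (v : 'I_(vert K) -> R -> X) (h d e : R) :
  0 < h < 2^-1 -> h < d ->
  (forall a u u' t, 0 <= u <= 1 -> 0 <= u' <= 1 -> 0 <= t <= 1 ->
    `|u - u'| < d -> mdist (F a (u, t)) (F a (u', t)) < e) ->
  (forall a t, 0 <= t <= 1 -> F a (0, t) = v (src a) t /\ F a (1, t) = v (tgt a) t) ->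
  (forall a p, sq R p -> mdist (F a p) (G a p) < e) ->
  (forall a u t, 0 <= u <= 1 -> 0 <= t <= 1 ->
        [/\ u <= h -> mdist (v (src a) t) (G' a (u, t)) < e,
          h <= u <= 1 - h -> G' a (u, t) = G a ((u - h) / (1 - 2 * h), t) &
          1 - h <= u -> mdist (v (tgt a) t) (G' a (u, t)) < e]) ->
  forall a p, sq R p -> mdist (F a p) (G' a p) < 2 * e.
Proof.
move=> h01 hd uF Fv FG G'P a [u t] /sqP[/= ui ti].
have i0 : 0 <= (0 : R) <= 1 by rewrite lexx ler01.
have i1 : 0 <= (1 : R) <= 1 by rewrite lexx ler01.
have [F0 F1] := Fv a t ti; have [k1 k2 k3] := G'P a u t ui ti.
have /andP[h0 h1] := h01.
have [uh|hu] := lerP u h.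
  have := k1 uh; have := uF a u 0 t ui i0 ti; rewrite F0 => H1 H2.
  have {}H1 := H1 _; apply: le_lt_trans (metric_triangle _ (v (src a) t) _) _.
  have : mdist (F a (u, t)) (v (src a) t) < e by apply: H1; rewrite subr0 ger0_norm; lra.
  by lra.
have [uh'|hu'] := lerP (1 - h) u.
  have := k3 uh'; have := uF a u 1 t ui i1 ti; rewrite F1 => H1 H2.
  apply: le_lt_trans (metric_triangle _ (v (tgt a) t) _) _.
  have : mdist (F a (u, t)) (v (tgt a) t) < e by apply: H1; rewrite ler0_norm; lra.
  by lra.
have um : h <= u <= 1 - h by rewrite !ltW.
have [ci cu] := collar_coord h01 um.
rewrite k2//; set u' := (u - h) / (1 - 2 * h) in ci cu *.
apply: le_lt_trans (metric_triangle _ (F a (u', t)) _) _.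
have H1 : mdist (F a (u, t)) (F a (u', t)) < e.
  by apply: uF => //; rewrite distrC; apply: le_lt_trans cu hd.
have H2 : mdist (F a (u', t)) (G a (u', t)) < e by apply: FG; apply/sqP.
by lra.
Qed.

(** Two rounds of collars are made. The first gives the squares the sides [w'], which miss [al1].
    Fracturing then perturbs each square on its own and destroys the agreement over the vertices;
    the second round restores the sides [w'] so that the squares can be glued. *)
Lemma P_DADP_FRP : P_DADP_star X -> FRP_star X.
Proof.
move=> P K1 K2 f1 tau1 f2 tau2 e k1 k2 e0.
have [[[cf1 _] mtau1] tau01] := k1; have [[[[cf2 _] _] _] f2c] := k2.
have i0 : 0 <= (0 : R) <= 1 by rewrite lexx ler01.
have i1 : 0 <= (1 : R) <= 1 by rewrite lexx ler01.
pose al x := f2 (x, 0).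
have cal : {within polyhedron R K2, continuous al}.
  have c1 : {within polyhedron R K2, continuous (fun x : 'rV[R]_(vert K2) => (x, 0 : R))}.
    by apply: continuous_subspaceT; rewrite -/(cts _); cts.
  have c2 : (fun x : 'rV[R]_(vert K2) => (x, 0 : R)) @` polyhedron R K2 `<=` cyl R K2.
    by move=> _ [x xL <-]; split => //; exact/IIP.
  exact: (within_comp c1 cf2 c2).
have cf1T (S : topologicalType) (k : S -> 'rV[R]_(vert K1) * R) : cts k -> (forall s, cyl R K1 (k s)) ->
    cts (fun s => f1 (k s)).
  move=> ck kc; apply: within_setT; have c1 : {within setT, continuous k} by apply: continuous_subspaceT.
  have c2 : k @` setT `<=` cyl R K1 by move=> _ [s _ <-].
  exact: (within_comp c1 cf1 c2).
pose w (i : 'I_(vert K1)) t := f1 (delta_mx ord0 i, clamp t).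
have cw i : cts (w i).
  by apply: cf1T; [cts|move=> t; split; [exact: vertex_poly|exact: clamp_II]].
pose F0 (a : edge_set K1) (p : R * R) := f1 (on_edge a (clamp p.1), clamp p.2).
have cF0 a : cts (F0 a).
  apply: cf1T; first by apply: cts_pair; [apply: cts_on_edge|]; cts.
  by move=> p; split; [apply: on_edge_poly; exact: clamp_itv|exact: clamp_II].
have F0w a t : 0 <= t <= 1 -> F0 a (0, t) = w (src a) t /\ F0 a (1, t) = w (tgt a) t.
  move=> ti; rewrite /F0 /w /= [clamp 0]clamp_le0// [clamp 1]clamp_ge1//.
  by rewrite /on_edge edge_pt0 edge_pt1.
(* Over an edge, each of the two rounds of collars costs less than 2 e2. *)
pose e2 := e / 8; have e20 : 0 < e2 by rewrite divr_gt0.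
have [d1 d10 d1P] := homotopies_to_close_paths cw e20.
have m0 : 0 < Num.min e2 d1 by rewrite lt_min e20.
have [w' [al1 [c [[cw' cal1] ww' aal1 c0 cP]]]] :=
  disjoint_walls (P_DADP_arcs_disjoint P) cw cal m0.
have : forall i, exists K : R * R -> X, [/\ cts K,
      forall t, 0 <= t <= 1 -> K (0, t) = w' i t /\ K (1, t) = w i t &
      forall p, sq R p -> mdist (w i p.2) (K p) < e2].
  move=> i; have [||K [cK K01 Kw]] := d1P i (w' i); first exact: cw'.
    by move=> t ti; have := ww' i t ti; rewrite lt_min => /andP[].
  exists (fun p => K (1 - p.1, p.2)); split; first by cts.
    by move=> t /K01[h1 h2]; rewrite subr0 subrr.
  move=> p /sqP[p1 p2]; apply: (Kw (1 - p.1, p.2)); apply/sqP; split => //=; lra.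
move=> /choice[Kw KwP].
have [d2 d20 d2P] := unif_cont_family cF0 e20.
have [||G0 [h1 [cG0 [h1P h1d] G0w G0P]]] := @collar_family K1 F0 w' w
  (fun a => Kw (src a)) (fun a => Kw (tgt a)) e2 e20 cF0 _ _ d2 d20.
- move=> a; have [cK K01 Kc] := KwP (src a); split => //.
    by move=> t /K01[].
  by move=> t ti; rewrite (F0w a t ti).1; case: (K01 t ti).
- move=> a; have [cK K01 Kc] := KwP (tgt a); split => //.
    by move=> t /K01[].
  by move=> t ti; rewrite (F0w a t ti).2; case: (K01 t ti).
have F00 a p : sq R p -> mdist (F0 a p) (F0 a p) < e2 by rewrite mdistxx.
have FG0 := collar_close h1P h1d d2P F0w F00 G0P.
(* The new margins stay within [c / 4] of [w'] and [F] within [c / 4] of [al1], while [w'] and [al1]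
   are at least [c] apart: the margins meet nothing. *)
have e30 : 0 < Num.min e2 (c / 4) by rewrite lt_min e20; lra.
have [d3 d30 d3P] := homotopies_to_close_paths cw' e30.
have e40 : 0 < Num.min d3 (Num.min e2 (c / 4)) by rewrite lt_min d30.
have [|G' [F [cG' G0G' cF Fal frac]]] := fractured_family lcX P cG0 cal1 _ e40.
  move=> a t x ti xL; have [-> ->] := G0w a t ti.
  by split=> E; [have := cP (src a) t x ti xL|have := cP (tgt a) t x ti xL]; rewrite E mdistxx; clear -c0; lra.
have G0G'e a p : sq R p -> [/\ mdist (G0 a p) (G' a p) < d3,
    mdist (G0 a p) (G' a p) < e2 & mdist (G0 a p) (G' a p) < c / 4].
  by move=> /(G0G' a); rewrite !lt_min => /and3P[].
have s0 t : 0 <= t <= 1 -> sq R (0, t) by move=> ti; apply/sqP.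
have s1 t : 0 <= t <= 1 -> sq R (1, t) by move=> ti; apply/sqP.
have : forall ab : edge_set K1 * bool, exists K : R * R -> X, [/\ cts K,
    forall t, 0 <= t <= 1 -> K (0, t) = w' (if ab.2 then tgt ab.1 else src ab.1) t /\
      K (1, t) = G' ab.1 (if ab.2 then 1 else 0, t) &
    forall p, sq R p -> mdist (w' (if ab.2 then tgt ab.1 else src ab.1) p.2) (K p) < Num.min e2 (c / 4)].
  move=> [a b] /=; apply: d3P; first by have cGa := cG' a; cts.
  move=> t ti; have [h2 h3] := G0w a t ti.
  case: b; rewrite -?h3 -?h2; first by have [h _ _] := G0G'e a _ (s1 t ti).
  by have [h _ _] := G0G'e a _ (s0 t ti).
move=> /choice[H HP].
have [d4 d40 d4P] := unif_cont_family cG0 e20.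
have [||G4 [h4 [cG4 [h4P h4d] G4w G4P]]] := @collar_family K1 G' w' w'
  (fun a => H (a, false)) (fun a => H (a, true)) (Num.min e2 (c / 4)) e30 cG' _ _ d4 d40.
- move=> a; have [cK K01 Kc] := HP (a, false); split => //.
    by move=> t /K01[].
  by move=> t /K01[].
- move=> a; have [cK K01 Kc] := HP (a, true); split => //.
    by move=> t /K01[].
  by move=> t /K01[].
have GG4 : forall a p, sq R p -> mdist (G0 a p) (G4 a p) < 2 * e2.
  apply: (collar_close (v := w') (G := G') h4P h4d d4P G0w).
    by move=> a p /(G0G'e a)[].
  move=> a u t ui ti; have [k3 k4 k5] := G4P a u t ui ti; split => //.
    by move=> /k3; rewrite lt_min => /andP[].
  by move=> /k5; rewrite lt_min => /andP[].
have [f1' [cf1' f1'e f1'v]] := glue_edges f1 cG4 cw' G4w.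
have Fal1 p : cyl R K2 p -> mdist (al1 p.1) (F p) < e2 /\ mdist (al1 p.1) (F p) < c / 4.
  by move=> /Fal; rewrite !lt_min => /and3P[].
have {frac} : forall a, exists JB : {J : finType & J -> 'rV[R]_2 -> R * R},
  [/\ forall j, cell_param (projT2 JB j) /\ cell_carrier (projT2 JB j) `<=` sq R,
      trivIset [set: projT1 JB] (fun j => cell_carrier (projT2 JB j)),
      forall p, sq R p -> (F @` cyl R K2) (G' a p) -> exists j, cell_int (projT2 JB j) p &
      forall j, exists2 t, 0 <= t <= 1 & forall x, polyhedron R K2 x ->
        ~ (G' a @` cell_carrier (projT2 JB j)) (F (x, t))].
  by move=> a; have [J [B BP]] := frac a; exists (existT _ J B).
move=> /choice[JB JBP].
have /andP[h40 h41] := h4P; have d5 : 0 < 1 - 2 * h4 by clear -h41; lra.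
(* The part of the cylinder over an edge where the glued map is a rescaled copy of [G' a]; all balls
   are placed there. *)
pose Em (a : edge_set K1) (z : R * R) := (on_edge a (h4 + (1 - 2 * h4) * z.1), z.2).
have Emi (z : R * R) : sq R z -> h4 <= h4 + (1 - 2 * h4) * z.1 <= 1 - h4.
  move=> /sqP[/andP[z0 z1] _]; have := ler_wpM2l (ltW d5) z1; rewrite mulr1 => z2.
  have z3 : 0 <= (1 - 2 * h4) * z.1 by rewrite mulr_ge0 ?(ltW d5).
  by clear -z2 z3; lra.
have Em_cyl a z : sq R z -> cyl R K1 (Em a z).
  move=> zs; have zi := Emi z zs; have /sqP[_ z2] := zs.
  split; last exact/IIP.
  by apply: on_edge_poly; clear -zi h40; lra.
have f1'Em a z : sq R z -> f1' (Em a z) = G' a z.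
  move=> zs; have zi := Emi z zs; have /sqP[_ z2] := zs.
  have zi' : 0 <= h4 + (1 - 2 * h4) * z.1 <= 1 by clear -zi h40; lra.
  rewrite f1'e//; have [_ -> // _] := G4P a _ _ zi' z2.
  by rewrite addrAC subrr add0r mulrC mulKf ?gt_eqF//; case: (z).
have Em_inj a a' z z' : sq R z -> sq R z' -> Em a z = Em a' z' -> a = a' /\ z = z'.
  move=> zs zs' [E1 E2]; have zi := Emi z zs.
  have ui : 0 < h4 + (1 - 2 * h4) * z.1 < 1 by clear -zi h40; lra.
  have [aa /addrI /mulfI] := on_edge_inj ui E1; rewrite gt_eqF// => /(_ isT) z1.
  by split => //; rewrite [LHS]surjective_pairing z1 E2 -surjective_pairing.
have wF i t p : 0 <= t <= 1 -> cyl R K2 p -> F p <> w' i t.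
  move=> ti pL E; have [pL1 _] := pL; have [_ h] := Fal1 p pL.
  by have := cP i t _ ti pL1; rewrite (metric_sym (w' i t)) -E; clear -h c0; lra.
exists f1', tau1, F, snd; split => //.
- split; first by split => //; split => //; exact: map_onT.
  split; last by [].
  split; first exact: map_onT.
  split; first by apply: continuous_subspaceT => p; exact: cvg_snd.
  by move=> _ [[x t] [_ ti] <-].
- split.
    move=> [x t] [/= xK /IIP ti]; case: (poly_cases xK) => [[i ->]|[a [u [ui ->]]]].
      rewrite f1'v//; have := ww' i t ti; rewrite lt_min /w clamp_id// => /andP[+ _].
      by rewrite /e2; clear -e0; lra.
    have us : sq R (u, t) by apply/sqP.
    have := FG0 a _ us; have := GG4 a _ us; rewrite f1'e// => k3 k4.
    have E : F0 a (u, t) = f1 (on_edge a u, t) by rewrite /F0 /= !clamp_id.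
    rewrite -E; apply: le_lt_trans (metric_triangle _ (G0 a (u, t)) _) _.
    by move: k3 k4; rewrite /e2; clear -e0; lra.
  move=> [x t] [/= xK ti]; have [-> _] := f2c x t xK ti; rewrite -/(al x).
  have [|h5 _] := Fal1 (x, t); first by split.
  have := aal1 x xK; rewrite lt_min => /andP[h6 _].
  by apply: le_lt_trans (metric_triangle _ (al1 x) _) _; move: h5 h6; rewrite /e2 /=; clear -e0; lra.
pose T : finType := {a : edge_set K1 & projT1 (JB a)}.
pose Bt (x : T) v := Em (tag x) (projT2 (JB (tag x)) (tagged x) v).
have Bsq (x : T) v : disk R 2 v -> sq R (projT2 (JB (tag x)) (tagged x) v).
  move=> vd; have [B1 _ _ _] := JBP (tag x); have [_ Bs] := B1 (tagged x).
  by apply: Bs; exists v.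
exists #|{: T}|, (fun j => Bt (enum_val j)); split.
- move=> j; set x := enum_val j; have [B1 _ _ _] := JBP (tag x).
  have [[cB Bi] Bs] := B1 (tagged x); split; last first.
    by move=> _ [v vd <-]; apply: Em_cyl; exact: Bsq.
  split.
    apply: (within_compT (g := Em (tag x)) cB); rewrite -/(cts _) /Em.
    by apply: cts_pair; [apply: cts_on_edge|]; cts.
  move=> v v' vd v'd /Em_inj[]; [exact: Bsq|exact: Bsq|].
  by move=> _; apply: Bi.
- move=> i j _ _ [z [[v vd <-] [v' v'd E]]]; apply: enum_val_inj.
  move: E; rewrite /Bt => /Em_inj[]; [exact: Bsq|exact: Bsq|].
  case: (enum_val i) (enum_val j) => [a k] [a' k'] /= aa; move: k'; rewrite aa => k' E.
  have [_ B2 _ _] := JBP a; congr existT; apply: B2 => //.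
  exists (projT2 (JB a) k v); split; first by exists v.
  by exists v'.
- move=> [x t] [[/= xK /IIP ti] [p pL Fp]].
  case: (poly_cases xK) Fp => [[i ->]|[a [u [ui ->]]]] Fp.
    by case: (wF i t p ti pL); rewrite Fp f1'v.
  rewrite f1'e// in Fp; have [k3 k4 k5] := G4P a u t ui ti.
  have away i : ~ mdist (w' i t) (G4 a (u, t)) < Num.min e2 (c / 4).
    rewrite lt_min => /andP[_ h]; have [pL1 _] := pL; have [_ h'] := Fal1 p pL.
    have := cP i t _ ti pL1; have := metric_triangle (w' i t) (F p) (al1 p.1).
    by rewrite (metric_sym (F p)); move: h h'; rewrite Fp; clear -c0; lra.
  have um : h4 <= u <= 1 - h4.
    apply/andP; split; rewrite leNgt; apply/negP => hu.
      by apply: (away (src a)); apply: k3; exact: ltW.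
    by apply: (away (tgt a)); apply: k5; exact: ltW.
  have [ci _] := collar_coord h4P um.
  pose z := ((u - h4) / (1 - 2 * h4), t).
  have zs : sq R z by apply/sqP.
  have [_ _ B3 _] := JBP a.
  have [|j [v vo Bv]] := B3 z zs; first by exists p => //; rewrite Fp k4.
  exists (enum_rank (Tagged (fun a => projT1 (JB a)) j)) => //.
  exists v => //; rewrite enum_rankK /Bt /= Bv /Em /z /=.
  by congr (on_edge _ _, _); field; rewrite gt_eqF.
- move=> j E; set x := enum_val j in E; have [_ _ _ B4] := JBP (tag x).
  have [t ti tB] := B4 (tagged x).
  have : II R t by apply/IIP.
  rewrite -E => -[[y t'] [[/= yL _] [_ [v vd <-] E2]] /= tt].
  apply: (tB y yL); rewrite -tt; exists (projT2 (JB (tag x)) (tagged x) v); first by exists v.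
  by rewrite -E2 f1'Em//; exact: Bsq.
Qed.

End P_DADP_to_FRP.

(** * From FRP* to P-DADP* *)

Section clearing_lines.
Context {R : realType} {X : metricType R}.
Context (lcX : locally_contractible X).

(** [f] is cut along the line, both sides are shifted away from it by [h], and the gap is filled by
    the homotopy [K] run towards [w'] on the line itself. The map [r] is the reverse shift, and [h]
    is half of a modulus of continuity of [f]. *)
Lemma clear_line (f : R * R -> X) (L : complex1) (al : 'rV[R]_(vert L) -> X) (c e : R) :
  arcs_disjoint (X := X) -> cts f -> {within polyhedron R L, continuous al} ->
  0 <= c <= 1 -> 0 < e ->
  exists (f' : R * R -> X) (al' : 'rV[R]_(vert L) -> X),
    [/\ cts f' /\ {within polyhedron R L, continuous al'},
      forall p, sq R p -> mdist (f p) (f' p) < e,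
      eps_approximation (polyhedron R L) e al al' &
      forall t x, 0 <= t <= 1 -> polyhedron R L x -> f' (c, t) <> al' x].
Proof.
move=> AD cf cal ci e0; have e20 : 0 < e / 2 by lra.
pose w t := f (c, t); have cw : cts w by rewrite /w; cts.
have [d d0 dP] := close_paths_homotopic lcX cw e20.
have m0 : 0 < Num.min e d by rewrite lt_min e0.
have [w' [al' [[cw' cal'] ww' aal' dis]]] := AD _ _ _ _ cw cal m0.
have [||K [cK K01 Kw]] := dP w'; first exact: cw'.
  by move=> t /ww'; rewrite lt_min => /andP[].
have cfI : {within sq R, continuous f} by exact: continuous_subspaceT.
have [k k0 kP] := unif_cont compact_sq cfI e20.
pose h := k / 2; have h0 : 0 < h by rewrite divr_gt0.
pose r (u : R) := u - Num.max (- h) (Num.min h (u - c)).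
have [|||| f' [cf' fA fB]] := @paste_at R X (fun p => `|p.1 - c|) h
  (fun p => K (clamp (1 - `|p.1 - c| / h), clamp p.2)) (fun p => f (r p.1, clamp p.2)).
- by cts.
- by cts.
- by rewrite /r; cts.
- move=> p pc; rewrite pc divff ?gt_eqF// subrr [clamp 0]clamp_le0//.
  have [-> _] := K01 _ (clamp_itv p.2); rewrite /w; congr (f (_, _)).
  rewrite /r; have [pn|pp] := ler0P (p.1 - c); move: pc; [rewrite ler0_norm//|rewrite gtr0_norm//] => pc.
    rewrite (min_idPr _); last by lra.
    by rewrite (_ : p.1 - c = - h) ?maxxx; lra.
  rewrite (_ : p.1 - c = h) // minxx (max_idPr _); lra.
exists f', al'; split => //.
- move=> [u t] /[dup] us /sqP[/= ui ti]; have [uc|cu] := lerP `|u - c| h.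
    rewrite fA//= (clamp_id ti); set s := clamp _.
    have h1 : mdist (w t) (K (s, t)) < e / 2 by apply: (Kw (s, t)); apply/sqP; split => //; exact: clamp_itv.
    have h2 : mdist (f (u, t)) (w t) < e / 2.
      apply: kP; [by []|by apply/sqP|].
      split; last exact: ballxx.
      by rewrite /ball/=; apply: le_lt_trans uc _; rewrite /h; lra.
    by apply: le_lt_trans (metric_triangle _ (w t) _) _; lra.
  rewrite fB/= ?(ltW cu)// (clamp_id ti).
  have rE : 0 <= r u <= 1 /\ `|u - r u| <= h.
    rewrite /r opprB addrCA subrr addr0; have [pn|pp] := ler0P (u - c).
      move: cu; rewrite ler0_norm// => cu.
      rewrite (min_idPr _) ?(max_idPl _); [|lra|lra].
      by rewrite normrN gtr0_norm//; split; lra.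
    move: cu; rewrite gtr0_norm// => cu.
    rewrite (min_idPl _) ?(max_idPr _); [|lra|lra].
    by rewrite gtr0_norm//; split; lra.
  apply: lt_trans (_ : e / 2 < e); last by lra.
  apply: kP; [by []|by apply/sqP; split => //; exact: rE.1|].
  split; last exact: ballxx.
  by rewrite /ball/=; apply: le_lt_trans rE.2 _; rewrite /h; lra.
- by move=> x /aal'; rewrite lt_min => /andP[].
- move=> t x ti xL; rewrite fA/= ?subrr ?normr0 ?(ltW h0)// mul0r subr0 [clamp 1]clamp_ge1//.
  by rewrite (clamp_id ti) (K01 t ti).2; exact: dis.
Qed.

Definition on_line (l : bool * R) (p : R * R) := (if l.1 then p.1 else p.2) = l.2.

(** Both maps move by less than a quarter of the gap obtained so far, so at least half of it
    survives on the earlier lines. Horizontal lines are reduced to vertical ones by exchanging the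
    coordinates. *)
Lemma clear_lines (s : seq (bool * R)) (f : R * R -> X) (L : complex1)
    (al : 'rV[R]_(vert L) -> X) (e : R) :
  arcs_disjoint (X := X) -> cts f -> {within polyhedron R L, continuous al} ->
  (forall l, l \in s -> 0 <= l.2 <= 1) -> 0 < e ->
  exists (f' : R * R -> X) (al' : 'rV[R]_(vert L) -> X) (c : R),
    [/\ cts f' /\ {within polyhedron R L, continuous al'},
      forall p, sq R p -> mdist (f p) (f' p) < e,
      eps_approximation (polyhedron R L) e al al', 0 < c &
      forall l p x, l \in s -> sq R p -> on_line l p -> polyhedron R L x ->
        c <= mdist (f' p) (al' x)].
Proof.
move=> AD cf cal s01; elim: s e s01 => [|l s IH] e s01 e0.
  by exists f, al, 1; split => // [p _|x _]; rewrite mdistxx.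
have e20 : 0 < e / 2 by lra.
have [|f1 [al1 [c [[cf1 cal1] ff1 aal1 c0 cP]]]] := IH _ _ e20.
  by move=> l' l's; apply: s01; rewrite inE l's orbT.
have l01 : 0 <= l.2 <= 1 by apply: s01; rewrite inE eqxx.
have m0 : 0 < Num.min (e / 2) (c / 4) by rewrite lt_min e20; lra.
have [f2 [al2 [[cf2 cal2] f1f2 al12 dis]]] : exists (f2 : R * R -> X) (al2 : 'rV[R]_(vert L) -> X),
    [/\ cts f2 /\ {within polyhedron R L, continuous al2},
      forall p, sq R p -> mdist (f1 p) (f2 p) < Num.min (e / 2) (c / 4),
      eps_approximation (polyhedron R L) (Num.min (e / 2) (c / 4)) al1 al2 &
      forall p x, sq R p -> on_line l p -> polyhedron R L x -> f2 p <> al2 x].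
  case: l l01 {s01} => -[] z /= z01; rewrite /on_line /=.
    have [f2 [al2 [h1 h2 h3 h4]]] := clear_line AD cf1 cal1 z01 m0.
    exists f2, al2; split => // -[u t] x /sqP[/= ui ti] -> xL; exact: h4.
  have cf1s : cts (fun p => f1 (p.2, p.1)) by cts.
  have [f2 [al2 [[h1 h1'] h2 h3 h4]]] := clear_line AD cf1s cal1 z01 m0.
  exists (fun p => f2 (p.2, p.1)), al2; split => //.
  - by split => //; cts.
  - move=> [u t] /sqP[ui ti]; apply: (h2 (t, u)); exact/sqP.
  - by move=> [u t] x /sqP[/= ui ti] -> xL; exact: h4.
pose Z := sq R `&` [set p | on_line l p].
have cZ : compact Z.
  apply: compact_closedI; first exact: compact_sq.
  pose co (p : R * R) := if l.1 then p.1 else p.2.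
  rewrite (_ : [set p | _] = co @^-1` [set l.2])//.
  apply: preimage_closed; last by apply: compact_closed; [exact: norm_hausdorff|exact: compact_set1].
  by move=> x _; rewrite /co; case: (l.1); [exact: cvg_fst|exact: cvg_snd].
have cf2Z : {within Z, continuous f2} by exact: continuous_subspaceT.
have [|d d0 dP] := gap cZ (@compact_poly _ L) cf2Z cal2.
  by move=> p x [ps pl] xL; exact: dis.
exists f2, al2, (Num.min (c / 2) d); split.
- by [].
- move=> p ps; have := f1f2 p ps; rewrite lt_min => /andP[h _].
  by apply: le_lt_trans (metric_triangle _ (f1 p) _) _; have := ff1 p ps; lra.
- move=> x xL; have := al12 x xL; rewrite lt_min => /andP[h _].
  by apply: le_lt_trans (metric_triangle _ (al1 x) _) _; have := aal1 x xL; lra.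
- by rewrite lt_min d0 andbT; lra.
move=> l' p x; rewrite inE ge_min => /predU1P[->|l's] ps pl xL; apply/orP.
  by right; apply: dP.
left; have h1 := cP l' p x l's ps pl xL.
have := f1f2 p ps; have := al12 x xL; rewrite !lt_min => /andP[_ h2] /andP[_ h3].
have := metric_triangle (f1 p) (f2 p) (al1 x); have := metric_triangle (f2 p) (al2 x) (al1 x).
by rewrite (metric_sym (al2 x)); lra.
Qed.

End clearing_lines.

(** * Fractures of the square and pushing balls off their centres *)

Section FRP_squares.
Context {R : realType} {X : metricType R}.

Definition arc_complex := @Complex1 2 (fun i j => (i < j)%N).
Definition arc_edge : edge_set arc_complex :=
  exist _ (ord0 : 'I_2, ord_max : 'I_2) (erefl : is_true true).

Lemma arc_poly x : polyhedron R arc_complex x ->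
  0 <= x ord0 (tgt arc_edge) <= 1 /\ x = on_edge arc_edge (x ord0 (tgt arc_edge)).
Proof.
suff H : polyhedron R arc_complex x -> exists u, 0 <= u <= 1 /\ x = on_edge arc_edge u.
  by move=> /H[u [ui ->]]; rewrite on_edge_tgt.
move=> /poly_cases[[i ->]|[a [u [ui ->]]]].
  have [->|->] : i = ord0 \/ i = ord_max.
    by case: i => -[|[|//]] ?; [left|right]; exact: val_inj.
    by exists 0; rewrite lexx ler01 /on_edge edge_pt0.
  by exists 1; rewrite lexx ler01 /on_edge edge_pt1.
exists u; split => //; congr on_edge; apply: val_inj => /=; clear -a.
case: a => -[i j] /= /andP[ij _].
have i0 : i = ord0 by case: i j ij => -[|[|//]] ? [[|[|//]] ?] //= _; exact: val_inj.
have j1 : j = ord_max by case: i j ij {i0} => -[|[|//]] ? [[|[|//]] ?] //= _; exact: val_inj.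
by rewrite i0 j1.
Qed.

Lemma FRP_fracture (f : R * R -> X) (L : complex1) (al : 'rV[R]_(vert L) -> X) (e : R) :
  FRP_star X -> cts f -> {within polyhedron R L, continuous al} -> 0 < e ->
  exists (g : R * R -> X) (F : 'rV[R]_(vert L) * R -> X),
    [/\ cts g, forall p, sq R p -> mdist (f p) (g p) < e,
      {within cyl R L, continuous F}, forall p, cyl R L p -> mdist (al p.1) (F p) < e &
      fracture g F].
Proof.
move=> FR cf cal e0.
pose xt (p : 'rV[R]_(vert arc_complex) * R) := (p.1 ord0 (tgt arc_edge), p.2).
have cxt : cts xt by rewrite /xt; cts.
pose f1 p := f (xt p); pose f2 (p : 'rV[R]_(vert L) * R) := al p.1.
have ctau K : map_on (cyl R K) (II R) (snd : _ -> R).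
  split; first by apply: continuous_subspaceT => p; exact: cvg_snd.
  by move=> _ [[x t] [_ ti] <-].
have k1 : in_catK (f1 : 'rV[R]_(vert arc_complex) * R -> X) snd.
  split; last by [].
  split; last exact: ctau.
  by apply: map_onT; apply: continuous_subspaceT; rewrite -/(cts _) /f1; cts.
have k2 : in_catKc (f2 : 'rV[R]_(vert L) * R -> X) snd.
  split; last by [].
  split; last by [].
  split; last exact: ctau.
  apply: map_onT; apply: (within_comp (f := fst)) cal _.
    by apply: continuous_subspaceT => p; exact: cvg_fst.
  by move=> _ [[x t] [xL _] <-].
have [f1' [tau1' [F [tau2' [[[[[cf1' _] _] _] [[[cF _] _] _]] [ff1 ff2] tau2E]]]]] :=
  FR _ _ _ _ _ _ e k1 k2 e0.
move=> [m [B [Bc Bt Bi Bf]]].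
pose ar (p : R * R) := (on_edge arc_edge (clamp p.1), clamp p.2).
have arc_cyl p : cyl R arc_complex (ar p).
  by split; [apply: on_edge_poly; exact: clamp_itv|exact: clamp_II].
have xt_ar p : sq R p -> xt (ar p) = p.
  move=> /sqP[p1 p2]; have -> : xt (ar p) = (clamp p.1, clamp p.2).
    by congr pair; exact: on_edge_tgt.
  by rewrite !clamp_id//; case: (p).
have ar_xt q : cyl R arc_complex q -> ar (xt q) = q.
  move=> [/arc_poly[q1 q2] /IIP qi]; rewrite /ar !clamp_id// -q2.
  by case: (q).
have xt_sq q : cyl R arc_complex q -> sq R (xt q).
  by move=> [/arc_poly[q1 q2] /IIP qi]; apply/sqP.
exists (fun p => f1' (ar p)), F; split.
- apply: within_setT; have c1 : {within setT, continuous ar}.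
    by apply: continuous_subspaceT; apply: cts_pair; [apply: cts_on_edge|]; rewrite -?/(cts _); cts.
  have c2 : ar @` setT `<=` cyl R arc_complex by move=> _ [p _ <-].
  exact: (within_comp c1 cf1' c2).
- by move=> p ps; have := ff1 _ (arc_cyl p); rewrite /f1 xt_ar.
- exact: cF.
- by move=> p pL; exact: (ff2 p pL).
have Bcyl j v : disk R 2 v -> cyl R arc_complex (B j v).
  by move=> vd; have [_ Bs] := Bc j; apply: Bs; exists v.
exists 'I_m, (fun j v => xt (B j v)); split.
- move=> j; have [[cB Binj] _] := Bc j; split; first split.
  + exact: (within_compT (g := xt) cB cxt).
  + move=> v v' vd v'd E; apply: Binj => //.
    by rewrite -(ar_xt _ (Bcyl j v vd)) E ar_xt//; exact: Bcyl.
  + by move=> _ [v vd <-]; apply: xt_sq; exact: Bcyl.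
- move=> i j _ _ [_ [[v vd <-] [v' v'd E]]]; apply: Bt => //.
  exists (B i v); split; first by exists v.
  exists v' => //; rewrite -(ar_xt _ (Bcyl j v' v'd)) E ar_xt//; exact: Bcyl.
- move=> p ps Fp; have [|j _ [v vo Bv]] := Bi (ar p).
    by split.
  by exists j, v => //; rewrite Bv xt_ar.
(* As [tau2'] is the projection, a set of times different from the whole interval leaves out some
   [t], at which all of [F (_, t)] misses the ball. *)
- move=> j; apply: contrapT => H; apply: (Bf j).
  apply/seteqP; split => [_ [[x t] [[xL ti] _] <-]|t ti].
    by rewrite tau2E.
  apply: contrapT => H2; apply: H; exists t; first exact/IIP.
  move=> x xL [_ [v vd <-] E]; apply: H2; exists (x, t); last by rewrite tau2E.
  by split; [split|exists (B j v); [exists v|rewrite -E ar_xt//; exact: Bcyl]].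
Qed.

Lemma open_sub_sq (U : set (R * R)) p : open U -> U `<=` sq R -> U p ->
  0 < p.1 < 1 /\ 0 < p.2 < 1.
Proof.
rewrite openE => oU Us /oU; rewrite /interior => /nbhs_ballP[r /= r0 H].
have B (x y : R) : `|x| < r -> `|y| < r -> sq R (p.1 + x, p.2 + y).
  by move=> xr yr; apply/Us/H; split; rewrite /ball/= opprD addNKr normrN.
have n0 : `|0 : R| < r by rewrite normr0.
have n1 : `|r / 2| < r by rewrite gtr0_norm; lra.
have n2 : `|- (r / 2)| < r by rewrite normrN.
have /sqP[/= h1 _] := B _ _ n1 n0; have /sqP[/= h2 _] := B _ _ n2 n0.
have /sqP[/= _ h3] := B _ _ n0 n1; have /sqP[/= _ h4] := B _ _ n0 n2.
by split; lra.
Qed.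

(* A path spread over the square as [w p.2] is recovered on the side [p.1 = 0],
   which the balls of a fracture do not meet. *)
Lemma FRP_arcs_disjoint : FRP_star X -> arcs_disjoint (X := X).
Proof.
move=> FR w L al e cw cal e0.
have cf : cts (fun p : R * R => w p.2) by cts.
have [g [F [cg wg cF alF [J [b [bP _ bint _]]]]]] := FRP_fracture FR cf cal e0.
have i0 : 0 <= (0 : R) <= 1 by rewrite lexx ler01.
have cylP x : polyhedron R L x -> cyl R L (x, 0) by move=> xL; split => //; exact/IIP.
exists (fun t => g (0, t)), (fun x => F (x, 0)); split.
- split; first by cts.
  have c1 : {within polyhedron R L, continuous (fun x : 'rV[R]_(vert L) => (x, 0 : R))}.
    by apply: continuous_subspaceT; rewrite -/(cts _); cts.
  by apply: (within_comp c1 cF) => _ [x xL <-]; exact: cylP.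
- by move=> t ti; apply: (wg (0, t)); apply/sqP.
- by move=> x /cylP /alF.
move=> t x ti xL E; have [||j jt] := bint (0, t); first by apply/sqP.
  by exists (x, 0) => //; exact: cylP.
have [bp bs] := bP j.
have isq : cell_int (b j) `<=` sq R.
  by apply: subset_trans bs; apply: image_subset; exact: open_disk_sub.
by have [+ _] := open_sub_sq (injective_disk_open bp) isq jt; rewrite ltxx.
Qed.

(** Take M = (n + 1) P + 1, with [P] a multiple of a denominator of each rational [x i]. Then M x is
    an integer plus x, hence not an integer when x is rational; for irrational x every positive M
    works. *)
Lemma avoid_grid (I : finType) (x : I -> R) (d : R) : (forall i, 0 < x i < 1) -> 0 < d ->
  exists M : nat, [/\ (0 < M)%N, M%:R^-1 < d & forall i k, M%:R * x i != k%:R].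
Proof.
move=> xi d0.
have : forall i, exists Q : nat, (0 < Q)%N /\
    ((exists k : nat, Q%:R * x i = k%:R) \/ forall q k : nat, (0 < q)%N -> q%:R * x i <> k%:R).
  move=> i; have [[q [q0 [k E]]]|H] :=
    pselect (exists q : nat, (0 < q)%N /\ exists k : nat, q%:R * x i = k%:R).
    by exists q; split => //; left; exists k.
  by exists 1%N; split => //; right => q k q0 E; apply: H; exists q; split => //; exists k.
move=> /choice[Q QP]; pose P := (\prod_i Q i)%N.
have P0 : (0 < P)%N by apply: prodn_gt0 => i; have [] := QP i.
have [n nd] := small_invn d0.
exists (n.+1 * P).+1; split => //.
  apply: lt_trans nd; rewrite ltf_pV2 ?posrE ?ltr0n// ltr_nat ltnS.
  by rewrite leq_pmulr.
move=> i k; apply/eqP; have [Q0 [[l E]|H]] := QP i; last exact: H.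
have [Q' PE] : exists Q', P = (Q' * Q i)%N.
  by exists (\prod_(j | j != i) Q j)%N; rewrite /P (bigD1 i)//= mulnC.
rewrite -natr1 mulrDl mul1r PE mulnA natrM -mulrA E -natrM => E2.
have /andP[x0 x1] := xi i; have E3 : x i = k%:R - (n.+1 * Q' * l)%:R by rewrite -E2 addrC addKr.
have : ((n.+1 * Q' * l)%:R : R) < k%:R by lra.
rewrite ltr_nat => h1; have : (k%:R : R) < (n.+1 * Q' * l)%:R + 1 by lra.
by rewrite natr1 ltr_nat ltnS leqNgt h1.
Qed.

Definition push (h : R) (v : 'rV[R]_2) : 'rV[R]_2 := (Num.max (nrm v) h)^-1 *: v.

Lemma cts_push h : 0 < h -> cts (push h).
Proof.
move=> h0; rewrite /push; cts => v.
by rewrite gt_eqF// lt_max h0 orbT.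
Qed.
Lemma push_disk h v : 0 < h -> disk R 2 (push h v).
Proof.
move=> h0; have m0 : 0 < Num.max (nrm v) h by rewrite lt_max h0 orbT.
by rewrite diskP nrmZ gtr0_norm ?invr_gt0// ler_pdivrMl// mulr1 le_max lexx.
Qed.
Lemma push_sphere h v : 0 < h -> h <= nrm v -> sphere R 2 (push h v).
Proof.
move=> h0 hv; have n0 : 0 < nrm v by exact: lt_le_trans hv.
by rewrite sphereP /push (max_idPl hv) nrmZ gtr0_norm ?invr_gt0// mulVf// gt_eqF.
Qed.
Lemma push_id h v : h <= 1 -> nrm v = 1 -> push h v = v.
Proof. by move=> h1 v1; rewrite /push v1 (max_idPl h1) invr1 scale1r. Qed.

(* The witness moves [b j v] to [b j (push h v)], which is on the boundary of the
   [j]-th ball as soon as [h <= nrm v]. *)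
Lemma push_balls (J : finType) (b : J -> 'rV[R]_2 -> R * R) (h : R) : 0 < h <= 1 ->
  (forall j, cell_param (b j) /\ cell_carrier (b j) `<=` sq R) ->
  trivIset [set: J] (fun j => cell_carrier (b j)) ->
  exists P : R * R -> R * R, [/\ cts P, forall y, sq R y -> sq R (P y),
    forall y, (forall j, ~ cell_int (b j) y) -> P y = y,
    forall j y, cell_carrier (b j) y -> cell_carrier (b j) (P y) &
    forall j y, cell_int (b j) (P y) -> exists2 v, nrm v < h & y = b j v].
Proof.
move=> /andP[h0 h1] bP bT.
have disj i j v v' : disk R 2 v -> disk R 2 v' -> b i v = b j v' -> i = j.
  move=> vd v'd E; apply: bT => //; exists (b i v); split; first by exists v.
  by rewrite E; exists v'.
pose kk j y := xget 0 [set v | disk R 2 v /\ b j v = y].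
have kkE j v : disk R 2 v -> kk j (b j v) = v.
  move=> vd; rewrite /kk; case: xgetP => [v' _ [v'd E]|/(_ v)[]]; last by split.
  by have [[_ bi] _] := bP j; apply: bi.
(* The complement of the ball interiors is closed by invariance of domain, so pasting along closed
   sets applies. *)
pose A (o : option J) := if o is Some j then cell_carrier (b j) else ~` \bigcup_(j in [set: J]) cell_int (b j).
pose g (o : option J) y := if o is Some j then b j (push h (kk j y)) else y.
have ci j : closed (cell_carrier (b j)).
  have [[cb _] _] := bP j; apply: compact_closed; first exact: norm_hausdorff.
  by apply: continuous_compact cb _; exact: compact_disk.
have [|||P cP PE] := @paste _ _ _ A g id.
- case=> [j|] /=; first exact: ci.
  apply: open_closedC; apply: bigcup_open => j _; apply: injective_disk_open.
  by have [] := bP j.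
- case=> [j|] /=; last by apply: continuous_subspaceT => y; exact: cvg_id.
  have [[cb _] _] := bP j.
  have ck : {within cell_carrier (b j), continuous (kk j)}.
    apply: (within_inverse _ (@compact_disk _ _) cb (kkE j)); exact: norm_hausdorff.
  have c1 : {within cell_carrier (b j), continuous (fun y => push h (kk j y))}.
    exact: (within_compT (g := push h) ck (cts_push h0)).
  have c2 : (fun y => push h (kk j y)) @` cell_carrier (b j) `<=` disk R 2.
    by move=> _ [y _ <-]; exact: push_disk.
  exact: (within_comp c1 cb c2).
- have key j y : cell_carrier (b j) y -> A None y -> b j (push h (kk j y)) = y.
    move=> [v vd <-] nint; rewrite kkE// push_id//.
    case: (disk_split vd) => [vo|/sphereP//]; case: nint; exists j => //; by exists v.
  case=> [i|] [j|] y //=.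
  + by move=> [v vd <-] [v' v'd E]; have -> := disj _ _ _ _ vd v'd (esym E).
  + exact: key.
  + by move=> h2 h3; rewrite key.
have {}cP : cts P.
  apply: within_setT; apply: continuous_subspaceW cP => y _.
  have [[j _ [v vo <-]]|H] := pselect ((\bigcup_(j in [set: J]) cell_int (b j)) y).
    by exists (Some j) => //; exists v => //; exact: open_disk_sub.
  by exists None.
have PN y : (forall j, ~ cell_int (b j) y) -> P y = y.
  by move=> H; rewrite (PE None)//= => -[j _ /H].
have PS j v : disk R 2 v -> P (b j v) = b j (push h v).
  by move=> vd; rewrite (PE (Some j)) /= ?kkE//; exists v.
have Pc j y : cell_carrier (b j) y -> cell_carrier (b j) (P y).
  by move=> [v vd <-]; rewrite PS//; exists (push h v) => //; exact: push_disk.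
exists P; split => //.
  move=> y ys; have [[j yj]|H] := pselect (exists j, cell_int (b j) y).
    have [_ bs] := bP j; apply: bs; apply: Pc; case: yj => v vo <-.
    by exists v => //; exact: open_disk_sub.
  by rewrite PN// => j yj; apply: H; exists j.
move=> j y [u uo Py].
have [[i [v vo vy]]|H] := pselect (exists i, cell_int (b i) y); last first.
  have PNy : P y = y by apply: PN => i yi; apply: H; exists i.
  by exfalso; apply: H; exists j, u => //; rewrite Py PNy.
have vd := open_disk_sub vo; have ud := open_disk_sub uo.
have E : b j u = b i (push h v) by rewrite Py -vy PS.
have ij := disj _ _ _ _ ud (push_disk v h0) E; rewrite -ij in E vy.
exists v => //; rewrite ltNge; apply/negP => hv.
have [[_ bi] _] := bP j; have := bi _ _ ud (push_disk v h0) E => uE.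
have := push_sphere h0 hv; rewrite -uE sphereP; move/open_diskP: uo.
by move=> + E1; rewrite E1 ltxx.
Qed.

End FRP_squares.

(** * Blown-up copies on a coarse grid *)

Section coarse_grid.
Context {R : realType} {X : metricType R}.

Definition in_slab (n a : nat) (x : R) := a%:R <= n%:R * x <= a%:R + 1.
Definition slab_clamp (n a : nat) (x : R) : R := Num.max (a%:R / n%:R) (Num.min ((a%:R + 1) / n%:R) x).

Lemma in_slab_exists n x : (0 < n)%N -> 0 <= x <= 1 -> exists a : 'I_n, in_slab n a x.
Proof.
move=> n0 /andP[x0 x1]; have N0 : 0 < n%:R :> R by rewrite ltr0n.
have Nx0 : 0 <= n%:R * x by rewrite mulr_ge0// ltW.
have := truncn_itv Nx0; set k := Num.truncn _ => /andP[k1 k2].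
have [kn|nk] := ltnP k n.
  by exists (Ordinal kn); rewrite /in_slab k1 natr1 ltW.
have E : x = 1.
  apply/eqP; rewrite eq_le x1 -(ler_pM2l N0) mulr1; apply: le_trans k1.
  by rewrite ler_nat.
have nn : (n.-1 < n)%N by rewrite prednK.
exists (Ordinal nn); rewrite /in_slab E mulr1 natr1 /= prednK// lexx andbT ler_nat.
exact: leq_pred.
Qed.

(** The dichotomy behind the construction: the retraction ends on a coarse line or does not move the
    point. *)
Lemma slab_clamp_cases n a x : (0 < n)%N ->
  [\/ n%:R * slab_clamp n a x = a%:R, n%:R * slab_clamp n a x = a%:R + 1 |
    slab_clamp n a x = x /\ in_slab n a x].
Proof.
move=> n0; have N0 : 0 < n%:R :> R by rewrite ltr0n.
have E (y : R) : n%:R * (y / n%:R) = y by rewrite mulrC divfK// gt_eqF.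
have an : a%:R / n%:R <= (a%:R + 1) / n%:R :> R by rewrite ler_pM2r ?invr_gt0//; lra.
rewrite /slab_clamp /in_slab; case: (ltrP _ x) => h1.
  by constructor 2; rewrite (max_idPr an) E.
case: (lerP x) => h2; first by constructor 1.
constructor 3; split => //.
by apply/andP; split; [rewrite -[leLHS]E|rewrite -[leRHS]E]; rewrite ler_pM2l// ltW.
Qed.

Lemma slab_clampP n a x : (0 < n)%N -> in_slab n a (slab_clamp n a x).
Proof.
by move=> n0; rewrite /in_slab; have [->|->|[-> //]] := slab_clamp_cases a x n0; lra.
Qed.

(** The slabs are adjacent and [x] is on their common line. It is blown up to 1 in the left slab and
    to 0 in the right one, and both clamps send it back to that line. *)
Lemma slab_overlap n (a a' : 'I_n) x : in_slab n a x -> in_slab n a' x -> a <> a' ->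
  [/\ ~ 0 < n%:R * x - a%:R < 1, ~ 0 < n%:R * x - a'%:R < 1 &
  slab_clamp n a (n%:R * x - a%:R) = slab_clamp n a' (n%:R * x - a'%:R)].
Proof.
wlog aa' : a a' / (a < a')%N => [W s s' ne|/andP[h1 h2] /andP[h3 h4] _].
  have [lt|gt|/val_inj//] := ltngtP a a'; first exact: W.
  by have [] := W _ _ gt s' s (nesym ne).
have N0 : 0 < n%:R :> R by rewrite ltr0n (leq_trans _ (ltn_ord a)).
have aaR : a%:R + 1 <= a'%:R :> R by rewrite natr1 ler_nat.
have E : n%:R * x = a%:R + 1 by lra.
have E' : a'%:R = a%:R + 1 :> R by lra.
have Ea : n%:R * x - a%:R = 1 by lra.
have Ea' : n%:R * x - a'%:R = 0 by lra.
rewrite Ea Ea' !ltxx andbF; split => //.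
rewrite /slab_clamp E' (min_idPl _); last first.
  by rewrite ler_pdivrMr// mul1r natr1 ler_nat ltn_ord.
rewrite (max_idPr _); last by rewrite ler_pM2r ?invr_gt0//; lra.
by apply/esym/max_idPl; rewrite ge_min divr_ge0 ?orbT// -E' ler0n.
Qed.

(* Each coarse square carries a copy of [g], blown up to the unit square,
   modified by [P], and retracted back onto the coarse square. *)
Definition coarse (n a b : nat) (g : R * R -> X) (P : R * R -> R * R) (p : R * R) :=
  let y := P (n%:R * p.1 - a%:R, n%:R * p.2 - b%:R) in
  g (slab_clamp n a y.1, slab_clamp n b y.2).

(** A common point of two coarse squares is blown up to a point off the open unit square, where [P]
    is the identity; the retractions then agree by [slab_overlap]. *)
Lemma paste_coarse n (g : R * R -> X) (P : R * R -> R * R) : (0 < n)%N -> cts g -> cts P ->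
  (forall y, ~ (0 < y.1 < 1 /\ 0 < y.2 < 1) -> P y = y) ->
  exists2 h : R * R -> X, {within sq R, continuous h} &
    forall (a b : 'I_n) p, in_slab n a p.1 -> in_slab n b p.2 -> h p = coarse n a b g P p.
Proof.
move=> n0 cg cP P1.
have slabE a : [set x : R | in_slab n a x] = (fun x : R => n%:R * x) @^-1` `[a%:R, a%:R + 1].
  by apply/funext => x /=; rewrite in_itv.
have cs a : closed [set x : R | in_slab n a x].
  rewrite slabE; apply: preimage_closed; last exact: itv_closed.
  have cm : cts (fun x : R => n%:R * x) by cts.
  by move=> x _; exact: cm.
have [|||h ch hE] := @paste _ _ ('I_n * 'I_n)%type
  (fun s => [set x : R | in_slab n s.1 x] `*` [set x : R | in_slab n s.2 x]) (fun s => coarse n s.1 s.2 g P) g.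
- by move=> s; exact: closed_rect.
- move=> s; apply: continuous_subspaceT; rewrite -/(cts _) /coarse /slab_clamp.
  by cts.
- move=> [a b] [a' b'] p [/= pa pb] [/= pa' pb']; rewrite /coarse /=.
  have [->|ne] := pselect (a = a').
    have [->//|ne2] := pselect (b = b').
    have [k1 k2 k3] := slab_overlap pb pb' ne2.
    by rewrite !P1//= ?k3// => -[_ ?]; [apply: k2|apply: k1].
  have [k1 k2 k3] := slab_overlap pa pa' ne.
  rewrite !P1 /= ?k3//; try by move=> -[? _]; first [apply: k2|apply: k1].
  have [->//|ne2] := pselect (b = b').
  by have [_ _ ->] := slab_overlap pb pb' ne2.
exists h; last by move=> a b p pa pb; rewrite (hE (a, b)).
apply: continuous_subspaceW ch => p /sqP[p1 p2].
have [a pa] := in_slab_exists n0 p1; have [b pb] := in_slab_exists n0 p2.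
by exists (a, b).
Qed.

End coarse_grid.

(** * Separating the centres and concluding *)

Section FRP_to_P_DADP.
Context {R : realType} {X : metricType R}.

(** [m j] is the cell of the [M]-grid that contains the centre of the [j]-th ball. Any two centres
    differ by at least [d] in some coordinate, so 1 / M < d separates them; no centre is on a grid
    line, so small disks around them stay in their cells. *)
Lemma center_cells (J : finType) (b : J -> 'rV[R]_2 -> R * R) :
  (forall j, cell_param (b j) /\ cell_carrier (b j) `<=` sq R) ->
  trivIset [set: J] (fun j => cell_carrier (b j)) ->
  exists (M : nat) (h : R) (m : J -> nat * nat), [/\ (0 < M)%N, 0 < h <= 1,
    forall j v, nrm v < h -> (m j).1%:R < M%:R * (b j v).1 < (m j).1%:R + 1 /\
      (m j).2%:R < M%:R * (b j v).2 < (m j).2%:R + 1,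
    forall j, ((m j).1 < M)%N /\ ((m j).2 < M)%N & injective m].
Proof.
move=> bP bT.
have o0 : open_disk R 2 0 by apply/open_diskP; rewrite nrm0.
pose c j := b j 0.
have ci j : 0 < (c j).1 < 1 /\ 0 < (c j).2 < 1.
  have [bp bs] := bP j; apply: (open_sub_sq (injective_disk_open bp)); last by exists 0.
  by apply: subset_trans bs; apply: image_subset; exact: open_disk_sub.
have [d d0 dP] : exists2 d : R, 0 < d & forall ij : J * J, ij.1 <> ij.2 ->
    d <= `|(c ij.1).1 - (c ij.2).1| \/ d <= `|(c ij.1).2 - (c ij.2).2|.
  apply: (fin_min (P := fun (ij : J * J) d => ij.1 <> ij.2 ->
    d <= `|(c ij.1).1 - (c ij.2).1| \/ d <= `|(c ij.1).2 - (c ij.2).2|)).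
    move=> ij r r' _ rr H /H[h|h]; [left|right]; exact: le_trans h.
  move=> [i j] /=; have [->|ne] := eqVneq i j; first by exists 1.
  have [E1|n1] := eqVneq (c i).1 (c j).1; last first.
    by exists `|(c i).1 - (c j).1|; [rewrite normr_gt0 subr_eq0|left].
  have [E2|n2] := eqVneq (c i).2 (c j).2; last first.
    by exists `|(c i).2 - (c j).2|; [rewrite normr_gt0 subr_eq0|right].
  case/eqP: ne; apply: bT => //; exists (c i); split; exists 0 => //; try exact: open_disk_sub.
  by rewrite -/(c j) [LHS]surjective_pairing -E1 -E2 -surjective_pairing.
pose x (jb : J * bool) := if jb.2 then (c jb.1).1 else (c jb.1).2.
have [|M [M0 Md Mx]] := avoid_grid (x := x) _ d0.
  by move=> [j []]; rewrite /x /=; have [] := ci j.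
have MR : 0 < M%:R :> R by rewrite ltr0n.
have fl (z : R) : 0 < z < 1 -> (forall k : nat, M%:R * z != k%:R) ->
    (Num.truncn (M%:R * z) < M)%N /\
    (Num.truncn (M%:R * z))%:R < M%:R * z < (Num.truncn (M%:R * z))%:R + 1.
  move=> zi zk; have Mz : 0 <= M%:R * z by apply: mulr_ge0; lra.
  have := truncn_itv Mz; rewrite -natr1 => /andP[k1 k2].
  have k3 : (Num.truncn (M%:R * z))%:R < M%:R * z by rewrite lt_neqAle k1 eq_sym zk.
  split; last by rewrite k3.
  by rewrite -(ltr_nat R); apply: lt_trans k3 _; rewrite gtr_pMr//; lra.
have f1 j := fl (c j).1 (ci j).1 (Mx (j, true)).
have f2 j := fl (c j).2 (ci j).2 (Mx (j, false)).
pose m j := (Num.truncn (M%:R * (c j).1), Num.truncn (M%:R * (c j).2)).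
have [h h0 hP] : exists2 h : R, 0 < h & forall j v, nrm v < h ->
    (m j).1%:R < M%:R * (b j v).1 < (m j).1%:R + 1 /\
    (m j).2%:R < M%:R * (b j v).2 < (m j).2%:R + 1.
  apply: (fin_min (P := fun j h => forall v, nrm v < h ->
    (m j).1%:R < M%:R * (b j v).1 < (m j).1%:R + 1 /\
    (m j).2%:R < M%:R * (b j v).2 < (m j).2%:R + 1)).
    by move=> j r r' _ rr H v vr; apply: H; exact: lt_le_trans rr.
  move=> j; have [_ /andP[f11 f12]] := f1 j; have [_ /andP[f21 f22]] := f2 j.
  pose e := Num.min (Num.min (M%:R * (c j).1 - (m j).1%:R) ((m j).1%:R + 1 - M%:R * (c j).1))
    (Num.min (M%:R * (c j).2 - (m j).2%:R) ((m j).2%:R + 1 - M%:R * (c j).2)) / M%:R.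
  have e0 : 0 < e by rewrite divr_gt0// !lt_min !subr_gt0 f11 f12 f21 f22.
  have [[cb _] _] := bP j.
  have [r r0 rP] : exists2 r : R, 0 < r & forall v, disk R 2 v -> nrm v < r ->
      `|(c j).1 - (b j v).1| < e /\ `|(c j).2 - (b j v).2| < e.
    move/subspace_continuousP: cb => /(_ _ (open_disk_sub o0)).
    move/(_ (ball (c j) e) (nbhsx_ballx _ _ e0)); rewrite /fmap /= /within /= nbhs_simpl /=.
    move=> /nbhs_ballP[r /= r0 H]; exists r => // v vd vr.
    have [] := H v _ vd; last by rewrite /ball/=.
    by rewrite -ball_normE /ball_ /= sub0r normrN; apply: le_lt_trans vr; exact: mxnorm_le_nrm.
  exists (Num.min 1 r); first by rewrite lt_min r0 ltr01.
  move=> v; rewrite lt_min => /andP[v1 vr].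
  have vd : disk R 2 v by apply/diskP; exact: ltW.
  have [k1 k2] := rP v vd vr.
  move: k1 k2; rewrite /e !ltr_pdivlMr// !lt_min => /andP[/andP[k1 k2] _] /andP[_ /andP[k3 k4]].
  have nM (y z : R) : `|y - z| * M%:R = `|M%:R * y - M%:R * z|.
    by rewrite -mulrBr normrM (gtr0_norm MR) mulrC.
  move: k1 k2 k3 k4; rewrite !nM !ltr_norml => /andP[? ?] /andP[? ?] /andP[? ?] /andP[? ?].
  by split; lra.
exists M, (Num.min 1 h), m; split => //.
- by rewrite lt_min h0 ltr01 ge_min lexx.
- by move=> j v; rewrite lt_min => /andP[_]; exact: hP.
- by move=> j; have [k1 _] := f1 j; have [k2 _] := f2 j.
move=> i j [E1 E2]; apply: contrapT => ne.
have Md1 : 1 < M%:R * d by rewrite -ltr_pdivrMl// mulr1.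
have [_ k1] := f1 i; have [_ k2] := f1 j; have [_ k3] := f2 i; have [_ k4] := f2 j.
move: k1 k2 k3 k4; rewrite E1 E2 => k1 k2 k3 k4.
have N (y z : R) : d <= `|y - z| -> 1 < `|M%:R * y - M%:R * z|.
  by move=> h1; rewrite -mulrBr normrM (gtr0_norm MR); apply: lt_le_trans Md1 _; rewrite ler_pM2l.
by have [/N|/N] := dP (i, j) ne; rewrite /= ltNge => /negP; apply; rewrite ler_norml; lra.
Qed.

Lemma FRP_P_DADP (lcX : locally_contractible X) : FRP_star X -> P_DADP_star X.
Proof.
move=> FR f L al e [cf _] [cal _] e0; have e10 : 0 < e / 8 by lra.
pose g0 (p : R * R) := f (sqd (csq p)).
have cg0 : cts g0.
  have c1 : {within setT, continuous (fun p : R * R => sqd (csq p))}.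
    have := @sqd_cts R => cs.
    by apply: continuous_subspaceT; rewrite -/(cts _); cts.
  apply: within_setT; apply: (within_comp c1 cf) => _ [p _ <-].
  by apply/sqd_disk; exact: csq_sq.
have cg0s : {within sq R, continuous g0} by exact: continuous_subspaceT.
have [d d0 dP] := unif_cont compact_sq cg0s e10.
(* The mesh is below the modulus [d], so replacing a point by another one of its coarse square
   changes [g0] by less than [e / 8]. *)
have [n nd] := small_invn d0; move: (n.+1) (ltn0Sn n) nd => {}n n0 nd.
have N0 : 0 < n%:R :> R by rewrite ltr0n.
(* All [n + 1] positions, so the sides of the square are included: the retraction to an outer coarse
   square may land on them. *)
pose lines := [seq (b, k%:R / n%:R : R) | b <- [:: true; false], k <- iota 0 n.+1].
have [|g1 [al1 [c [[cg1 cal1] gg1 aal1 c0 cP]]]] :=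
    clear_lines lcX (s := lines) (FRP_arcs_disjoint FR) cg0 cal _ e10.
  move=> _ /allpairsP[[b k] [_ kn ->]]; move: kn; rewrite mem_iota add0n ltnS => /= kn.
  by rewrite divr_ge0//= ler_pdivrMr// mul1r ler_nat.
have e30 : 0 < Num.min (e / 8) (c / 4) by rewrite lt_min e10; lra.
have [g [F [cg g1g cF alF [J [b [bP bT bint bmiss]]]]]] := FRP_fracture FR cg1 cal1 e30.
have [M [h [m [M0 hi mP mM minj]]]] := center_cells bP bT.
have [h0 _] := andP hi.
have [P [cPP Psq Pid _ Pint]] := push_balls hi bP bT.
have bopen j y : cell_int (b j) y -> 0 < y.1 < 1 /\ 0 < y.2 < 1.
  have [bp bs] := bP j; apply: (open_sub_sq (injective_disk_open bp)).
  by apply: subset_trans bs; apply: image_subset; exact: open_disk_sub.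
have [|H cH HE] := paste_coarse n0 cg cPP.
  by move=> y ny; apply: Pid => j /bopen.
have coarseE p : sq R p -> exists (a a' : 'I_n) y,
    [/\ in_slab n a p.1, in_slab n a' p.2, sq R y, H p = g (slab_clamp n a y.1, slab_clamp n a' y.2) &
      y = P (n%:R * p.1 - a%:R, n%:R * p.2 - a'%:R)].
  move=> /sqP[p1 p2]; have [a pa] := in_slab_exists n0 p1; have [a' pa'] := in_slab_exists n0 p2.
  exists a, a', (P (n%:R * p.1 - a%:R, n%:R * p.2 - a'%:R)); split => //; last exact: HE.
  by apply/Psq/sqP; move: pa pa'; rewrite /in_slab /=; clear; split; lra.
have slab01 (a : 'I_n) (x : R) : in_slab n a x -> 0 <= x <= 1.
  move=> /andP[x1 x2]; have an : a%:R + 1 <= n%:R :> R by rewrite natr1 ler_nat.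
  have a0 : 0 <= a%:R :> R by [].
  by rewrite -(pmulr_rge0 _ N0) -[x <= 1](ler_pM2l N0) mulr1; apply/andP; split; lra.
have csqP (a a' : 'I_n) (y : R * R) : sq R (slab_clamp n a y.1, slab_clamp n a' y.2).
  by apply/sqP; split; apply: slab01; exact: slab_clampP.
have lineP (l : bool) (k : nat) p q : (k <= n)%N -> sq R p ->
    n%:R * (if l then p.1 else p.2) = k%:R -> cyl R L q -> g p <> F q.
  move=> kn ps pk qL E; have [qL1 _] := qL.
  have ln : (l, k%:R / n%:R) \in lines.
    apply/allpairsP; exists (l, k); split; first by case: l {pk}.
      by rewrite mem_iota add0n ltnS.
    by [].
  have pl : on_line (l, k%:R / n%:R) p by rewrite /on_line /= -pk mulrC mulKf// gt_eqF.
  have k1 := cP _ _ _ ln ps pl qL1.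
  have := g1g p ps; have := alF q qL; rewrite !lt_min => /andP[_ k2] /andP[_ k3].
  have := metric_triangle (g1 p) (g p) (al1 q.1); rewrite E.
  by rewrite (metric_sym (F q)); move: k3; rewrite E; lra.
(* A meeting of [H] and [F] lies over an open cell of the grid of mesh 1 / (n M), namely the scaled
   cell of the centre of some ball [j], and its value is in the image of the same ball. *)
have key p q : sq R p -> cyl R L q -> H p = F q ->
    exists (a a' : 'I_n) j, [/\ (a * M + (m j).1)%:R < n%:R * M%:R * p.1 < (a * M + (m j).1)%:R + 1,
      (a' * M + (m j).2)%:R < n%:R * M%:R * p.2 < (a' * M + (m j).2)%:R + 1 &
      (g @` cell_carrier (b j)) (F q)].
  move=> ps qL E; have [a [a' [y [pa pa' ys Hp yE]]]] := coarseE p ps.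
  set z := (slab_clamp n a y.1, slab_clamp n a' y.2) in Hp.
  (* If the retraction moved a coordinate of [y], the value would be taken on a coarse line, where
     [g] misses [F]. *)
  have slabid (l : bool) (k : 'I_n) (x : R) :
      n%:R * slab_clamp n k x = n%:R * (if l then z.1 else z.2) -> slab_clamp n k x = x.
    move=> lE; have [k1|k1|[]//] := slab_clamp_cases k x n0.
      by case: (lineP l k z q (ltnW (ltn_ord k)) (csqP a a' y) _ qL); rewrite -?Hp//= -lE.
    by case: (lineP l k.+1 z q (ltn_ord k) (csqP a a' y) _ qL); rewrite -?Hp//= -lE k1 natr1.
  have y1 : slab_clamp n a y.1 = y.1 by apply: (slabid true).
  have y2 : slab_clamp n a' y.2 = y.2 by apply: (slabid false).
  rewrite /z y1 y2 -surjective_pairing in Hp.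
  have [|j jy] := bint y ys; first by exists q; rewrite // -Hp.
  have jc : cell_carrier (b j) y by case: jy => v vo <-; exists v => //; exact: open_disk_sub.
  exists a, a', j; move: jy; rewrite yE => /Pint[v vh vE].
  have [k1 k2] := mP j v vh; rewrite -vE /= in k1 k2.
  split; [| |by exists y; rewrite // -Hp].
    have -> : n%:R * M%:R * p.1 = M%:R * (n%:R * p.1 - a%:R) + (a * M)%:R by rewrite natrM; ring.
    by rewrite natrD; clear -k1; lra.
  have -> : n%:R * M%:R * p.2 = M%:R * (n%:R * p.2 - a'%:R) + (a' * M)%:R by rewrite natrM; ring.
  by rewrite natrD; clear -k2; lra.
have cylP x (t : R) : polyhedron R L x -> 0 <= t <= 1 -> cyl R L (x, t).
  by move=> xL ti; split => //; exact/IIP.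
have sat x t : polyhedron R L x -> 0 <= t <= 1 -> mdist (al1 x) (F (x, t)) < e / 8.
  by move=> xL ti; have := alF _ (cylP x t xL ti); rewrite lt_min => /andP[].
have i0 : 0 <= (0 : R) <= 1 by rewrite lexx ler01.
have nM0 : (0 < n * M)%N by rewrite muln_gt0 n0.
have nME : (n * M)%:R = n%:R * M%:R :> R by rewrite natrM.
have between (K k : nat) : K%:R < k%:R + 1 :> R -> k%:R < K%:R + 1 :> R -> K = k.
  by rewrite !natr1 !ltr_nat !ltnS => ? ?; apply/eqP; rewrite eqn_leq; apply/andP.
have gsq (c' : 'I_(n * M).*2.+1 * 'I_(n * M).*2.+1) p : gcell c' p -> sq R p.
  by move=> [c1 c2]; apply/sqP; split; [exact: (cl1_itv nM0 c1)|exact: (cl1_itv nM0 c2)].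
have halfE (a0 : nat) : a0%:R = (odd a0)%:R + 2 * (a0./2)%:R :> R.
  by rewrite -[in LHS](odd_double_half a0) -muln2 natrD natrM mulrC.
have skel x t : polyhedron R L x -> 0 <= t <= 1 ->
    ~ ((fun v => H (dsq v)) @` skeleton1 (grid nM0)) (F (x, t)).
  move=> xL ti [v [c' dc vc] E].
  have : (sqd @` gcell c') v by rewrite -gparam_carrier.
  move=> [p pc pv]; move: E; rewrite -pv sqdK => E.
  have [||a [a' [j [k1 k2 _]]]] := key p (x, t) (gsq _ _ pc); [exact: cylP|by []|].
  (* On a grid line the scaled coordinate is an integer, while [key] puts it strictly between
     consecutive integers. *)
  have even (z : R) (a0 K : nat) : ~~ odd a0 -> cl1 (n * M) a0 z ->
      ~ K%:R < n%:R * M%:R * z < K%:R + 1.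
    move=> o; rewrite /cl1 (halfE a0) (negbTE o) normr_le0 subr_eq0 nME add0r -[2 * _ * z]mulrA.
    move: (_ * z) => w /eqP E2 /andP[h1 h2].
    have E3 : w = (a0./2)%:R by clear -E2; lra.
    have [h3 h4] : K%:R < (a0./2)%:R :> R /\ (a0./2)%:R < K%:R + 1 :> R by rewrite -E3.
    by move: h3 h4; rewrite natr1 !ltr_nat ltnS => /ltn_geF ->.
  have [pc1 pc2] := pc; move: dc; rewrite /= /gdim.
  have [q1|q1] := boolP (odd c'.1); last by move=> _; exact: (even _ _ _ q1 pc1 k1).
  have [//|q2] := boolP (odd c'.2); move=> _; exact: (even _ _ _ q2 pc2 k2).
exists (grid nM0), (fun v => H (dsq v)), (fun x => F (x, 0)); split.
- split.
    apply: map_onT; have c1 : {within disk R 2, continuous (@dsq R)}.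
      by apply: continuous_subspaceT; exact: dsq_cts.
    by apply: (within_comp c1 cH) => _ [v vd <-]; exact/dsq_sq.
  move=> v vd; have vs : sq R (dsq v) by exact/dsq_sq.
  have [a [a' [y [pa pa' ys Hp _]]]] := coarseE _ vs.
  set z := (slab_clamp n a y.1, slab_clamp n a' y.2) in Hp; have zs : sq R z := csqP a a' y.
  have := g1g z zs; rewrite Hp lt_min => /andP[k1 _]; have k2 := gg1 z zs.
  have -> : f v = g0 (dsq v) by rewrite /g0 csq_id// dsqK.
  have k3 : mdist (g0 (dsq v)) (g0 z) < e / 8.
    apply: dP => //.
    have near (k : 'I_n) (x x' : R) : in_slab n k x -> in_slab n k x' -> `|x - x'| < d.
      move=> /andP[x1 x2] /andP[x1' x2']; apply: le_lt_trans nd.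
      rewrite -(ler_pM2l N0) mulfV ?gt_eqF// -[in leLHS](gtr0_norm N0) -normrM mulrBr.
      by rewrite ler_norml; lra.
    by split; apply: near; eauto; exact: slab_clampP.
  apply: le_lt_trans (metric_triangle _ (g0 z) _) _.
  by have := metric_triangle (g0 z) (g1 z) (g z); lra.
- split; first split.
  + have c1 : {within polyhedron R L, continuous (fun x : 'rV[R]_(vert L) => (x, 0 : R))}.
      by apply: continuous_subspaceT; rewrite -/(cts _); cts.
    by apply: (within_comp c1 cF) => _ [x xL <-]; exact: cylP.
  + by move=> _ [x xL <-]; exact: skel.
  + move=> x xL; have k1 := aal1 x xL; have k2 := sat x 0 xL i0.
    by apply: le_lt_trans (metric_triangle _ (al1 x) _) _; move: k1 k2 => /=; lra.
move=> c' dc.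
have [t ti tP] : exists2 t, 0 <= t <= 1 & forall x p, polyhedron R L x -> gcell c' p ->
    H p <> F (x, t).
  have odd2 (K a0 : nat) (z : R) : odd a0 -> cl1 (n * M) a0 z ->
      K%:R < n%:R * M%:R * z < K%:R + 1 -> K = a0./2.
    move=> o; rewrite /cl1 (halfE a0) o nME /= mulr1n -[2 * _ * z]mulrA ler_norml; move: (_ * z) => w.
    by move=> /andP[h1 h2] /andP[h3 h4]; apply: between; clear -h1 h2 h3 h4; lra.
  (* A 2-cell has odd numbers, whose halves index the fine intervals. Modulo [M] they give the
     position inside the coarse square, which determines the ball because [m] is injective. *)
  pose r := (c'.1./2 %% M, c'.2./2 %% M)%N.
  have hit x t p : polyhedron R L x -> 0 <= t <= 1 -> gcell c' p -> H p = F (x, t) ->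
      exists2 j, m j = r & (g @` cell_carrier (b j)) (F (x, t)).
    move=> xL ti pc E.
    have [||a [a' [j [k1 k2 gj]]]] := key p (x, t) (gsq _ _ pc); [exact: cylP|by []|].
    have [pc1 pc2] := pc; move: dc; rewrite /= /gdim => dc.
    have o1 : odd c'.1 by case: (odd c'.1) dc => //; case: odd.
    have o2 : odd c'.2 by case: (odd c'.2) dc => //; case: odd.
    exists j => //; have [m1 m2] := mM j.
    rewrite /r -(odd2 _ _ _ o1 pc1 k1) -(odd2 _ _ _ o2 pc2 k2) !modnMDl !modn_small//.
    exact: surjective_pairing.
  have [[j mj]|H0] := pselect (exists j, m j = r).
    have [t ti tj] := bmiss j; exists t => // x p xL pc E.
    have [j' mj' gj'] := hit x t p xL ti pc E; apply: (tj x xL).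
    by rewrite (minj j j') ?mj.
  (* No ball has its centre in this position, so [F] misses the cell at every time. *)
  exists 0 => // x p xL pc E; have [j mj _] := hit x 0 p xL i0 pc E.
  by apply: H0; exists j.
exists (fun q => F (q.1, q.2 * t)), (fun x => F (x, t)).
have st (s : R) : II R s -> 0 <= s * t <= 1.
  move=> /IIP/andP[s0 s1]; have /andP[t0 t1] := ti.
  by rewrite mulr_ge0//= mulr_ile1.
split; first split.
- have c1 : {within polyhedron R L, continuous (fun x : 'rV[R]_(vert L) => (x, t))}.
    by apply: continuous_subspaceT; rewrite -/(cts _); cts.
  by apply: (within_comp c1 cF) => _ [x xL <-]; exact: cylP.
- move=> _ [x xL <-] [v vc E].
  have : (sqd @` gcell c') v by rewrite -gparam_carrier.
  by move=> [p pc pv]; move: E; rewrite -pv sqdK; exact: tP.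
split.
- split.
    have c1 : {within cyl R L, continuous (fun q : 'rV[R]_(vert L) * R => (q.1, q.2 * t))}.
      by apply: continuous_subspaceT; rewrite -/(cts _); cts.
    by apply: (within_comp c1 cF) => _ [q [qL qi] <-]; split => //; apply/IIP; exact: st.
  by move=> _ [q [qL qi] <-]; apply: skel => //; exact: st.
- by move=> x xL /=; rewrite mul0r mul1r.
(* Each track stays within [e / 8] of [al1 x], so its diameter is at most [e / 4]. *)
move=> x xL; apply: (@le_lt_trans _ _ (e / 4)%:E); last by rewrite lte_fin; clear -e0; lra.
apply: ge_ereal_sup => _ [[z1 z2] [/= [[x1 s1] [/= -> i1] <-] [[x2 s2] [/= -> i2] <-]] <-].
rewrite lee_fin /=; have k1 := sat x _ xL (st _ i1); have k2 := sat x _ xL (st _ i2).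
have := metric_triangle (F (x, s1 * t)) (al1 x) (F (x, s2 * t)).
by rewrite (metric_sym _ (al1 x)); clear -k1 k2; lra.
Qed.

End FRP_to_P_DADP.

Theorem theorem4p6 (R : realType) (X : metricType R)
    (X_ANR : ANR X) (X_fin_dim : finite_dimensional X) :
  P_DADP_star X <-> FRP_star X.
Proof.
by have [lcX _ _] := X_ANR; split; [exact: P_DADP_FRP|exact: FRP_P_DADP].
Qed.
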